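(* Let $K$ be a quartic CM-field that is not biquadratic and not isomorphic to $\mathbb{Q}(\zeta_5)$, let $K_0$ be its real quadratic subfield, and let $\Phi$ be a CM-type of $K$. Let $\mathcal{O}'$ be an order of $K$ stable under complex conjugation, and put $f=[\mathcal{O}_K:\mathcal{O}']$. If $S_{\mathcal{O}_K}\subset S_{\mathcal{O}'}$ (both kernels formed with respect to $\Phi$ and this $f$), then \[ [\mathcal{O}_K:\mathcal{O}']^2 \ \mid\ 2^{40}\,3^{16}\,N_{K_0/\mathbb{Q}}(\Delta_{K/K_0}), \] where $\Delta_{K/K_0}$ is the relative discriminant of $K/K_0$.
   Context: A quartic CM-field $K$ is a totally imaginary quadratic extension of a real quadratic field $K_0$; $x\mapsto\overline{x}$ denotes complex conjugation on $K$. An order is a subring of $\mathcal{O}_K$ of finite index. Fix a positive integer $f$. For an order $\mathcal{O}$ of $K$ stable under complex conjugation, with $f$ a multiple of $[\mathcal{O}_K:\mathcal{O}]$, let $I_{\mathcal{O}}$ be the group (under componentwise multiplication) of pairs $(\mathfrak{a},\alpha)$ with $\mathfrak{a}$ an invertible fractional $\mathcal{O}$-ideal coprime to $f$ and $\alpha\in K_0$ totally positive with $\mathfrak{a}\overline{\mathfrak{a}}=\alpha\mathcal{O}$; let $P_{\mathcal{O}}$ be the subgroup of pairs $(x\mathcal{O},x\overline{x})$ with $x\in K^\times$, $x\mathcal{O}$ coprime to $f$; the polarised ideal class group is $\mathfrak{C}(\mathcal{O})=I_{\mathcal{O}}/P_{\mathcal{O}}$. Invertible $\mathcal{O}$-ideals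 coprime to $f$ correspond bijectively to fractional $\mathcal{O}_K$-ideals coprime to $f$ via $\mathfrak{a}\mapsto\mathfrak{a}\mathcal{O}_K$. A CM-type $\Phi$ of $K$ is a set of representatives of the embeddings $K\to\mathbb{C}$ modulo complex conjugation. Its reflex field $K^r\subset\mathbb{C}$ is the field generated by the values of $N_\Phi(x)=\prod_{\phi\in\Phi}\phi(x)$, $x\in K$. Let $K^c$ be the normal closure of $K$ and $S$ the set of embeddings $K^c\to\mathbb{C}$ extending elements of $\Phi$; the reflex type is $\Phi^r=\{\psi^{-1}|_{K^r}:\psi\in S\}$, and the reflex type norm is $N_{\Phi^r}(y)=\prod_{\phi\in\Phi^r}\phi(y)\in K$ for $y\in K^r$. It extends to ideals: for a fractional $\mathcal{O}_{K^r}$-ideal $\mathfrak{a}$, $N_{\Phi^r}(\mathfrak{a})$ is the fractional $\mathcal{O}_K$-ideal with $N_{\Phi^r}(\mathfrak{a})\mathcal{O}_{K^c}=\prod_{\phi\in\Phi^r}\phi(\mathfrak{a})\mathcal{O}_{K^c}$. Let $I_{K^r}(f)$ be the group of fractional $\mathcal{O}_{K^r}$-ideals coprime to $f$. The map $I_{K^r}(f)\to\mathfrak{C}(\mathcal{O})$, $\mathfrak{a}\mapsto(N_{\Phi^r}(\mathfrak{a}),N_{K^r/\mathbb{Q}}(\mathfrak{a}))$ (the first entry viewed as the corresponding $\mathcal{O}$-ideal coprime to $f$) is a homomorphism, and $S_{\mathcal{O}}$ denotes its kernel. *)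

(* Defs.v *)
(* Number fields are modelled as subfields of the field
   algC of complex algebraic numbers; all sets are Prop-valued predicates
   on algC.  Complex conjugation is algC's conjugation  x^*. *)
From mathcomp Require Import all_boot all_order all_algebra all_field.
Set Implicit Arguments. Unset Strict Implicit. Unset Printing Implicit Defensive.
Import Order.TTheory GRing.Theory Num.Theory.
Local Open Scope ring_scope.

Definition cset := algC -> Prop.

(* set equality *)
Definition seteq (A B : cset) : Prop := forall z, A z <-> B z.

(* subfield of C *)
Definition is_subfield (F : cset) : Prop :=
  F 0 /\ F 1 /\ (forall x y, F x -> F y -> F (x + y)) /\ (forall x, F x -> F (- x))
  /\ (forall x y, F x -> F y -> F (x * y)) /\ (forall x, F x -> x != 0 -> F x^-1).

(* F has degree n over Q: it has a Q-basis with n elements *)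
Definition Qdegree (F : cset) (n : nat) : Prop :=
  exists b : 'I_n -> algC,
    (forall i, F (b i)) /\
    (forall c : 'I_n -> algC, (forall i, c i \in Crat) ->
        \sum_(i < n) c i * b i = 0 -> forall i, c i = 0) /\
    (forall x, F x -> exists c : 'I_n -> algC,
        (forall i, c i \in Crat) /\ x = \sum_(i < n) c i * b i).

(* a (ring) embedding of F into C, given by a function on algC restricted to F *)
Definition is_embedding (F : cset) (s : algC -> algC) : Prop :=
  s 1 = 1 /\ (forall x y, F x -> F y -> s (x + y) = s x + s y)
         /\ (forall x y, F x -> F y -> s (x * y) = s x * s y).

(* two embeddings are equal when they agree on F *)
Definition agree (F : cset) (s t : algC -> algC) : Prop := forall x, F x -> s x = t x.

Definition totally_real (F : cset) : Prop :=
  forall s, is_embedding F s -> forall x, F x -> s x \is Num.real.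

Definition totally_imaginary (F : cset) : Prop :=
  forall s, is_embedding F s -> exists x, F x /\ s x \isn't Num.real.

Definition subset (A B : cset) : Prop := forall z, A z -> B z.

(* K is a quartic CM-field with real quadratic subfield K0:
   K totally imaginary quadratic extension of the totally real quadratic K0 *)
Definition quartic_CM (K K0 : cset) : Prop :=
  is_subfield K /\ is_subfield K0 /\ subset K0 K /\ Qdegree K 4 /\ Qdegree K0 2 /\
  totally_real K0 /\ totally_imaginary K.

(* K = Q(u, v) with u^2, v^2 rational (together with degree 4: biquadratic) *)
Definition biquadratic (K : cset) : Prop :=
  exists u v, K u /\ K v /\ u ^+ 2 \in Crat /\ v ^+ 2 \in Crat /\
    forall x, K x -> exists a b c d, [/\ a \in Crat, b \in Crat, c \in Crat & d \in Crat] /\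
      x = a + b * u + c * v + d * (u * v).

(* Q(zeta_5) inside C *)
Definition Qzeta5 : cset := fun x =>
  exists z : algC, 5.-primitive_root z /\
    exists a b c d, [/\ a \in Crat, b \in Crat, c \in Crat & d \in Crat] /\
      x = a + b * z + c * z ^+ 2 + d * z ^+ 3.

(* F is isomorphic (as a field) to L *)
Definition field_isomorphic (F L : cset) : Prop :=
  exists s, is_embedding F s /\ (forall x, F x -> L (s x)) /\
    (forall y, L y -> exists x, F x /\ y = s x).

(* ring of integers *)
Definition ring_of_integers (F : cset) : cset := fun z => F z /\ z \in Aint.

(* [A : B] = n for additive groups B <= A: n pairwise incongruent
   representatives covering A *)
Definition has_index (A B : cset) (n : nat) : Prop :=
  exists r : 'I_n -> algC,
    (forall i, A (r i)) /\ (forall i j, B (r i - r j) -> i = j) /\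
    (forall x, A x -> exists i, B (x - r i)).

(* an order of F: a subring of O_F of finite index *)
Definition is_order (F O : cset) : Prop :=
  subset O (ring_of_integers F) /\ O 1 /\
  (forall x y, O x -> O y -> O (x - y)) /\ (forall x y, O x -> O y -> O (x * y)) /\
  exists n, has_index (ring_of_integers F) O n.

Definition conj_stable (O : cset) : Prop := forall x, O x -> O x^*.

(* ---------- ideals ---------- *)
(* fractional ideal of the order O *)
Definition frac_ideal (O a : cset) : Prop :=
  a 0 /\ (forall y z, a y -> a z -> a (y + z)) /\ (forall r z, O r -> a z -> a (r * z)) /\
  (exists z, a z /\ z != 0) /\ (exists d : nat, (0 < d)%N /\ forall z, a z -> O (d%:R * z)).

Definition integral_ideal (O a : cset) : Prop := frac_ideal O a /\ subset a O.

(* product of two sets of numbers (finite sums of products) *)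
Definition ideal_mul (a b : cset) : cset := fun z =>
  exists s : seq (algC * algC), (forall p, p \in s -> a p.1 /\ b p.2) /\
    z = \sum_(p <- s) p.1 * p.2.

(* the ideal of R generated by G *)
Definition gen_ideal (R G : cset) : cset := fun z =>
  exists s : seq (algC * algC), (forall p, p \in s -> R p.1 /\ G p.2) /\
    z = \sum_(p <- s) p.1 * p.2.

Definition ideal_prod (R : cset) (l : seq cset) : cset := foldr ideal_mul R l.

Definition principal (O : cset) (x : algC) : cset := fun z => exists y, O y /\ z = x * y.

Definition image (s : algC -> algC) (a : cset) : cset := fun z => exists y, a y /\ z = s y.

Definition invertible (O a : cset) : Prop :=
  frac_ideal O a /\ exists b, frac_ideal O b /\ seteq (ideal_mul a b) O.

(* integral ideal b coprime to f:  b + f O = O *)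
Definition integral_coprime (O : cset) (f : nat) (b : cset) : Prop :=
  forall z, O z -> exists u v, b u /\ O v /\ z = u + f%:R * v.

(* fractional ideal coprime to f: a = b c^-1 with b, c integral invertible
   ideals coprime to f *)
Definition coprime_to (O : cset) (f : nat) (a : cset) : Prop :=
  frac_ideal O a /\
  exists b c, integral_ideal O b /\ invertible O b /\ integral_coprime O f b /\
              integral_ideal O c /\ invertible O c /\ integral_coprime O f c /\
              seteq (ideal_mul a c) b.

(* absolute norm of a fractional ideal a of the maximal order OF: q = N(b)/N(c)
   where a = b c^-1 with b, c integral, N(b) = [OF : b] *)
Definition ideal_norm_is (OF a : cset) (q : algC) : Prop :=
  exists b c (nb nc : nat), integral_ideal OF b /\ integral_ideal OF c /\
    seteq (ideal_mul a c) b /\ has_index OF b nb /\ has_index OF c nc /\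
    q = nb%:R / nc%:R.

(* ---------- CM types and reflex ---------- *)
(* Phi is a set of representatives of the embeddings of K mod complex conjugation *)
Definition CM_type (K : cset) (Phi : seq (algC -> algC)) : Prop :=
  (forall i : 'I_(size Phi), is_embedding K (nth id Phi i)) /\
  forall s, is_embedding K s ->
    exists! i : 'I_(size Phi),
      agree K (nth id Phi i) s \/ agree K (nth id Phi i) (fun x => (s x)^*).

Definition type_norm (Phi : seq (algC -> algC)) (x : algC) : algC :=
  \prod_(p <- Phi) p x.

(* smallest subfield of C containing G *)
Definition gen_field (G : cset) : cset := fun z =>
  forall F, is_subfield F -> subset G F -> F z.

(* reflex field: generated by the type norms *)
Definition reflex_field (K : cset) (Phi : seq (algC -> algC)) : cset :=
  gen_field (fun z => exists x, K x /\ z = type_norm Phi x).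

(* normal closure of K inside C *)
Definition normal_closure (K : cset) : cset :=
  gen_field (fun z => exists s x, is_embedding K s /\ K x /\ z = s x).

(* Phir is the reflex type: (a duplicate-free list of) the embeddings
   psi^-1|_{K^r} with psi : K^c -> C an embedding extending an element of Phi *)
Definition reflex_type (K : cset) (Phi Phir : seq (algC -> algC)) : Prop :=
  let Kr := reflex_field K Phi in
  let Kc := normal_closure K in
  let inv_restr (psi r : algC -> algC) :=
      forall y, Kr y -> Kc (r y) /\ psi (r y) = y in
  let S (psi : algC -> algC) :=
      is_embedding Kc psi /\ exists j : 'I_(size Phi), agree K psi (nth id Phi j) in
  (forall i : 'I_(size Phir), exists psi, S psi /\ inv_restr psi (nth id Phir i)) /\
  (forall psi, S psi -> exists i : 'I_(size Phir), inv_restr psi (nth id Phir i)) /\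
  (forall i j : 'I_(size Phir), agree Kr (nth id Phir i) (nth id Phir j) -> i = j).

(* S_O: kernel of  I_{K^r}(f) -> C(O),  a |-> (N_{Phi^r}(a), N_{K^r/Q}(a)).
   a is in the kernel iff the image pair lies in P_O, i.e. equals
   (xO, x xbar) for some x in K^x with xO coprime to f. *)
Definition S_kernel (K : cset) (Phi Phir : seq (algC -> algC)) (O : cset) (f : nat)
    (a : cset) : Prop :=
  let OK := ring_of_integers K in
  let Kr := reflex_field K Phi in
  let OKr := ring_of_integers Kr in
  let OKc := ring_of_integers (normal_closure K) in
  coprime_to OKr f a /\
  exists (c b : cset) (x : algC),
    (* c = N_{Phi^r}(a), the O_K-ideal with c O_Kc = prod_phi phi(a) O_Kc *)
    frac_ideal OK c /\
    seteq (ideal_mul c OKc) (ideal_prod OKc [seq ideal_mul (image p a) OKc | p <- Phir]) /\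
    (* b = the invertible O-ideal coprime to f corresponding to c *)
    invertible O b /\ coprime_to O f b /\ seteq (ideal_mul b OK) c /\
    (* (b, N(a)) = (xO, x xbar) in P_O *)
    K x /\ x != 0 /\ coprime_to O f (principal O x) /\ seteq b (principal O x) /\
    ideal_norm_is OKr a (x * x^*).

(* relative discriminant of K/K0: the O_K0-ideal generated by
   det(sigma_i(x_j))^2 = (x1 x2bar - x1bar x2)^2, x1, x2 in O_K *)
Definition rel_disc (K K0 : cset) : cset :=
  gen_ideal (ring_of_integers K0)
    (fun z => exists x1 x2, ring_of_integers K x1 /\ ring_of_integers K x2 /\
        z = (x1 * x2^* - x1^* * x2) ^+ 2).

(* Main.v *)
(** The trace of the reflex type, composed with the trace of [Phi], doubles every element
    of [K] that is negated by complex conjugation.  If [y] is an integer of the reflex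
    field coprime to [f], its principal ideal lies in the kernel for the maximal order,
    hence in the kernel for [O']; as the only units of [K] of relative norm 1 are [1] and
    [-1], the reflex type norm of [y] lies in [O'].  The difference of the type norms of
    [1 + e y] and [1 - e y] is [2 e] times the trace of [y], so, working one prime divisor
    of [f] at a time, [O'] contains 12 times the reflex trace of every integer [y] negated
    by conjugation, and therefore [24 (x - x^* )] for every integer [x] of [K].

    The index is then counted along [x |-> x - x^*].  On the imaginary side it divides
    [48 ^ 2].  On the real side [O'] meets [K0] in an order [Z + g O_K0] containing the
    ideal [24 ^ 2 Delta], because [Delta] is generated by the squares of the elements
    [x - x^*]; an ideal contained in that order lies in [g O_K0], which gives
    [g ^ 2 | 24 ^ 4 N(Delta)].

    The index of a principal ideal of the reflex field is computed without determinants: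
    it is invariant under complex conjugation, which reduces it to the real quadratic
    subfield, where the conjugation again preserves the ring of integers. *)
From HB Require Import structures.
Require Import Defs.
From mathcomp Require Import all_boot all_order all_algebra all_field.
From mathcomp Require Import boolp.
From mathcomp Require Import ring zify.
Set Implicit Arguments. Unset Strict Implicit. Unset Printing Implicit Defensive.
Import Order.TTheory GRing.Theory Num.Theory.
Local Open Scope ring_scope.

Local Notation subset := Defs.subset.
Local Notation image := Defs.image.

(** * Indices of additive subgroups *)

(** The hypothesis only places certain norms in [O'], while an index is counted additively, and a
    norm is available only for elements coprime to [f]. For an imaginary [y], both [1 + e y] and
    [1 - e y] divide the rational integer [1 - e^2 A + e^4 B], where [A] and [B] are the trace and
    norm to the rationals of the real quadratic number [y^2]; so one congruence condition on [e]
    serves both. At every prime other than 5 one of [e = 1, 2, 3] satisfies it, and 12 is the least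
    common multiple of the factors [2 e]. At 5 the case [A = 0], [B = -1] defeats every [e] prime to
    5, and [y] is replaced by odd polynomials in [y].

    The two excluded kinds of field enter through the units: a norm-one unit other than a sign would
    put into [K] either an imaginary square root of a rational or a fifth root of unity.

    With 24 = 2 * 12, the count gives 48^4 * 24^4 = 2^28 * 3^8 times the norm of the discriminant,
    which divides the stated bound. *)

Definition addgrp (A : cset) := A 0 /\ forall x y, A x -> A y -> A (x - y).

Lemma addgrpN A x : addgrp A -> A x -> A (- x).
Proof. by case=> A0 AB Ax; rewrite -sub0r; apply: AB. Qed.

Lemma addgrpD A x y : addgrp A -> A x -> A y -> A (x + y).
Proof. by move=> gA Ax Ay; rewrite -[y]opprK; apply: gA.2 => //; apply: addgrpN. Qed.

Lemma addgrp_sum A (I : Type) (r : seq I) (P : pred I) (F : I -> algC) :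
  addgrp A -> (forall i, P i -> A (F i)) -> A (\sum_(i <- r | P i) F i).
Proof.
move=> gA AF; elim/big_ind: _ => //; first by case: gA.
by move=> x y; apply: addgrpD.
Qed.

Lemma addgrpMn A x n : addgrp A -> A x -> A (n%:R * x).
Proof.
move=> gA Ax; elim: n => [|n IHn]; first by rewrite mul0r; case: gA.
by rewrite -addn1 natrD mulrDl mul1r; apply: addgrpD.
Qed.

Lemma addgrpMz A x (k : int) : addgrp A -> A x -> A (k%:~R * x).
Proof.
move=> gA Ax; case: k => k; first exact: addgrpMn.
by rewrite NegzE mulrNz mulNr; apply: addgrpN => //; apply: addgrpMn.
Qed.

Lemma finite_choice (I : finType) (T : Type) (P : I -> T -> Prop) :
  (forall i, exists t, P i t) -> exists h : I -> T, forall i, P i (h i).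
Proof. exact: fin_all_exists. Qed.

Lemma seteq_sym A B : seteq A B -> seteq B A.
Proof. by move=> AB z; split=> /AB. Qed.

Lemma seteq_trans A B C : seteq A B -> seteq B C -> seteq A C.
Proof. by move=> AB BC z; split=> [/AB/BC|/BC/AB]. Qed.

Lemma has_index_ext A A' B B' n :
  seteq A A' -> seteq B B' -> has_index A B n -> has_index A' B' n.
Proof.
move=> AA' BB' [r [Ar [rI rC]]]; exists r; split; first by move=> i; apply/AA'.
split=> [i j /BB'|x /AA' /rC [i /BB']]; first exact: rI.
by exists i.
Qed.

Lemma has_index_fin A B (I : finType) (r : I -> algC) :
  (forall i, A (r i)) -> (forall i j, B (r i - r j) -> i = j) ->
  (forall x, A x -> exists i, B (x - r i)) -> has_index A B #|I|.
Proof.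
move=> Ar rI rC; exists (fun i => r (enum_val i)); split=> //.
split=> [i j /rI /enum_val_inj //|x /rC [i Bi]].
by exists (enum_rank i); rewrite enum_rankK.
Qed.

Lemma index_gt0 A B n : has_index A B n -> A 0 -> (0 < n)%N.
Proof. by move=> [r [_ [_ rC]]] /rC [i _]; case: n i {r rC} => // -[]. Qed.

Lemma index_le A B m n : addgrp B -> has_index A B m -> has_index A B n ->
  (m <= n)%N.
Proof.
move=> gB [r [Ar [rI rC]]] [s [As [sI sC]]].
have /finite_choice [h hP] : forall i, exists j, B (r i - s j).
  by move=> i; apply: sC.
have /leq_card : injective h.
  move=> i j hij; apply: rI; have := gB.2 _ _ (hP i) (hP j).
  by rewrite hij opprB addrA subrK.
by rewrite !card_ord.
Qed.

Lemma index_unique A B m n : addgrp B -> has_index A B m -> has_index A B n ->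
  m = n.
Proof.
move=> gB Am An; apply/eqP; rewrite eqn_leq.
by rewrite (index_le gB Am An) (index_le gB An Am).
Qed.

Lemma index_self A : addgrp A -> has_index A A 1.
Proof.
move=> gA; exists (fun=> 0); split=> [_|]; first by case: gA.
by split=> [i j|x Ax]; [rewrite !ord1 | exists ord0; rewrite subr0].
Qed.

Lemma index_tower A B C m n : addgrp A -> addgrp B -> subset B A -> subset C B ->
  has_index A B m -> has_index B C n -> has_index A C (m * n).
Proof.
move=> gA gB BA CB [r [Ar [rI rC]]] [s [Bs [sI sC]]].
have := @has_index_fin A C ('I_m * 'I_n)%type (fun i => r i.1 + s i.2).
rewrite card_prod !card_ord; apply.
- by move=> [i j] /=; apply: addgrpD; rewrite ?Ar //; apply/BA/Bs.
- move=> [i j] [i' j'] /= Cij.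
  have eqi : i = i'.
    apply: rI; have -> : r i - r i' = (r i + s j - (r i' + s j')) - (s j - s j').
      by ring.
    by apply: gB.2; [apply: CB | apply: gB.2].
  move: Cij; rewrite eqi => Cij; congr (_, _); apply: sI.
  by have -> : s j - s j' = r i' + s j - (r i' + s j') by ring.
- move=> x /rC [i Bi]; have [j Cj] := sC _ Bi.
  by exists (i, j); rewrite /= opprD addrA.
Qed.

(** Redundant covers suffice: the list is thinned until each coset keeps one representative,
    membership in [B] being decided classically. Indices can thereby be shown to exist without being
    computed. *)
Lemma finite_cover_index A B (s : seq algC) : addgrp B ->
  (forall x, x \in s -> A x) ->
  (forall x, A x -> exists2 r, r \in s & B (x - r)) -> exists n, has_index A B n.
Proof.
move=> gB sA sC.
pose e x y := ~~ `[< B (x - y) >].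
suff [t [tp ts tC]] : exists t : seq algC, [/\ pairwise e t,
    {subset t <= s} & forall r, r \in s -> exists2 u, u \in t & B (r - u)].
  exists (size t); exists (fun i => nth 0 t i); split.
    by move=> i; apply/sA/ts/mem_nth.
  split=> [i j Bij|x /sC [r rs Br]].
    move/(pairwiseP 0): tp => tp; apply: val_inj => /=.
    case: (ltngtP i j) => // ij.
      by have := tp i j (ltn_ord i) (ltn_ord j) ij; rewrite /e => /asboolP.
    have := tp j i (ltn_ord j) (ltn_ord i) ij; rewrite /e => /asboolP [].
    by rewrite -opprB; apply: addgrpN.
  have [u ut Bu] := tC _ rs.
  have lt_u : (index u t < size t)%N by rewrite index_mem.
  exists (Ordinal lt_u); rewrite /= nth_index //.
  have -> : x - u = (x - r) + (r - u) by ring.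
  by apply: addgrpD.
elim: s {sA sC} => [|r s [t [tp ts tC]]]; first by exists [::].
have [[u ut Bu]|nB] := pselect (exists2 u, u \in t & B (r - u)).
  exists t; split=> // [x /ts xs|x]; first by rewrite inE xs orbT.
  by rewrite inE => /orP [/eqP->|/tC //]; exists u.
exists (r :: t); split=> /=.
- rewrite tp andbT; apply/allP => u ut; apply/asboolP => Bu.
  by apply: nB; exists u.
- by move=> x; rewrite !inE => /orP [->//|/ts ->]; rewrite orbT.
- move=> x; rewrite inE => /orP [/eqP->|/tC [u ut Bu]].
    by exists r; rewrite ?inE ?eqxx // subrr; case: gB.
  by exists u => //; rewrite inE ut orbT.
Qed.

Lemma index_cover A B n : has_index A B n -> exists s : seq algC,
  (forall x, x \in s -> A x) /\ (forall x, A x -> exists2 r, r \in s & B (x - r)).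
Proof.
move=> [r [Ar [_ rC]]]; exists (codom r); split=> [x /codomP [i ->] //|x /rC [i Bi]].
by exists (r i) => //; apply: codom_f.
Qed.

Lemma index_sub A B C n : addgrp B -> addgrp C -> subset B A -> has_index A C n ->
  exists k, has_index B (fun x => B x /\ C x) k.
Proof.
move=> gB gC BA [r [Ar [_ rC]]].
have /finite_choice [b bP] : forall i, exists b,
    B b /\ ((exists2 x, B x & C (x - r i)) -> C (b - r i)).
  move=> i.
  have [[x Bx Cx]|nx] := pselect (exists2 x, B x & C (x - r i)); first by exists x.
  (* A coset of [C] that does not meet [B] gets the dummy [0]; no element of [B] is ever assigned to
     it. *)
  by exists 0; split=> //; case: gB.
apply: (@finite_cover_index _ _ (codom b)).
- split; first by case: gB; case: gC.
  by move=> x y [Bx Cx] [By Cy]; split; [apply: gB.2|apply: gC.2].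
- by move=> x /codomP [i ->]; case: (bP i).
- move=> x Bx; have [i Ci] := rC _ (BA _ Bx).
  have [Bb Cb] := bP i; have {}Cb : C (b i - r i) by apply: Cb; exists x.
  exists (b i); first exact: codom_f.
  split; first exact: gB.2.
  have -> : x - b i = (x - r i) - (b i - r i) by ring.
  by apply: gC.2.
Qed.

(** Finiteness of both factors is part of the conclusion: many indices below arise by squeezing a
    group between two others of known index. *)
Lemma index_between A B C n : addgrp A -> addgrp B -> addgrp C ->
  subset B A -> subset C B -> has_index A C n ->
  exists m k, [/\ has_index A B m, has_index B C k & n = (m * k)%N].
Proof.
move=> gA gB gC BA CB AC.
have [s [sA sC]] := index_cover AC.
have [m AB] : exists m, has_index A B m.
  apply: (finite_cover_index gB sA) => x /sC [r rs Cr].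
  by exists r => //; apply: CB.
have [k BC] := index_sub gB gC BA AC.
have {}BC : has_index B C k.
  by apply: has_index_ext BC => // x; split=> [[]//|Cx]; split=> //; apply: CB.
exists m, k; split=> //; apply: (index_unique gC AC).
exact: index_tower gA gB BA CB AB BC.
Qed.

(** Multiplicativity along the exact sequence formed by the kernel and image of [t]. Applied to
    [t x = x - x^*], it splits the index of [O'] into a real and an imaginary factor. *)
Lemma index_exact A B (t : algC -> algC) n : addgrp A -> addgrp B -> subset B A ->
  (forall x y, t (x - y) = t x - t y) -> has_index A B n ->
  exists h g, [/\ has_index (image t A) (image t B) h,
    has_index (fun x => A x /\ t x = 0) (fun x => B x /\ t x = 0) g & n = (h * g)%N].
Proof.
move=> gA gB BA tB AB.
have t0 : t 0 = 0 by have := tB 0 0; rewrite !subrr.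
have [s [sA sC]] := index_cover AB.
have gtB : addgrp (image t B).
  split; first by exists 0; split; [case: gB | rewrite t0].
  move=> _ _ [x [Bx ->]] [y [By ->]]; exists (x - y); rewrite tB.
  by split=> //; apply: gB.2.
have [h Ah] : exists h, has_index (image t A) (image t B) h.
  apply: (@finite_cover_index _ _ (map t s)) => //.
    by move=> _ /mapP [x xs ->]; exists x; split=> //; apply: sA.
  move=> _ [x [/sC [r rs Br] ->]]; exists (t r); first exact: map_f.
  by exists (x - r).
have gAk : addgrp (fun x => A x /\ t x = 0).
  split; first by split=> //; case: gA.
  move=> x y [Ax tx] [Ay ty]; split; first exact: gA.2.
  by rewrite tB tx ty subrr.
have [g] := index_sub gAk gB (fun x Ax => Ax.1) AB.
move=> /(@has_index_ext _ (fun x => A x /\ t x = 0) _ (fun x => B x /\ t x = 0)) Ag.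
have {}Ag : has_index (fun x => A x /\ t x = 0) (fun x => B x /\ t x = 0) g.
  by apply: Ag => // x; split=> [[[_ ?] ?]//|[Bx tx]]; do !split=> //; apply: BA.
exists h, g; split=> //; apply: (index_unique gB AB).
case: Ah => r [Ar [rI rC]]; case: Ag => k [Ak [kI kC]].
have /finite_choice [a aP] : forall i, exists a, A a /\ r i = t a.
  by move=> i; apply: Ar.
have := @has_index_fin A B ('I_h * 'I_g)%type (fun i => a i.1 + k i.2).
rewrite card_prod !card_ord; apply.
- by move=> [i j] /=; apply: addgrpD => //; [case: (aP i) | case: (Ak j)].
- move=> [i j] [i' j'] /= Bij.
  have eqi : i = i'.
    apply: rI; exists (a i + k j - (a i' + k j')); split=> //.
    have tD x y : t (x + y) = t x + t y.
      by rewrite -{1}[y]opprK tB -[- y]sub0r tB t0 sub0r opprK.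
    rewrite tB !tD (Ak j).2 (Ak j').2 !addr0.
    by rewrite (aP i).2 (aP i').2.
  move: Bij; rewrite eqi => Bij; congr (_, _); apply: kI.
  have kk : k j - k j' = a i' + k j - (a i' + k j') by ring.
  by split; [rewrite kk | rewrite tB (Ak j).2 (Ak j').2 subrr].
- move=> x Ax; have [i [b [Bb tb]]] := rC (t x) (ex_intro _ x (conj Ax erefl)).
  have [j [Bj _]] : exists j, B (x - a i - b - k j) /\ t (x - a i - b - k j) = 0.
    apply: kC; split; first by apply: gA.2; [apply: gA.2 => //; case: (aP i) | apply: BA].
    by rewrite !tB -tb (aP i).2 subrr.
  exists (i, j) => /=; have -> : x - (a i + k j) = (x - a i - b - k j) + b by ring.
  exact: addgrpD.
Qed.

Lemma index_image A B (t : algC -> algC) n :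
  (forall x y, t (x - y) = t x - t y) -> injective t ->
  has_index A B n -> has_index (image t A) (image t B) n.
Proof.
move=> tB tI [r [Ar [rI rC]]]; exists (fun i => t (r i)); split=> [i|].
  by exists (r i).
split=> [i j [b [Bb]]|_ [x [/rC [i Bi] ->]]].
  by rewrite -tB => /tI eqb; apply: rI; rewrite eqb.
by exists i, (x - r i).
Qed.

Lemma image_addgrp A (t : algC -> algC) :
  (forall x y, t (x - y) = t x - t y) -> addgrp A -> addgrp (image t A).
Proof.
move=> tB gA; have t0 : t 0 = 0 by have := tB 0 0; rewrite !subrr.
split; first by exists 0; split; [case: gA | rewrite t0].
move=> _ _ [x [Ax ->]] [y [Ay ->]]; exists (x - y); rewrite tB.
by split=> //; apply: gA.2.
Qed.

Lemma principal_image A z : seteq (image ( *%R z) A) (principal A z).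
Proof. by move=> x; split=> -[y []]; exists y. Qed.

Lemma principal_addgrp A z : addgrp A -> addgrp (principal A z).
Proof.
move=> gA; split; first by exists 0; rewrite mulr0; split=> //; case: gA.
move=> _ _ [x [Ax ->]] [y [Ay ->]]; exists (x - y); rewrite mulrBr.
by split=> //; apply: gA.2.
Qed.

Lemma index_principal A B z n : z != 0 -> has_index A B n ->
  has_index (principal A z) (principal B z) n.
Proof.
move=> z0 /(@index_image _ _ ( *%R z)) AB.
apply: has_index_ext (principal_image _ _) (principal_image _ _) _.
by apply: AB => [x y|]; [rewrite mulrBr | apply: mulfI].
Qed.

(* The sum of the representatives is invariant under translation by [x]. *)
Lemma index_kills A B n x : addgrp A -> addgrp B -> has_index A B n -> A x ->
  B (n%:R * x).
Proof.
move=> gA gB [r [Ar [rI rC]]] Ax.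
have /finite_choice [h hP] : forall i, exists j, B (x + r i - r j).
  by move=> i; apply: rC; apply: addgrpD.
have hI : injective h.
  move=> i j hij; apply: rI; have := gB.2 _ _ (hP i) (hP j).
  by rewrite hij; congr B; ring.
have -> : n%:R * x = \sum_(i < n) (x + r i - r (h i)).
  rewrite sumrB big_split /= sumr_const card_ord mulr_natl.
  by rewrite (reindex_inj hI) /= addrK.
exact: addgrp_sum.
Qed.

(* Both [B : zB] and [A : zA] are computed from the index of zB in A. *)
Lemma index_principal_transfer A B z k N : addgrp A -> addgrp B -> z != 0 ->
  subset B A -> subset (principal A z) A -> subset (principal B z) B ->
  has_index A B k ->
  (has_index A (principal A z) N <-> has_index B (principal B z) N).
Proof.
move=> gA gB z0 BA zA zB AB.
have zAB := index_principal z0 AB.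
have [gzA gzB] := (principal_addgrp z gA, principal_addgrp z gB).
have k0 : (0 < k)%N by apply: index_gt0 AB _; case: gA.
have szAB : subset (principal B z) (principal A z).
  by move=> _ [y [/BA Ay ->]]; exists y.
split=> HN.
  have AzB := index_tower gA gzA zA szAB HN zAB.
  have [m [l [Am Bl eqN]]] := index_between gA gB gzB BA zB AzB.
  rewrite (index_unique gB Am AB) mulnC in eqN.
  suff -> : N = l by [].
  by apply/eqP; rewrite -(eqn_pmul2l k0) -eqN.
have AzB := index_tower gA gB BA zB AB HN.
have [m [l [Am Bl eqN]]] := index_between gA gzA gzB zA szAB AzB.
rewrite (index_unique gzB Bl zAB) mulnC in eqN.
suff -> : N = m by [].
by apply/eqP; rewrite -(eqn_pmul2r k0) -eqN mulnC.
Qed.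

(** * Integers of quadratic fields *)

Definition quad (u : algC) : cset :=
  fun x => exists a b, [/\ a \in Crat, b \in Crat & x = a + b * u].

Lemma quad_inj u a b : u \notin Crat -> a \in Crat -> b \in Crat ->
  a + b * u = 0 -> a = 0 /\ b = 0.
Proof.
move=> uQ Qa Qb eq0; have b0 : b = 0.
  apply: contraNeq uQ => b0; have -> : u = - a / b.
    by apply: (mulIf b0); rewrite divfK // mulrC; apply/eqP; rewrite -addr_eq0 addrC eq0.
  by rewrite rpredM ?rpredN ?rpredV.
by split=> //; move: eq0; rewrite b0 mul0r addr0.
Qed.

(** An automorphism of all of [algC], not just of [quad u]: it applies to every number in the proof,
    preserves [Aint] and can be composed with complex conjugation. *)
Lemma sqrt_conjugate (u : algC) : u ^+ 2 \in Crat -> u \notin Crat ->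
  exists nu : {rmorphism algC -> algC}, nu u = - u.
Proof.
move=> u2Q uQ.
have [Qn [QnC [[|zn []] // [Dz]]] genQn] := num_field_exists [:: u].
pose phi := kHomExtend 1 \1 zn (- zn).
have homQn1: kHom 1 1 (\1%VF : 'End(Qn)) by rewrite kHom1.
have pzn_zk0: root (map_poly \1%VF (minPoly 1 zn)) (- zn).
  rewrite -(fmorph_root QnC) rmorphN /= Dz -map_poly_comp.
  rewrite (@eq_map_poly _ _ _ QnC) => [|a]; last by rewrite /= id_lfunE.
  set p1 := map_poly _ _.
  have Qp1 : p1 \is a polyOver Crat.
    apply/polyOverP => i; rewrite coef_map.
    have /vlineP [a ->] : (minPoly 1 zn)`_i \in 1%VS.
      by apply/polyOverP; apply: minPolyOver.
    by rewrite /= rmorphZ_num rmorph1 mulr1 Crat_rat.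
  (* Splitting into even and odd parts gives [p1(u) = a + b u] with [a], [b] rational. Both vanish
     because [u] is irrational, hence [p1(-u) = a - b u = 0]. *)
  have: root p1 u by rewrite -Dz fmorph_root root_minPoly.
  rewrite !rootE -[p1]poly_even_odd.
  rewrite !(hornerD, hornerM, horner_comp, hornerX) mulrNN -!expr2.
  set a := (even_poly _).[_]; set b := (odd_poly _).[_] => /eqP ab0.
  have Qe (q : {poly algC}) : q \is a polyOver Crat -> q.[u ^+ 2] \in Crat.
    by move=> Qq; apply: rpred_horner.
  have [-> ->] : a = 0 /\ b = 0; last by rewrite mul0r addr0.
  apply: quad_inj ab0 => //; apply: Qe; apply/polyOverP => i.
    by rewrite coef_even_poly (polyOverP Qp1).
  by rewrite coef_odd_poly (polyOverP Qp1).
have phim : monoid_morphism phi.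
  by apply/kHom_monoid_morphism; rewrite -genQn span_seq1 /= kHomExtendP.
pose phimM := GRing.isMonoidMorphism.Build _ _ phi phim.
pose phiRM : {rmorphism _ -> _} := HB.pack (fun_of_lfun phi) phimM.
have [nu Dnu] := extend_algC_subfield_aut QnC phiRM.
exists nu; rewrite -Dz -Dnu /= -{1}[zn]hornerX /phi.
rewrite (kHomExtend_poly homQn1) ?polyOverX //.
rewrite map_polyE map_id_in => [|?]; last by rewrite id_lfunE.
by rewrite polyseqK hornerX rmorphN.
Qed.

Lemma Crat_denominator x : x \in Crat ->
  exists2 d : nat, (0 < d)%N & d%:R * x \in Num.int.
Proof.
move=> /CratP [a ->]; exists `|denq a|%N; first by rewrite absz_gt0 denq_neq0.
have -> : `|denq a|%N%:R = ratr (denq a)%:~R :> algC.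
  by rewrite ratr_int -[in RHS](gez0_abs (denq_ge0 a)).
by rewrite -rmorphM mulrC -numqE /= ratr_int intr_int.
Qed.

Lemma Aint_sqr z : z ^+ 2 \in Aint -> z \in Aint.
Proof.
move=> Az; apply: (@root_monic_Aint (minCpoly (z ^+ 2) \Po 'X^2)).
- by rewrite rootE horner_comp hornerXn -rootE root_minCpoly.
- rewrite monicE lead_coef_comp ?size_polyXn // lead_coefXn expr1n mulr1.
  by rewrite -monicE minCpoly_monic.
- by apply: polyOver_comp => //; apply: rpredX; apply: polyOverX.
Qed.

(** If the minimal polynomial is [Q X + c], then [c / x = - Q(x)] is an algebraic integer. This
    bounds the denominators of the inverse of a principal ideal. *)
Lemma Aint_inv_multiple x : x \in Aint -> x != 0 ->
  exists2 d : nat, (0 < d)%N & d%:R * x^-1 \in Aint.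
Proof.
move=> Ax x0; pose P := minCpoly x.
have PE : P = drop_poly 1 P * 'X + (P`_0)%:P.
  rewrite {1}[P](esym (poly_take_drop 1 P)) expr1 addrC; congr (_ + _).
  by apply/polyP => i; rewrite coef_take_poly coefC; case: i.
have rP : P.[x] = 0 by apply/rootP; apply: root_minCpoly.
have Qx : (drop_poly 1 P).[x] * x = - P`_0.
  apply/eqP; rewrite -addr_eq0; apply/eqP; rewrite -[RHS]rP [in RHS]PE.
  by rewrite hornerD hornerM hornerX hornerC.
have /intrP [c cE] : P`_0 \in Num.int by apply: (polyOverP Ax).
(* If [c = 0], then [Q] is a rational polynomial of smaller degree vanishing at [x]. *)
have c0 : c != 0.
  apply/eqP => c0; move: Qx; rewrite cE c0 mulr0z oppr0 => /eqP.
  rewrite mulf_eq0 (negPf x0) orbF => dx0.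
  have [q [Dq mq] dvq] := minCpolyP x.
  have dE : drop_poly 1 P = map_poly ratr (drop_poly 1 q).
    by apply/polyP => i; rewrite coef_map !coef_drop_poly /P Dq coef_map.
  have : root (map_poly ratr (drop_poly 1 q)) x by rewrite -dE.
  rewrite dvq => /dvdp_leq; rewrite -size_poly_eq0 size_drop_poly.
  have : (1 < size q)%N.
    by have := size_minCpoly x; rewrite Dq size_map_poly.
  by case: (size q) => [|[|n]] // _ /(_ isT); rewrite subn1 ltnn.
exists `|c|%N; first by rewrite absz_gt0.
have cx : c%:~R * x^-1 \in Aint.
  have -> : c%:~R * x^-1 = - (drop_poly 1 P).[x].
    by apply: (mulIf x0); rewrite divfK // mulNr Qx opprK cE.
  rewrite rpredN; apply: rpred_horner => //; apply/polyOverP => i.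
  by rewrite coef_drop_poly Aint_Cint //; apply: (polyOverP Ax).
have -> : `|c|%N%:R = (sgz c)%:~R * c%:~R :> algC.
  by rewrite -intrM -abszEsg.
by rewrite -mulrA rpredM // Aint_int.
Qed.

Lemma intr_divz_eq (j : int) (k : nat) :
  j%:~R = (j %/ k)%Z%:~R * k%:R + (j %% k)%Z%:~R :> algC.
Proof. by rewrite {1}(divz_eq j k) intrD intrM. Qed.

Section QuadraticIntegers.

Variables (u : algC).
Hypotheses (u2Q : u ^+ 2 \in Crat) (uQ : u \notin Crat).

(** For an integer [x = a + b u] the difference [x - nu x = 2 b u] is an algebraic integer, so
    [2 b N] with [N = d u^2] is a rational integer. The element [w] realises the least positive
    value of [2 b N]; Euclidean division by it leaves a rational integer. No case distinction modulo
    4 arises. *)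
Lemma quad_integer_basis : exists2 w, ring_of_integers (quad u) w & w \notin Crat /\
  forall x, ring_of_integers (quad u) x -> exists i j : int, x = i%:~R + j%:~R * w.
Proof.
have [nu nuu] := sqrt_conjugate u2Q uQ.
have u0 : u != 0 by apply: contraNneq uQ => ->; apply: Crat0.
have [d d0 dZ] := Crat_denominator u2Q.
have du2 : (d%:R * u) ^+ 2 \in Num.int.
  by rewrite exprMn expr2 -mulrA rpredM ?natr_int.
have d0C : d%:R != 0 :> algC by rewrite pnatr_eq0 -lt0n.
have Adu : d%:R * u \in Aint by apply/Aint_sqr/Aint_Cint.
have cZ a b : a \in Crat -> b \in Crat -> a + b * u \in Aint ->
    2 * b * u * (d%:R * u) \in Num.int.
  move=> Qa Qb Ax; apply: Cint_rat_Aint.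
    have -> : 2 * b * u * (d%:R * u) = 2 * b * d%:R * u ^+ 2 by ring.
    by apply: rpredM u2Q; rewrite !rpredM ?rpred_nat.
  have -> : 2 * b * u = (a + b * u) - nu (a + b * u).
    by rewrite rmorphD rmorphM (aut_Crat nu Qa) (aut_Crat nu Qb) nuu; ring.
  by rewrite rpredM ?rpredB // Aint_aut.
pose N := u * (d%:R * u).
have N0 : N != 0 by rewrite !mulf_neq0.
pose P k := (0 < k)%N && `[< exists a b, [/\ a \in Crat, b \in Crat,
  a + b * u \in Aint & 2 * b * N = k%:R] >].
have exP : exists k, P k.
  have /intrP [c cE] : 2 * d%:R * u * (d%:R * u) \in Num.int.
    apply: (cZ 0); [exact: Crat0|exact: rpred_nat|by rewrite add0r].
  have NE b : 2 * b * N = 2 * b * u * (d%:R * u) by rewrite /N; ring.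
  have c0 : c != 0.
    by rewrite -(intr_eq0 algC) -cE -NE !mulf_neq0 // pnatr_eq0.
  (* The integer [d u] has a nonzero value of [2 b N]; multiplying it by the sign of [c] makes the
     value positive. *)
  exists `|c|%N; rewrite /P absz_gt0 c0; apply/asboolP.
  exists 0, ((sgz c)%:~R * d%:R).
  split; first exact: Crat0.
  - by rewrite rpredM ?rpred_nat ?rpred_int.
  - by rewrite add0r -mulrA rpredM ?Aint_int.
  have -> : 2 * ((sgz c)%:~R * d%:R) * N = (sgz c)%:~R * (2 * d%:R * N) by ring.
  by rewrite NE cE -intrM -abszEsg.
have [k /andP [k0 /asboolP [a [b [Qa Qb Aw bN]]]] kmin] := ex_minnP exP.
have b0 : b != 0.
  by apply: contraTneq k0 => b0; move: bN; rewrite b0 mulr0 mul0r => /eqP;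
    rewrite eq_sym pnatr_eq0 => /eqP ->.
exists (a + b * u); first by split=> //; exists a, b.
split.
  apply: contra uQ => wQ; have -> : u = (a + b * u - a) / b.
    by rewrite addrC addKr mulrC mulKf.
  by rewrite rpredM ?rpredV ?rpredB.
move=> x [[a' [b' [Qa' Qb' ->]]] Ax].
have /intrP [c cE] : 2 * b' * N \in Num.int.
  by rewrite /N mulrA; apply: (cZ a').
pose j := (c %/ k)%Z; pose r := (c %% k)%Z.
have Qj : j%:~R \in Crat by rewrite rpred_int.
have bE : 2 * (b' - j%:~R * b) * N = r%:~R.
  have -> : 2 * (b' - j%:~R * b) * N = 2 * b' * N - j%:~R * (2 * b * N) by ring.
  by rewrite cE bN {1}(divz_eq c k) intrD intrM /= -/j -/r; ring.
have Ax' : (a' - j%:~R * a) + (b' - j%:~R * b) * u \in Aint.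
  have -> : (a' - j%:~R * a) + (b' - j%:~R * b) * u =
    (a' + b' * u) - j%:~R * (a + b * u) by ring.
  by rewrite rpredB // rpredM // Aint_int.
have r_ge0 : 0 <= r by apply: modz_ge0; rewrite -lt0n in k0 *; case: (k) k0.
have r_lt : r < k by have := @ltz_pmod c k; apply; rewrite ltz_nat.
have r0 : r = 0.
  apply/eqP; apply: contraLR r_lt => r0; rewrite -leNgt.
  have rE : r = `|r|%N by rewrite gez0_abs.
  rewrite rE lez_nat; apply: kmin; rewrite /P absz_gt0 r0; apply/asboolP.
  exists (a' - j%:~R * a), (b' - j%:~R * b); split=> //.
  - by rewrite rpredB ?rpredM.
  - by rewrite rpredB ?rpredM.
  - by rewrite bE {1}rE.
have b'0 : b' - j%:~R * b = 0.
  apply/eqP; move/eqP: bE; rewrite r0 mulr0z mulf_eq0 (negPf N0) orbF.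
  by rewrite mulf_eq0 pnatr_eq0.
have /intrP [i iE] : a' - j%:~R * a \in Num.int.
  by apply: Cint_rat_Aint; [rewrite rpredB ?rpredM|move: Ax'; rewrite b'0 mul0r addr0].
exists i, j; rewrite -iE; move/eqP: b'0; rewrite subr_eq0 => /eqP ->; ring.
Qed.

End QuadraticIntegers.

Lemma eq_of_lt_modulus (i j n : nat) (a : int) : (i < n)%N -> (j < n)%N ->
  Posz i = Posz j + Posz n * a -> i = j.
Proof.
by move=> lt_in lt_jn eqij; have [a0|a0|a0] := ltrgt0P a; nia.
Qed.

(** * Subgroups and ideals of a lattice with basis [1], [w] *)

Section IntegerBasis.

Variables (A : cset) (w : algC).
Hypotheses (gA : addgrp A) (A1 : A 1) (Aw : A w) (wQ : w \notin Crat).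
Hypothesis A_span : forall x, A x -> exists i j : int, x = i%:~R + j%:~R * w.

Lemma span_inj (i j i' j' : int) :
  i%:~R + j%:~R * w = i'%:~R + j'%:~R * w -> i = i' /\ j = j'.
Proof.
move=> /eqP; rewrite -subr_eq0 => /eqP eq0.
have [] := @quad_inj w (i%:~R - i'%:~R) (j%:~R - j'%:~R) wQ _ _ _.
- by rewrite rpredB ?rpred_int.
- by rewrite rpredB ?rpred_int.
- by rewrite -[RHS]eq0; ring.
by move=> /eqP + /eqP; rewrite !subr_eq0 !eqr_int => /eqP -> /eqP ->.
Qed.

Lemma span_mem (i j : int) : A (i%:~R + j%:~R * w).
Proof.
by apply: addgrpD => //; [rewrite -[_%:~R]mulr1|]; apply: addgrpMz.
Qed.

Lemma index_nat_multiple n : (0 < n)%N -> has_index A (principal A n%:R) (n * n).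
Proof.
move=> n0.
have := @has_index_fin A (principal A n%:R) ('I_n * 'I_n)%type
  (fun i => (Posz i.1)%:~R + (Posz i.2)%:~R * w).
rewrite card_prod !card_ord; apply.
- by move=> [i j]; apply: span_mem.
- move=> [i j] [i' j'] /= [y [/A_span [a [b ->]] eqy]].
  have [eqa eqb] : Posz i = Posz i' + Posz n * a /\ Posz j = Posz j' + Posz n * b.
    apply: span_inj; rewrite !intrD !intrM -!pmulrn.
    by move/eqP: eqy; rewrite subr_eq => /eqP ->; ring.
  congr (_, _); apply: val_inj => /=.
    exact: eq_of_lt_modulus (ltn_ord i) (ltn_ord i') eqa.
  exact: eq_of_lt_modulus (ltn_ord j) (ltn_ord j') eqb.
- move=> x /A_span [a [b ->]].
  have nz : (n : int) != 0 by case: (n) n0.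
  have lt_mod (c : int) : (`|(c %% n)%Z| < n)%N.
    by rewrite -ltz_nat gez0_abs ?modz_ge0 // ltz_pmod // ltz_nat.
  exists (Ordinal (lt_mod a), Ordinal (lt_mod b)) => /=.
  exists ((a %/ n)%Z%:~R + (b %/ n)%Z%:~R * w); split; first exact: span_mem.
  rewrite !gez0_abs ?modz_ge0 // {1}(divz_eq a n) {1}(divz_eq b n).
  by rewrite !intrD !intrM -!pmulrn; ring.
Qed.

(* [A / B] is cyclic, generated by [w], so [i + j w] lies in [B] iff [g] divides [j]. *)
Lemma ideal_in_suborder (B I : cset) g : addgrp B -> B 1 -> subset B A ->
  has_index A B g -> subset I B -> (forall x, I x -> I (w * x)) -> A (w * w) ->
  forall x, I x -> principal A g%:R x.
Proof.
move=> gB B1 BA AB IB Iw Aww.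
have BZ (i : int) : B i%:~R by rewrite -[_%:~R]mulr1; apply: addgrpMz.
have g0 : (0 < g)%N by apply: index_gt0 AB _; case: gA.
have ex : exists k, (0 < k)%N && `[< B (k%:R * w) >].
  by exists g; rewrite g0; apply/asboolP; apply: index_kills AB Aw.
have [k /andP [k0 /asboolP Bk] kmin] := ex_minnP ex.
have dvd (j : int) : B (j%:~R * w) -> (k %| j)%Z.
  move=> Bj; have kz : (k : int) != 0 by case: (k) k0.
  apply/dvdz_mod0P; apply/eqP/contraT => r0.
  have rE : (j %% k)%Z = `|(j %% k)%Z|%N by rewrite gez0_abs // modz_ge0.
  have : (k <= `|(j %% k)%Z|)%N.
    apply: kmin; rewrite absz_gt0 r0; apply/asboolP.
    have -> : `|(j %% k)%Z|%N%:R * w = j%:~R * w - (j %/ k)%Z%:~R * (k%:R * w).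
      by rewrite pmulrn -rE [j%:~R](intr_divz_eq j k); ring.
    by apply: gB.2 => //; apply: addgrpMz.
  by rewrite leqNgt -ltz_nat -rE ltz_pmod // ltz_nat.
have ABk : has_index A B k.
  exists (fun i : 'I_k => i%:R * w); split; first by move=> i; apply: addgrpMn.
  split=> [i j|x /A_span [a [b ->]]].
    rewrite -mulrBl !pmulrn -intrB => /dvd /dvdzP [c eqc].
    apply: val_inj => /=; apply: (@eq_of_lt_modulus _ _ _ c) (ltn_ord i) (ltn_ord j) _.
    by rewrite mulrC -eqc addrC subrK.
  have kz : (k : int) != 0 by case: (k) k0.
  have lt_mod : (`|(b %% k)%Z| < k)%N.
    by rewrite -ltz_nat gez0_abs ?modz_ge0 // ltz_pmod // ltz_nat.
  exists (Ordinal lt_mod); rewrite /= pmulrn gez0_abs ?modz_ge0 //.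
  have -> : a%:~R + b%:~R * w - (b %% k)%Z%:~R * w =
     a%:~R + (b %/ k)%Z%:~R * (k%:R * w).
    by rewrite [b%:~R](intr_divz_eq b k); ring.
  by apply: addgrpD => //; apply: addgrpMz.
rewrite (index_unique gB AB ABk).
have Bdvd (i j : int) : B (i%:~R + j%:~R * w) -> (k %| j)%Z.
  move=> Bij; apply: dvd.
  have -> : j%:~R * w = i%:~R + j%:~R * w - i%:~R by ring.
  exact: gB.2.
have [s [t wwE]] := A_span Aww.
move=> x Ix; have [i [j xE]] := A_span (BA _ (IB _ Ix)).
have kj : (k %| j)%Z by apply: (Bdvd i); rewrite -xE; apply: IB.
(* [w * x] is again in [I], hence in [B], and its [w]-coordinate is [i + j * t]. *)
have ki : (k %| i)%Z.
  suff : (k %| i + j * t)%Z by rewrite rpredDr // dvdz_mulr.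
  apply: (Bdvd (j * s)); have := IB _ (Iw _ Ix); congr B.
  by rewrite xE mulrDr mulrCA wwE intrD !intrM; ring.
move: kj ki => /dvdzP [b eqb] /dvdzP [a eqa].
exists (a%:~R + b%:~R * w); split; first exact: span_mem.
by rewrite xE eqa eqb !intrM -pmulrn; ring.
Qed.

End IntegerBasis.

(** * Quartic CM-fields *)

Ltac rmem := repeat first [ assumption | exact: rpred0 | exact: rpred1 | exact: rpred_nat
  | exact: rpred_int | rewrite rpredN | rewrite rpredV | apply: rpredX | apply: rpredD
  | apply: rpredM ].

Lemma subfield_nat F n : is_subfield F -> F n%:R.
Proof.
move=> [F0 [F1 [FD _]]]; elim: n => [//|n IHn].
by rewrite -addn1 natrD; apply: (FD).
Qed.

Lemma subfield_int F (k : int) : is_subfield F -> F k%:~R.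
Proof.
move=> sF; case: k => k; first exact: subfield_nat.
have [_ [_ [_ [FN _]]]] := sF.
by rewrite NegzE mulrNz; apply: (FN k.+1%:R); apply: subfield_nat.
Qed.

Lemma subfield_Crat F x : is_subfield F -> x \in Crat -> F x.
Proof.
move=> sF /CratP [a ->]; rewrite -[a]divq_num_den fmorph_div /= !ratr_int.
have [_ [_ [_ [_ [FM FV]]]]] := sF.
apply: (FM); first exact: subfield_int.
by apply: (FV); [exact: subfield_int | rewrite intr_eq0 denq_neq0].
Qed.

Lemma subfieldB F x y : is_subfield F -> F x -> F y -> F (x - y).
Proof. by move=> [_ [_ [FD [FN _]]]] Fx Fy; apply: (FD) => //; apply: (FN). Qed.

Lemma subfieldV F x : is_subfield F -> F x -> F x^-1.
Proof.
move=> [F0 [_ [_ [_ [_ FV]]]]] Fx.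
by have [->|x0] := eqVneq x 0; [rewrite invr0 | apply: (FV)].
Qed.

Lemma id_embedding F : is_embedding F id.
Proof. by []. Qed.

Lemma aut_embedding F (nu : {rmorphism algC -> algC}) : is_embedding F nu.
Proof. by split; [apply: rmorph1 | split=> x y _ _; rewrite ?rmorphD ?rmorphM]. Qed.

Lemma Qdegree_dependent F n (v : 'I_n.+1 -> algC) : Qdegree F n ->
  (forall i, F (v i)) -> exists2 c : 'I_n.+1 -> algC, (forall i, c i \in Crat) &
    (exists i, c i != 0) /\ \sum_i c i * v i = 0.
Proof.
move=> [b [_ [_ span]]] Fv.
have /finite_choice [C CP] : forall i, exists C : 'I_n -> rat,
    v i = \sum_j ratr (C j) * b j.
  move=> i; have [c [Qc ->]] := span _ (Fv i).
  have /finite_choice [a aP] : forall j, exists a, c j = ratr a.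
    by move=> j; apply/CratP.
  by exists a; apply: eq_bigr => j _; rewrite aP.
pose M : 'M[rat]_(n.+1, n) := \matrix_(i, j) C i j.
have : kermx M != 0.
  rewrite kermx_eq0 /row_free neq_ltn; apply/orP; left.
  by rewrite ltnS rank_leq_col.
case/rowV0Pn => r /sub_kermxP rM r0.
exists (fun i => ratr (r 0 i)); first by move=> i; apply: Crat_rat.
split.
  case/rV0Pn: r0 => i ri; exists i.
  by rewrite fmorph_eq0.
under eq_bigr do rewrite CP big_distrr /=.
rewrite exchange_big /= big1 // => j _.
have /rowP/(_ j) := rM; rewrite !mxE => rMj.
transitivity (ratr (\sum_i r 0 i * M i j) * b j); last by rewrite rMj rmorph0 mul0r.
rewrite rmorph_sum big_distrl; apply: eq_bigr => i _ /=.
by rewrite mxE rmorphM mulrA.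
Qed.

Lemma quadratic_field F : is_subfield F -> Qdegree F 2 ->
  exists d, [/\ d ^+ 2 \in Crat, d \notin Crat & seteq F (quad d)].
Proof.
move=> sF dF; have [F0 [F1 [FD [FN [FM FV]]]]] := sF.
have [t Ft tQ] : exists2 t, F t & t \notin Crat.
  apply: contrapT => nt; have FQ x : F x -> x \in Crat.
    by move=> Fx; apply: contrapT => /negP xQ; apply: nt; exists x.
  have [b [Fb [free _]]] := dF.
  pose i1 : 'I_2 := lift ord0 ord0.
  (* If all of [F] were rational, [b i1] and [- b ord0] would be the coefficients of a relation
     between the two basis elements, so both would vanish. *)
  have b0 : b ord0 = 0 /\ b i1 = 0.
    pose c (i : 'I_2) := if i == ord0 then b i1 else - b ord0.
    have c0 : forall i, c i = 0.
      apply: free; first by move=> i; rewrite /c; case: ifP => _; rewrite ?rpredN FQ.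
      by rewrite !big_ord_recl big_ord0 /c /=; ring.
    split; last by have := c0 ord0.
    by apply/eqP; rewrite -oppr_eq0; have := c0 i1; rewrite /c => /= ->.
  have /(_ ord0) : forall i : 'I_2, (fun=> 1 : algC) i = 0.
    apply: free => [i|]; first exact: Crat1.
    by rewrite !big_ord_recl big_ord0 -/i1 b0.1 b0.2; ring.
  by move/eqP; rewrite oner_eq0.
have Ft2 x : F x -> quad t x.
  move=> Fx; pose v (i : 'I_3) := [:: 1; t; x]`_i.
  have [c Qc [[i ci] eq0]] : exists2 c : 'I_3 -> algC, (forall i, c i \in Crat) &
      (exists i, c i != 0) /\ \sum_i c i * v i = 0.
    by apply: Qdegree_dependent dF _ => -[[|[|[|]]]].
  pose c0 := c ord0; pose c1 := c (lift ord0 ord0).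
  pose c2 := c (lift ord0 (lift ord0 ord0)).
  move: eq0; rewrite !big_ord_recl big_ord0 /v /= -/c0 -/c1 -/c2 mulr1 addr0 => eq0.
  have c2n : c2 != 0.
    apply: contraNneq ci => c2n; move: eq0; rewrite c2n mul0r addr0 => eq0.
    have [c0n c1n] := quad_inj tQ (Qc _) (Qc _) eq0.
    apply/eqP; case: i => -[|[|[|//]]] lt_i;
      [rewrite -[RHS]c0n|rewrite -[RHS]c1n|rewrite -[RHS]c2n];
      by congr (c _); apply: val_inj.
  exists (- c0 / c2), (- c1 / c2); split; try by rewrite rpredM ?rpredV ?rpredN ?Qc.
  apply: (mulfI c2n); transitivity (- (c0 + c1 * t)); last by field.
  by apply/eqP; rewrite -addr_eq0 addrC -addrA eq0.
have [a [b [Qa Qb t2]]] := Ft2 _ (FM _ _ Ft Ft).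
(* Completing the square in [t^2 = a + b t]. *)
exists (t - b / 2); split.
- have -> : (t - b / 2) ^+ 2 = a + (b / 2) ^+ 2.
    have -> : (t - b / 2) ^+ 2 = t * t - b * t + (b / 2) ^+ 2 by field.
    by rewrite t2; ring.
  by rewrite rpredD // rpredX // rpredM ?rpredV ?rpred_nat.
- apply: contra tQ => dQ; have -> : t = (t - b / 2) + b / 2 by rewrite subrK.
  by rewrite rpredD // rpredM ?rpredV ?rpred_nat.
- move=> x; split=> [/Ft2 [a' [b' [Qa' Qb' ->]]]|[a' [b' [Qa' Qb' ->]]]].
    exists (a' + b' * (b / 2)), b'; split=> //; last by ring.
    by rewrite rpredD // !rpredM ?rpredV ?rpred_nat.
  have FQ := subfield_Crat sF.
  apply: (FD); first exact: (FQ).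
  apply: (FM); first exact: (FQ).
  by apply: subfieldB => //; apply: (FQ); rewrite rpredM ?rpredV ?rpred_nat.
Qed.

Definition quart (u v : algC) : cset := fun x => exists a b c e,
  [/\ a \in Crat, b \in Crat, c \in Crat & e \in Crat] /\ x = a + b * u + (c + e * u) * v.

(* [K0 = Q(d)], [K = K0(a1)] with [a1^2 = p + q d], and [a2] is a conjugate of [a1] with
   [a2^2 = p - q d]; the automorphisms [nu1] and [nu2] of [algC] restrict to the
   conjugations of [Q(d)] and of [Q(a1 a2)]. *)
Record cm_data (K K0 : cset) (d a1 a2 p q : algC) (nu1 nu2 : {rmorphism algC -> algC}) :
    Prop := CMData {
  cm_K : seteq K (quart d a1);
  cm_K0 : seteq K0 (quad d);
  cm_d2 : d ^+ 2 \in Crat;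
  cm_d : d \notin Crat;
  cm_dJ : d^* = d;
  cm_p : p \in Crat;
  cm_q : q \in Crat;
  cm_q0 : q != 0;
  cm_a1 : a1 ^+ 2 = p + q * d;
  cm_a2 : a2 ^+ 2 = p - q * d;
  cm_a1J : a1^* = - a1;
  cm_a2J : a2^* = - a2;
  cm_a10 : a1 != 0;
  cm_a20 : a2 != 0;
  cm_m : a1 * a2 \notin Crat;
  cm_nu1d : nu1 d = - d;
  cm_nu1a : nu1 a1 = a2;
  cm_nu2 : nu2 (a1 * a2) = - (a1 * a2) }.

(** The five elements [1, d, a, d a, x] are dependent over the rationals. The coefficient of [x]
    cannot vanish: [K0] is real and [a] is not, so [1] and [a] are independent over [K0]. *)
Lemma quartic_over_quadratic K K0 d a :
  is_subfield K -> Qdegree K 4 -> subset K0 K -> seteq K0 (quad d) -> d \notin Crat ->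
  (forall x, K0 x -> x \is Num.real) -> K a -> a \isn't Num.real ->
  seteq K (quart d a).
Proof.
move=> sK dK K0K K0d dQ K0R Ka aR x; have [_ [_ [KD [_ [KM _]]]]] := sK.
have FQ := subfield_Crat sK.
have Kd : K d.
  by apply/K0K/K0d; exists 0, 1; rewrite Crat0 Crat1 add0r mul1r.
split=> [Kx|[a' [b' [c' [e' [[Qa Qb Qc Qe] ->]]]]]]; last first.
  by apply: (KD); [apply: (KD) | apply: (KM) => //; apply: (KD)];
    try apply: (KM) => //; apply: (FQ).
pose v (i : 'I_5) := [:: 1; d; a; d * a; x]`_i.
have [c Qc [[i ci] eq0]] : exists2 c : 'I_5 -> algC, (forall i, c i \in Crat) &
    (exists i, c i != 0) /\ \sum_i c i * v i = 0.
  apply: Qdegree_dependent dK _ => -[[|[|[|[|[|//]]]]] lt_i]; rewrite /v //=.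
  - by case: sK => _ [].
  - exact: (KM).
pose c0 := c ord0; pose c1 := c (lift ord0 ord0).
pose c2 := c (lift ord0 (lift ord0 ord0)).
pose c3 := c (lift ord0 (lift ord0 (lift ord0 ord0))).
pose c4 := c (lift ord0 (lift ord0 (lift ord0 (lift ord0 ord0)))).
move: eq0; rewrite !big_ord_recl big_ord0 /v /= -/c0 -/c1 -/c2 -/c3 -/c4 mulr1 addr0 => eq0.
have K0c k j : K0 (c k + c j * d) by apply/K0d; exists (c k), (c j).
have c4n : c4 != 0.
  apply: contraNneq ci => c4n; move: eq0; rewrite c4n mul0r addr0 => eq0.
  have eq1 : (c0 + c1 * d) + (c2 + c3 * d) * a = 0 by rewrite -[RHS]eq0; ring.
  have eq2 : c2 + c3 * d = 0.
    apply: contraNeq aR => nz; have -> : a = - (c0 + c1 * d) / (c2 + c3 * d).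
      by apply: (mulIf nz); rewrite divfK // mulrC; apply/eqP; rewrite -addr_eq0 addrC eq1.
    by rewrite realM ?realV ?realN ?K0R // /c0 /c1 /c2 /c3.
  move: eq1; rewrite eq2 mul0r addr0 => eq1.
  have [c0n c1n] := quad_inj dQ (Qc _) (Qc _) eq1.
  have [c2n c3n] := quad_inj dQ (Qc _) (Qc _) eq2.
  apply/eqP; case: i => -[|[|[|[|[|//]]]]] lt_i;
    [rewrite -[RHS]c0n|rewrite -[RHS]c1n|rewrite -[RHS]c2n|rewrite -[RHS]c3n|
     rewrite -[RHS]c4n]; by congr (c _); apply: val_inj.
exists (- c0 / c4), (- c1 / c4), (- c2 / c4), (- c3 / c4).
split; first by split; rewrite rpredM ?rpredV ?rpredN ?Qc.
apply: (mulfI c4n).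
transitivity (- (c0 + (c1 * d + (c2 * a + c3 * (d * a))))); last by field.
by apply/eqP; rewrite -addr_eq0; apply/eqP; rewrite -[RHS]eq0; ring.
Qed.

(** The exclusion of biquadratic fields is used twice, for [q != 0] and for the irrationality of
    [a1 * a2]. These two facts allow cyclic and non-normal fields to be treated alike, whether or
    not [a2] lies in [K]. *)
Lemma CM_structure K K0 : quartic_CM K K0 -> ~ biquadratic K ->
  exists d a1 a2 p q nu1 nu2, cm_data K K0 d a1 a2 p q nu1 nu2.
Proof.
move=> [sK [sK0 [K0K [dK [dK0 [K0R KI]]]]]] nbiq.
have [d [d2 dQ K0d]] := quadratic_field sK0 dK0.
have {}K0R x : K0 x -> x \is Num.real by apply: (K0R id); apply: id_embedding.
have K0_d : K0 d by apply/K0d; exists 0, 1; rewrite Crat0 Crat1 add0r mul1r.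
have dR := K0R _ K0_d.
have dJ : d^* = d by apply/CrealP.
have [a [Ka aR]] := KI id (id_embedding _).
have Ka_ := quartic_over_quadratic sK dK K0K K0d dQ K0R.
have [_ [_ [KD [KN [KM KV]]]]] := sK.
have FQ := subfield_Crat sK.
have [s0 [t0 [s [t [[Qs0 Qt0 Qs Qt] a2E]]]]] : quart d a (a * a).
  by apply/(Ka_ a) => //; apply: (KM).
(* Completing the square over [K0], so that [a1^2] lies in [quad d]. *)
pose a1 := a - (s + t * d) / 2.
have Kst : K ((s + t * d) / 2).
  apply: (KM); last by apply: (FQ); rewrite rpredV rpred_nat.
  by apply: (KD); [apply: (FQ) | apply: (KM); [apply: (FQ) | apply: (K0K)]].
have stR : (s + t * d) / 2 \is Num.real.
  have [sR tR] := (Creal_Crat Qs, Creal_Crat Qt).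
  by rewrite realM ?realV ?realn // realD // realM.
have Ka1 : K a1 by apply: subfieldB.
have a1R : a1 \isn't Num.real.
  by apply: contra aR => a1R; rewrite -[a](subrK ((s + t * d) / 2)) realD.
have {}Ka1d := Ka_ _ Ka1 a1R.
have [p [q [Qp Qq a1E]]] : quad d (a1 ^+ 2).
  exists (s0 + (s ^+ 2 + t ^+ 2 * d ^+ 2) / 4), (t0 + s * t / 2); split.
  - by rmem.
  - by rmem.
  - have -> : a1 ^+ 2 = a * a - (s + t * d) * a + ((s + t * d) / 2) ^+ 2.
      by rewrite /a1; field.
    by rewrite a2E; field.
clearbody a1.
have [QR pJ qJ] : [/\ {subset Crat <= Creal}, p^* = p & q^* = q].
  by split; [exact: Creal_Crat | exact: conj_Crat | exact: conj_Crat].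
(* A non-real number with a real square is negated by conjugation. *)
have sqJ z e : z \isn't Num.real -> z ^+ 2 = p + e * d -> e \in Crat -> z^* = - z.
  move=> zR zE Qe; have /eqP : (z^*) ^+ 2 = z ^+ 2.
    by rewrite -rmorphXn /= zE rmorphD rmorphM /= dJ pJ (conj_Crat Qe).
  rewrite eqf_sqr => /orP [/eqP zJ|/eqP //].
  by case/negP: zR; apply/CrealP.
have a1J : a1^* = - a1 by apply: sqJ a1E Qq.
have q0 : q != 0.
  apply/eqP => q0; apply: nbiq; exists d, a1; split; first exact: (K0K).
  split=> //; split=> //; split; first by rewrite a1E q0 mul0r addr0.
  move=> x /Ka1d [a' [b' [c' [e' [[? ? ? ?] ->]]]]].
  by exists a', b', c', e'; split=> //; ring.
have [nu1 nu1d] := sqrt_conjugate d2 dQ.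
have [a2 nu1a] : exists a2, nu1 a1 = a2 by exists (nu1 a1).
have a2sq : a2 ^+ 2 = p - q * d.
  rewrite -nu1a -rmorphXn /= a1E rmorphD rmorphM /= nu1d.
  by rewrite (aut_Crat nu1 Qp) (aut_Crat nu1 Qq) mulrN.
(* Total imaginarity is applied to the embedding [nu1]: a real [a2] would make all of [nu1(K)]
   real. *)
have a2R : a2 \isn't Num.real.
  have [x [Kx]] := KI nu1 (aut_embedding _ _); apply: contra => a2R.
  have [a' [b' [c' [e' [[Qa Qb Qc Qe] ->]]]]] := (Ka1d x).1 Kx.
  rewrite !(rmorphD, rmorphM) /= nu1d nu1a.
  rewrite (aut_Crat nu1 Qa) (aut_Crat nu1 Qb) (aut_Crat nu1 Qc) (aut_Crat nu1 Qe).
  have [[Ra Rb] [Rc Re]] := ((QR _ Qa, QR _ Qb), (QR _ Qc, QR _ Qe)).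
  by rmem.
have a2J : a2^* = - a2 by apply: (sqJ _ (- q)); rewrite ?rpredN // mulNr.
have a10 : a1 != 0 by apply: contraNneq a1R => ->; apply: real0.
have a20 : a2 != 0 by apply: contraNneq a2R => ->; apply: real0.
(* If [r = a1 a2] were rational, [a1 + a2] and [a1 - a2] would lie in [K] with rational squares
   [2 p + 2 r] and [2 p - 2 r], and they generate [K] since their product is [2 q d]. *)
have mQ : a1 * a2 \notin Crat.
  apply/negP => rQ; apply: nbiq; pose r := a1 * a2.
  have a2E' : a2 = r / a1 by rewrite /r mulrC mulKf.
  have Ka2 : K a2.
    by rewrite a2E'; apply: (KM); [apply: (FQ) | apply: (KV)].
  exists (a1 + a2), (a1 - a2); split; first exact: (KD).
  split; first exact: subfieldB.
  have u2 : (a1 + a2) ^+ 2 = 2 * p + 2 * r.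
    have -> : (a1 + a2) ^+ 2 = a1 ^+ 2 + a2 ^+ 2 + 2 * (a1 * a2) by ring.
    by rewrite a1E a2sq -/r; ring.
  have v2 : (a1 - a2) ^+ 2 = 2 * p - 2 * r.
    have -> : (a1 - a2) ^+ 2 = a1 ^+ 2 + a2 ^+ 2 - 2 * (a1 * a2) by ring.
    by rewrite a1E a2sq -/r; ring.
  split; first by rewrite u2; rmem.
  split; first by rewrite v2; rmem.
  move=> x /Ka1d [a' [b' [c' [e' [[Qa Qb Qc Qe] ->]]]]].
  exists a', (c' / 2 + e' * (2 * p - 2 * r) / (4 * q)),
    (c' / 2 + e' * (2 * p + 2 * r) / (4 * q)), (b' / (2 * q)); split.
    by split; rmem.
  have -> : d = (a1 + a2) * (a1 - a2) / (2 * q).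
    have -> : (a1 + a2) * (a1 - a2) = a1 ^+ 2 - a2 ^+ 2 by ring.
    by rewrite a1E a2sq; field.
  by rewrite -u2 -v2; field.
have m2 : (a1 * a2) ^+ 2 \in Crat.
  have -> : (a1 * a2) ^+ 2 = p ^+ 2 - q ^+ 2 * d ^+ 2.
    by rewrite exprMn a1E a2sq; ring.
  by rmem.
have [nu2 nu2m] := sqrt_conjugate m2 mQ.
by exists d, a1, a2, p, q, nu1, nu2; split.
Qed.

(** * CM-types *)

Section Embeddings.

Variables (F : cset) (s : algC -> algC).
Hypotheses (sF : is_subfield F) (es : is_embedding F s).

Lemma embedding0 : s 0 = 0.
Proof.
have [F0 _] := sF; have [_ [sD _]] := es.
by have := sD _ _ F0 F0; rewrite addr0 => s00; apply: (addrI (s 0)); rewrite addr0 -s00.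
Qed.

Lemma embeddingN x : F x -> s (- x) = - s x.
Proof.
have [F0 [_ [_ [FN _]]]] := sF; have [_ [sD _]] := es.
move=> Fx; have := sD _ _ Fx (FN _ Fx); rewrite subrr embedding0 => /eqP.
by rewrite eq_sym addrC addr_eq0 => /eqP.
Qed.

Lemma embeddingB x y : F x -> F y -> s (x - y) = s x - s y.
Proof.
have [F0 [_ [_ [FN _]]]] := sF; have [_ [sD _]] := es.
by move=> Fx Fy; rewrite sD ?embeddingN //; apply: FN.
Qed.

Lemma embedding_inj x y : F x -> F y -> s x = s y -> x = y.
Proof.
move=> Fx Fy sxy; apply/eqP; rewrite -subr_eq0; apply: contraT => nz.
have Fxy := subfieldB sF Fx Fy; have [s1 [_ sM]] := es.
have /eqP := sM _ _ Fxy (subfieldV sF Fxy).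
by rewrite mulfV // s1 embeddingB // sxy subrr mul0r oner_eq0.
Qed.

Lemma embedding_Crat x : x \in Crat -> s x = x.
Proof.
have [s1 [sD sM]] := es.
have sn n : s n%:R = n%:R.
  elim: n => [|n IHn]; first exact: embedding0.
  rewrite -addn1 natrD sD ?IHn ?s1 //; first exact: subfield_nat.
  by case: sF => _ [].
have sz (k : int) : s k%:~R = k%:~R.
  case: k => k; first exact: sn.
  rewrite NegzE mulrNz; rewrite (embeddingN (subfield_nat k.+1 sF)).
  by congr (- _); apply: sn.
move=> Qx; have := Qx; move/CratP=> [a xE].
have dn : (denq a)%:~R != 0 :> algC by rewrite intr_eq0 denq_neq0.
have xd : x * (denq a)%:~R = (numq a)%:~R.
  by rewrite xE -[a in ratr a]divq_num_den fmorph_div /= !ratr_int divfK.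
apply: (mulIf dn); rewrite -{1}(sz (denq a)) -sM; first by rewrite xd sz.
  exact: subfield_Crat.
exact: subfield_int.
Qed.

Lemma quart_mem a b c e u v : a \in Crat -> b \in Crat -> c \in Crat -> e \in Crat ->
  F u -> F v -> F (a + b * u + (c + e * u) * v).
Proof.
move=> Qa Qb Qc Qe Fu Fv; have FQ := subfield_Crat sF.
have [_ [_ [FD [_ [FM _]]]]] := sF.
by apply: (FD); [|apply: (FM) => //]; apply: (FD); try apply: (FM) => //; apply: FQ.
Qed.

Lemma embedding_quart a b c e u v :
  a \in Crat -> b \in Crat -> c \in Crat -> e \in Crat -> F u -> F v ->
  s (a + b * u + (c + e * u) * v) = a + b * s u + (c + e * s u) * s v.
Proof.
move=> Qa Qb Qc Qe Fu Fv; have FQ := subfield_Crat sF.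
have [_ [_ [FD [_ [FM _]]]]] := sF.
have [_ [sD sM]] := es; have sQ := embedding_Crat.
have Fb : F (b * u) by apply: (FM) => //; apply: FQ.
have Fe : F (e * u) by apply: (FM) => //; apply: FQ.
have Fc : F (c + e * u) by apply: (FD) => //; apply: FQ.
have Fa : F (a + b * u) by apply: (FD) => //; apply: FQ.
rewrite (sD _ _ Fa (FM _ _ Fc Fv)) (sD _ _ (FQ _ Qa) Fb) (sM _ _ (FQ _ Qb) Fu).
rewrite (sM _ _ Fc Fv) (sD _ _ (FQ _ Qc) Fe) (sM _ _ (FQ _ Qe) Fu).
by rewrite (sQ _ Qa) (sQ _ Qb) (sQ _ Qc) (sQ _ Qe).
Qed.

End Embeddings.

Lemma gen_field_subfield G : is_subfield (gen_field G).
Proof.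
split; first by move=> F [F0 _] _.
split; first by move=> F [_ [F1 _]] _.
split; first by move=> x y Fx Fy F sF GF; apply: sF.2.2.1; [apply: Fx|apply: Fy].
split; first by move=> x Fx F sF GF; apply: sF.2.2.2.1; apply: Fx.
split; first by move=> x y Fx Fy F sF GF; apply: sF.2.2.2.2.1; [apply: Fx|apply: Fy].
by move=> x Fx x0 F sF GF; apply: sF.2.2.2.2.2 => //; apply: Fx.
Qed.

Lemma seq_two_indices (T : Type) (x0 : T) (s : seq T) (i j : 'I_(size s)) : i <> j ->
  (forall k, k = i \/ k = j) ->
  s = [:: nth x0 s i; nth x0 s j] \/ s = [:: nth x0 s j; nth x0 s i].
Proof.
move=> nij ijT.
have sz : size s = 2%N.
  have : [set: 'I_(size s)] = [set i; j].
    by apply/setP => k; rewrite !inE; case: (ijT k) => ->; rewrite eqxx ?orbT.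
  move/(congr1 (fun A : {set _} => #|A|)); rewrite cardsT card_ord cards2 => ->.
  by have -> : (i != j) = true by apply/eqP.
have nij' : val i <> val j by move=> /val_inj.
have [ltj lti] := (ltn_ord j, ltn_ord i).
case: s sz i j {ijT nij} lti ltj nij' => [//|x [//|y [|//]]] _ [i /= _] [j /= _].
by case: i => [|[|//]]; case: j => [|[|//]]; auto.
Qed.

Section CM.

Variables (K K0 : cset) (d a1 a2 p q : algC) (nu1 nu2 : {rmorphism algC -> algC}).
Hypotheses (sK : is_subfield K) (cm : cm_data K K0 d a1 a2 p q nu1 nu2).

Let m := a1 * a2.

Lemma K_d : K d.
Proof.
apply/(cm_K cm); exists 0, 1, 0, 0; split; last by ring.
by split; rewrite ?Crat0 ?Crat1.
Qed.

Lemma K_a1 : K a1.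
Proof.
apply/(cm_K cm); exists 0, 0, 1, 0; split; last by ring.
by split; rewrite ?Crat0 ?Crat1.
Qed.

Lemma d_neq0 : d != 0.
Proof. by apply: contraNneq (cm_d cm) => ->; apply: Crat0. Qed.

Lemma m_sqr : m ^+ 2 = p ^+ 2 - q ^+ 2 * d ^+ 2.
Proof. by rewrite exprMn (cm_a1 cm) (cm_a2 cm); ring. Qed.

Lemma embedding_agree (s t : algC -> algC) : is_embedding K s -> is_embedding K t ->
  s d = t d -> s a1 = t a1 -> agree K s t.
Proof.
move=> es et sd sa x /(cm_K cm) [a [b [c [e [[Qa Qb Qc Qe] ->]]]]].
have [Kd Ka1] := (K_d, K_a1).
by rewrite (embedding_quart sK es) // (embedding_quart sK et) // sd sa.
Qed.

Lemma sqr_eq_pm (x y : algC) : x ^+ 2 = y ^+ 2 -> x = y \/ x = - y.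
Proof. by move/eqP; rewrite eqf_sqr => /orP [] /eqP ->; [left|right]. Qed.

Lemma embedding_a1 (s : algC -> algC) : is_embedding K s ->
  (s d = d /\ (s a1 = a1 \/ s a1 = - a1)) \/
  (s d = - d /\ (s a1 = a2 \/ s a1 = - a2)).
Proof.
move=> es; have [s1 [sD sM]] := es.
have sQ := embedding_Crat sK es; have FQ := subfield_Crat sK.
have [_ [_ [KD [_ [KM _]]]]] := sK.
have [Kd Ka1] := (K_d, K_a1).
have sX x : K x -> s (x ^+ 2) = s x ^+ 2 by move=> Kx; rewrite !expr2 sM.
have Kq : K (q * d) by apply: (KM) => //; apply: FQ; apply: cm_q cm.
have sa1 : s a1 ^+ 2 = p + q * s d.
  have [Qp Qq] := (cm_p cm, cm_q cm).
  by rewrite -sX // (cm_a1 cm) (sD _ _ (FQ _ Qp)) // (sM _ _ (FQ _ Qq)) // (sQ _ Qp) (sQ _ Qq).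
have : s d ^+ 2 = d ^+ 2 by rewrite -sX // sQ // (cm_d2 cm).
case/sqr_eq_pm => sd; [left|right]; split=> //; rewrite sd in sa1;
  apply: sqr_eq_pm; rewrite sa1 ?(cm_a1 cm) ?(cm_a2 cm) //; ring.
Qed.

Lemma conj_cm : [/\ d^* = d, a1^* = - a1 & a2^* = - a2].
Proof. by case: cm. Qed.

(* The two embeddings in [Phi] are given by automorphisms of [algC], sending [a1] to
   [+-a1] and [+-a2] in some order. *)
Definition type_data (Phi : seq (algC -> algC)) (t1 t2 : {rmorphism algC -> algC}) :=
  [/\ exists f1 f2, [/\ Phi = [:: f1; f2], agree K f1 t1 & agree K f2 t2],
   (t1 d = d /\ t2 d = - d) \/ (t1 d = - d /\ t2 d = d)
   & [/\ t1 a1 ^+ 2 = p + q * t1 d, t2 a1 ^+ 2 = p + q * t2 d,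
        (t1 a1)^* = - t1 a1, (t2 a1)^* = - t2 a1 &
        t1 a1 * t2 a1 = m \/ t1 a1 * t2 a1 = - m]].

(** The four embeddings form two conjugate pairs, those of the identity and of [nu1]. Each pair
    meets [Phi] in exactly one index, which forces [Phi] to have two entries, in unknown order. *)
Lemma CM_type_data Phi : CM_type K Phi -> exists t1 t2, type_data Phi t1 t2.
Proof.
move=> [Pe Pu]; have [dJ a1J a2J] := conj_cm.
pose cn : {rmorphism algC -> algC} := Num.conj.
pose cn1 : {rmorphism algC -> algC} := (cn \o nu1)%FUN.
have eid : is_embedding K id by [].
have e1 := aut_embedding K nu1.
have [i [iP iu]] := Pu _ eid; have [j [jP ju]] := Pu _ e1.
have {iP}[t1 t1P [t1d t1a]] : exists2 t : {rmorphism algC -> algC},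
    agree K (nth id Phi i) t & t d = d /\ (t a1 = a1 \/ t a1 = - a1).
  by case: iP => iP; [exists idfun | exists cn] => //; split=> //; [left|right].
have {jP}[t2 t2P [t2d t2a]] : exists2 t : {rmorphism algC -> algC},
    agree K (nth id Phi j) t & t d = - d /\ (t a1 = a2 \/ t a1 = - a2).
  case: jP => jP; [exists nu1 | exists cn1] => //; split.
  - exact: cm_nu1d cm.
  - by left; apply: cm_nu1a cm.
  - by rewrite /= (cm_nu1d cm) rmorphN /= dJ.
  - by right; rewrite /= (cm_nu1a cm) a2J.
have nij : i <> j.
  move=> eij; move: t1P; rewrite eij => t1P.
  have := t2P _ K_d; rewrite t1P ?t1d ?t2d; last exact: K_d.
  by move/eqP; rewrite -addr_eq0 -mulr2n mulrn_eq0 (negPf d_neq0).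
have ijT k : k = i \/ k = j.
  have ek := Pe k.
  have [[kd [ka|ka]]|[kd [ka|ka]]] := embedding_a1 ek; [left|left|right|right];
    apply/esym; [apply: iu|apply: iu|apply: ju|apply: ju].
  - by left; apply: embedding_agree.
  - right; apply: embedding_agree => //=; first exact: aut_embedding K cn.
      by rewrite dJ.
    by rewrite a1J.
  - by left; apply: embedding_agree; rewrite ?(cm_nu1d cm) ?(cm_nu1a cm).
  - right; apply: (embedding_agree ek (aut_embedding K cn1)).
      by rewrite /= (cm_nu1d cm) rmorphN /= dJ.
    by rewrite /= (cm_nu1a cm) a2J.
have X1 : t1 a1 ^+ 2 = p + q * t1 d by rewrite t1d; case: t1a => ->; rewrite ?sqrrN (cm_a1 cm).
have X2 : t2 a1 ^+ 2 = p + q * t2 d.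
  by rewrite t2d mulrN; case: t2a => ->; rewrite ?sqrrN (cm_a2 cm).
have J1 : (t1 a1)^* = - t1 a1 by case: t1a => ->; rewrite ?rmorphN /= a1J.
have J2 : (t2 a1)^* = - t2 a1 by case: t2a => ->; rewrite ?rmorphN /= a2J.
have M : t1 a1 * t2 a1 = m \/ t1 a1 * t2 a1 = - m.
  by rewrite /m; case: t1a => ->; case: t2a => ->; rewrite ?mulrNN ?mulrN ?mulNr; auto.
case: (seq_two_indices id nij ijT) => eqP.
  exists t1, t2; split; [by exists (nth id Phi i), (nth id Phi j)|by left|by split].
exists t2, t1; split; [by exists (nth id Phi j), (nth id Phi i)|by right|split=> //].
by rewrite mulrC.
Qed.

End CM.

(** * Norms as indices *)

Lemma principal_comp A x y : seteq (principal (principal A y) x) (principal A (x * y)).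
Proof.
move=> z; split=> [[_ [[u [Au ->]] ->]]|[u [Au ->]]]; first by exists u; rewrite mulrA.
by exists (y * u); rewrite mulrA; split=> //; exists u.
Qed.

Lemma principal_opp A x : addgrp A -> seteq (principal A (- x)) (principal A x).
Proof.
by move=> gA z; split=> -[u [Au ->]]; exists (- u); rewrite ?mulrNN ?mulrN ?mulNr;
  split=> //; apply: addgrpN.
Qed.

Lemma principal_sub A x : (forall u, A u -> A (x * u)) -> subset (principal A x) A.
Proof. by move=> Ax z [u [Au ->]]; apply: Ax. Qed.

Lemma integers_addgrp F : is_subfield F -> addgrp (ring_of_integers F).
Proof.
move=> sF; split; first by split; [case: sF | apply: rpred0].
by move=> x y [Fx Ax] [Fy Ay]; split; [apply: subfieldB | apply: rpredB].
Qed.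

Lemma integersM F x y : is_subfield F -> ring_of_integers F x ->
  ring_of_integers F y -> ring_of_integers F (x * y).
Proof.
by move=> [_ [_ [_ [_ [FM _]]]]] [Fx Ax] [Fy Ay]; split; [apply: FM | apply: rpredM].
Qed.

Lemma integers1 F : is_subfield F -> ring_of_integers F 1.
Proof. by move=> [_ [F1 _]]; split=> //; apply: rpred1. Qed.

Lemma integers_int F (k : int) : is_subfield F -> ring_of_integers F k%:~R.
Proof. by move=> sF; split; [apply: subfield_int | apply: Aint_int]. Qed.

Lemma integers_nat F (k : nat) : is_subfield F -> ring_of_integers F k%:R.
Proof. by move=> sF; apply: (integers_int k%:Z sF). Qed.

Lemma quad_subfield u : u ^+ 2 \in Crat -> u \notin Crat -> is_subfield (quad u).
Proof.
move=> u2 uQ; split; first by exists 0, 0; split; [rmem|rmem|ring].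
split; first by exists 1, 0; split; [rmem|rmem|ring].
split.
  move=> _ _ [a [b [Qa Qb ->]]] [c [e [Qc Qe ->]]].
  by exists (a + c), (b + e); split; [rmem|rmem|ring].
split.
  by move=> _ [a [b [Qa Qb ->]]]; exists (- a), (- b); split; [rmem|rmem|ring].
split.
  move=> _ _ [a [b [Qa Qb ->]]] [c [e [Qc Qe ->]]].
  by exists (a * c + b * e * u ^+ 2), (a * e + b * c); split; [rmem|rmem|ring].
move=> _ [a [b [Qa Qb ->]]] x0.
have QNb : - b \in Crat by rmem.
have x'0 : a + - b * u != 0.
  apply: contraNneq x0 => eq0; have [-> b0] := quad_inj uQ Qa QNb eq0.
  by rewrite -[b]opprK b0 oppr0 mul0r addr0.
pose R := a ^+ 2 - b ^+ 2 * u ^+ 2.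
have RE : (a + b * u) * (a + - b * u) = R by rewrite /R; ring.
have R0 : R != 0 by rewrite -RE mulf_neq0.
have QR : R \in Crat by rewrite /R; rmem.
exists (a / R), (- b / R); split; [by rmem|by rmem|].
apply: (mulfI x0); rewrite mulfV //.
transitivity ((a + b * u) * (a + - b * u) / R); first by rewrite RE divff.
by field.
Qed.

(** * Principal ideals of a quadratic field *)

Section RealQuadraticNorm.

Variables (m : algC) (nu : {rmorphism algC -> algC}).
Hypotheses (m2Q : m ^+ 2 \in Crat) (mQ : m \notin Crat) (num : nu m = - m).

Let F := quad m.
Let O := ring_of_integers F.

Lemma quad_aut x : F x -> F (nu x).
Proof.
move=> [a [b [Qa Qb ->]]]; exists a, (- b); split=> //; first by rmem.
by rewrite rmorphD rmorphM (aut_Crat nu Qa) (aut_Crat nu Qb) num; ring.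
Qed.

Lemma quad_autK x : F x -> nu (nu x) = x.
Proof.
move=> [a [b [Qa Qb ->]]].
rewrite !(rmorphD, rmorphM) (aut_Crat nu Qa) (aut_Crat nu Qb) (aut_Crat nu Qa).
by rewrite (aut_Crat nu Qb) num rmorphN num opprK.
Qed.

Lemma quad_integers_aut x : O x -> O (nu x).
Proof. by move=> [Fx Ax]; split; [apply: quad_aut | rewrite Aint_aut]. Qed.

Lemma quad_norm_int x : O x -> x * nu x \in Num.int.
Proof.
move=> Ox; have [[a [b [Qa Qb xE]]] Ax] := Ox; apply: Cint_rat_Aint.
  rewrite xE rmorphD rmorphM (aut_Crat nu Qa) (aut_Crat nu Qb) num.
  have -> : (a + b * m) * (a + b * - m) = a ^+ 2 - b ^+ 2 * m ^+ 2 by ring.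
  by rmem.
by have [_ Anx] := quad_integers_aut Ox; rmem.
Qed.

Lemma quad_trace_int x : O x -> x + nu x \in Num.int.
Proof.
move=> Ox; have [[a [b [Qa Qb xE]]] Ax] := Ox; apply: Cint_rat_Aint.
  rewrite xE rmorphD rmorphM (aut_Crat nu Qa) (aut_Crat nu Qb) num.
  have -> : a + b * m + (a + b * - m) = 2 * a by ring.
  by rmem.
by have [_ Anx] := quad_integers_aut Ox; rmem.
Qed.

Lemma quad_index_nat n : (0 < n)%N -> has_index O (principal O n%:R) (n * n).
Proof.
have sF := quad_subfield m2Q mQ.
have [w Ow [wQ span]] := quad_integer_basis m2Q mQ.
exact: (index_nat_multiple (integers_addgrp sF) (integers1 sF) Ow wQ span).
Qed.

(** With [N = |x nu(x)|], the index [N^2] of [N O] is the product of the indices of [x O] in [O] and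
    of [x nu(x) O] in [x O]. The second equals the index of [nu(x) O] in [O], and [nu] carries this
    to the first, so both are [N]. *)
Lemma quad_norm_index x : O x -> x != 0 -> exists N : nat,
  [/\ (0 < N)%N, N%:R = `|x * nu x| & has_index O (principal O x) N].
Proof.
move=> Ox x0; have sF := quad_subfield m2Q mQ; have gO := integers_addgrp sF.
have Onx := quad_integers_aut Ox.
have OM u v := @integersM F u v sF.
have /intrP [c cE] := quad_norm_int Ox.
have nx0 : nu x != 0 by rewrite fmorph_eq0.
have c0 : c != 0 by rewrite -(intr_eq0 algC) -cE mulf_neq0.
pose N := `|c|%N; exists N; have N0 : (0 < N)%N by rewrite absz_gt0.
have NE : N%:R = `|x * nu x| by rewrite cE -intr_norm -abszE.
split=> //.
have ON : has_index O (principal O (x * nu x)) (N * N).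
  have idx := quad_index_nat N0; apply: has_index_ext idx => //; rewrite cE.
  have : (c%:~R : algC) = N%:R \/ (c%:~R : algC) = - N%:R.
    by rewrite /N; case: (c) => k; [left|right; rewrite NegzE abszN mulrNz].
  case=> cN; rewrite cN; first by [].
  by apply/seteq_sym/principal_opp.
have subx : subset (principal O x) O by apply: principal_sub => u; apply: (OM).
have subn : subset (principal O (x * nu x)) (principal O x).
  by move=> z [u [Ou ->]]; exists (nu x * u); rewrite mulrA; split=> //; apply: (OM).
have [k [l [Ok kl eqN]]] := index_between gO (principal_addgrp x gO)
  (principal_addgrp _ gO) subx subn ON.
have Onuk : has_index O (principal O (nu x)) k.
  have idx := @index_image _ _ nu _ (fun x y => rmorphB nu x y) (fmorph_inj nu) Ok.
  apply: has_index_ext idx => z; split.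
  - by move=> [u [Ou ->]]; apply: quad_integers_aut.
  - move=> Oz; exists (nu z); split; first exact: quad_integers_aut.
    by rewrite quad_autK //; case: Oz.
  - move=> [_ [[u [Ou ->]] ->]]; exists (nu u).
    by rewrite rmorphM; split=> //; apply: quad_integers_aut.
  - move=> [u [Ou ->]]; exists (x * nu u); rewrite rmorphM quad_autK; last by case: Ou.
    by split=> //; exists (nu u); split=> //; apply: quad_integers_aut.
have xk : has_index (principal O x) (principal O (x * nu x)) k.
  have idx := index_principal x0 Onuk; apply: has_index_ext idx => //.
  exact: principal_comp.
have kk : l = k by apply: index_unique (principal_addgrp _ gO) kl xk.
have -> : N = k by apply/eqP; rewrite -eqn_sqr -!mulnn eqN kk.
by [].
Qed.

End RealQuadraticNorm.

(** * Principal ideals of an imaginary quadratic extension of [quad m] *)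

Section QuarticNorm.

Variables (m eta : algC) (nu : {rmorphism algC -> algC}).
Hypotheses (m2Q : m ^+ 2 \in Crat) (mQ : m \notin Crat) (num : nu m = - m).
Hypotheses (mJ : m^* = m) (etaJ : eta^* = - eta) (eta0 : eta != 0).
Hypotheses (eta2 : quad m (eta ^+ 2)) (sL : is_subfield (quart m eta)).

Let F := quad m.
Let O0 := ring_of_integers F.
Let L := quart m eta.
Let O := ring_of_integers L.

Lemma quad_quart : subset F L.
Proof.
by move=> _ [a [b [Qa Qb ->]]]; exists a, b, 0, 0; split; [split; rmem | ring].
Qed.

Lemma integers_quad_quart : subset O0 O.
Proof. by move=> u [Fu Au]; split=> //; apply: quad_quart. Qed.

Lemma quart_coord_conj a b c e : a \in Crat -> b \in Crat -> c \in Crat -> e \in Crat ->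
  (a + b * m + (c + e * m) * eta)^* = a + b * m - (c + e * m) * eta.
Proof.
move=> Qa Qb Qc Qe; rewrite !(rmorphD, rmorphM) /= mJ etaJ !conj_Crat //; ring.
Qed.

Lemma quart_conj_mem x : L x -> L x^*.
Proof.
move=> [a [b [c [e [[Qa Qb Qc Qe] ->]]]]]; rewrite quart_coord_conj //.
by exists a, b, (- c), (- e); split; [split; rmem | ring].
Qed.

Lemma quart_integers_conj x : O x -> O x^*.
Proof.
move=> [Lx Ax]; split; first exact: quart_conj_mem.
by have := Aint_aut (Num.conj : {rmorphism algC -> algC}) x; rewrite Ax.
Qed.

Lemma quart_fixed x : L x -> x^* = x -> F x.
Proof.
move=> [a [b [c [e [[Qa Qb Qc Qe] ->]]]]]; rewrite quart_coord_conj // => fx.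
exists a, b; split=> //.
have : 2 * ((c + e * m) * eta) = 0.
  transitivity ((a + b * m + (c + e * m) * eta) - (a + b * m - (c + e * m) * eta)).
    by ring.
  by rewrite fx subrr.
by move/eqP; rewrite mulf_eq0 pnatr_eq0 /= => /eqP ->; rewrite addr0.
Qed.

Lemma quart_norm_quad x : O x -> O0 (x * x^*).
Proof.
move=> Ox; have [Lxx Axx] := integersM sL Ox (quart_integers_conj Ox).
split=> //; apply: quart_fixed => //.
by rewrite rmorphM /= conjCK mulrC.
Qed.

Lemma eta_multiple : exists t : algC, [/\ O t, t != 0, t^* = - t & O0 (t ^+ 2)].
Proof.
have sF := quad_subfield m2Q mQ.
have [a [b [Qa Qb eE]]] := eta2.
have [k1 k10 k1Z] := Crat_denominator Qa.
have [k2 k20 k2Z] := Crat_denominator Qb.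
have [k3 k30 k3Z] := Crat_denominator m2Q.
(* The factors clear the denominators of [a], [b] and [m^2], where [eta^2 = a + b m]. *)
pose k := (k1 * k2 * k3)%N; pose t := k%:R * eta.
have Am : k3%:R * m \in Aint.
  by apply/Aint_sqr/Aint_Cint; rewrite exprMn expr2 -mulrA rpredM ?natr_int.
have Fm : F m by exists 0, 1; split; [rmem|rmem|ring].
have F2 : F (t ^+ 2).
  rewrite exprMn; have [_ [_ [_ [_ [FM _]]]]] := sF; apply: (FM) => //.
  by rewrite -natrX; apply: subfield_nat.
have A2 : t ^+ 2 \in Aint.
  have -> : t ^+ 2 = (k2 ^ 2 * k3 ^ 2 * k1)%:R * (k1%:R * a) +
      (k1 ^ 2 * k2 * k3)%:R * (k2%:R * b) * (k3%:R * m).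
    by rewrite /t /k exprMn eE !(natrM, natrX); ring.
  have [A1 A2] := (Aint_Cint k1Z, Aint_Cint k2Z).
  by rmem.
exists t; split=> //.
- split; last exact: Aint_sqr.
  have [_ [_ [_ [_ [LM _]]]]] := sL; apply: (LM); first exact: subfield_nat.
  by exists 0, 0, 1, 0; split; [split; rmem|ring].
- by rewrite mulf_neq0 // pnatr_eq0 -lt0n /k !muln_gt0 k10 k20.
- by rewrite /t rmorphM rmorph_nat /= etaJ mulrN.
Qed.

(** A substitute for [O], which need not be free over [O0]: on this sublattice multiplication by an
    element of [O0] acts on the two coordinates separately. *)
Definition sum_lattice (t : algC) : cset :=
  fun x => exists r s, [/\ O0 r, O0 s & x = r + t * s].

Lemma sum_lattice_addgrp t : addgrp (sum_lattice t).
Proof.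
have gO0 := integers_addgrp (quad_subfield m2Q mQ).
split; first by exists 0, 0; split; rewrite ?mulr0 ?addr0 //; case: gO0.
move=> _ _ [u [v [Ou Ov ->]]] [u' [v' [Ou' Ov' ->]]].
by exists (u - u'), (v - v'); split; [apply: gO0.2|apply: gO0.2|ring].
Qed.

Lemma sum_lattice_sub t : O t -> subset (sum_lattice t) O.
Proof.
move=> Ot _ [u [v [Ou Ov ->]]]; apply: (addgrpD (integers_addgrp sL)).
  exact: integers_quad_quart.
by apply: integersM => //; apply: integers_quad_quart.
Qed.

Lemma sum_lattice_index t x : t^* = - t -> t != 0 -> O0 x -> x != 0 ->
  exists N : nat, [/\ (0 < N)%N, N%:R = `|x * nu x| &
    has_index (sum_lattice t) (principal (sum_lattice t) x) (N * N)].
Proof.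
move=> tJ t0 Ox x0; have [N [N0 NE [r [Or [rI rC]]]]] := quad_norm_index m2Q mQ num Ox x0.
exists N; split=> //; have sF := quad_subfield m2Q mQ.
have gO := integers_addgrp sF.
have FJ u : O0 u -> u^* = u.
  move=> [[a [b [Qa Qb ->]]] _]; rewrite rmorphD rmorphM /= mJ.
  by rewrite !conj_Crat.
have inj u v u' v' : O0 u -> O0 v -> O0 u' -> O0 v' -> u + t * v = u' + t * v' ->
    u = u' /\ v = v'.
  move=> Ou Ov Ou' Ov' eq1; have := congr1 Num.conj eq1.
  rewrite !rmorphD !rmorphM /= tJ !FJ // => eq2.
  have eqv : t * v = t * v'.
    apply: (@mulfI _ 2); first by rewrite pnatr_eq0.
    transitivity ((u + t * v) - (u + - t * v)); first by ring.
    by rewrite eq1 eq2; ring.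
  by split; [move: eq1; rewrite eqv => /addIr | apply: (mulfI t0)].
have := @has_index_fin (sum_lattice t) (principal (sum_lattice t) x) ('I_N * 'I_N)%type
  (fun i => r i.1 + t * r i.2).
rewrite card_prod !card_ord; apply.
- by move=> [i j]; exists (r i), (r j); split; [apply: Or|apply: Or|].
- move=> [i j] [i' j'] /= [_ [[u [v [Ou Ov ->]]] eqz]].
  have [eqi eqj] : r i - r i' = x * u /\ r j - r j' = x * v.
    apply: inj; [exact: gO.2|exact: gO.2|exact: integersM|exact: integersM|].
    transitivity (r i + t * r j - (r i' + t * r j')); first by ring.
    by rewrite eqz; ring.
  by congr (_, _); apply: rI; [exists u | exists v].
- move=> _ [u [v [Ou Ov ->]]].
  have [i [u' [Ou' ui]]] := rC _ Ou; have [j [v' [Ov' vj]]] := rC _ Ov.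
  exists (i, j), (u' + t * v'); split; first by exists u', v'.
  transitivity (u - r i + t * (v - r j)); first by rewrite /=; ring.
  by rewrite ui vj; ring.
Qed.

Lemma sum_lattice_finite t : O t -> t != 0 -> t^* = - t -> O0 (t ^+ 2) ->
  exists k, has_index O (sum_lattice t) k.
Proof.
move=> Ot t0 tJ Ot2; have sF := quad_subfield m2Q mQ.
have [gO0 gO] := (integers_addgrp sF, integers_addgrp sL).
have OM u v := @integersM F u v sF.
have gS := sum_lattice_addgrp t.
have SO := sum_lattice_sub Ot.
have /intrP [c cE] := quad_norm_int m2Q num Ot2.
have c0 : c != 0 by rewrite -(intr_eq0 algC) -cE mulf_neq0 ?expf_neq0 // fmorph_eq0 expf_neq0.
pose M := (2 * `|c|)%N.
have M0 : M%:R != 0 :> algC by rewrite pnatr_eq0 muln_eq0 /= absz_eq0.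
have OM0 : O0 M%:R by apply: integers_nat.
have MS : subset (principal O M%:R) (sum_lattice t).
  move=> _ [y [Oy ->]].
  have OyJ := quart_integers_conj Oy.
  have O1 : O0 (y + y^*).
    have [Ly Ay] : O (y + y^*) by apply: addgrpD.
    by split=> //; apply: quart_fixed => //; rewrite rmorphD /= conjCK addrC.
  have O2 : O0 (t * (y - y^*)).
    have [Ly Ay] : O (t * (y - y^*)) by apply: integersM => //; apply: gO.2.
    split=> //; apply: quart_fixed => //.
    by rewrite rmorphM rmorphB /= conjCK tJ; ring.
  have sE : `|c|%N%:R = (sgz c)%:~R * c%:~R :> algC by rewrite -intrM -abszEsg.
  (* From [2 y = (y + y^* ) + (y - y^* )]: since [c] is the norm of [t^2], the second term times
     [|c|] is [t] times an element of [O0]. *)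
  exists (`|c|%N%:R * (y + y^*)),
    ((sgz c)%:~R * (nu (t ^+ 2) * (t * (y - y^*)))); split.
  - by apply: (OM) => //; apply: integers_nat.
  - by apply: (OM); [apply: integers_int | apply: (OM) => //; apply: quad_integers_aut].
  - by rewrite /M natrM sE -cE; ring.
have [N [N0 _ SN]] := sum_lattice_index tJ t0 OM0 M0.
have MSO : subset (principal (sum_lattice t) M%:R) (principal O M%:R).
  by move=> _ [u [/SO Ou ->]]; exists u.
(* [M O] is squeezed between the lattice and its multiple by [M]; dividing by [M] then gives the
   index of the lattice in [O]. *)
have [_ [k [_ OSk _]]] := index_between gS (principal_addgrp _ gO)
  (principal_addgrp _ gS) MS MSO SN.
exists k; have MV : M%:R^-1 != 0 :> algC by rewrite invr_eq0.
have Mid A : seteq (principal (principal A M%:R) M%:R^-1) A.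
  apply: seteq_trans (principal_comp _ _ _) _; rewrite mulVf // => u.
  by split=> [[v [Av ->]]|Au]; [rewrite mul1r | exists u; rewrite mul1r].
by have idx := index_principal MV OSk; apply: has_index_ext idx.
Qed.

(* [O : yO] = [O : y^* O] reduces the norm from [L] to the quadratic subfield, over which
   [O] is, up to finite index, free of rank two. *)
Lemma quart_norm_index y : O y -> y != 0 -> exists2 n : nat,
  n%:R = `|(y * y^*) * nu (y * y^*)| & has_index O (principal O y) n.
Proof.
move=> Oy y0; have gO := integers_addgrp sL; have sF := quad_subfield m2Q mQ.
have gO0 := integers_addgrp sF.
have Ow := quart_norm_quad Oy; have OyJ := quart_integers_conj Oy.
have yJ0 : y^* != 0 by rewrite fmorph_eq0.
have w0 : y * y^* != 0 by rewrite mulf_neq0.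
have [t [Ot t0 tJ Ot2]] := eta_multiple.
have [k OSk] := sum_lattice_finite Ot t0 tJ Ot2.
have [N [N0 NE SN]] := sum_lattice_index tJ t0 Ow w0.
have OM u v := @integersM L u v sL.
have gS := sum_lattice_addgrp t.
have SO := sum_lattice_sub Ot.
have subO z : O z -> subset (principal O z) O.
  by move=> Oz; apply: principal_sub => u; apply: (OM).
have subS : subset (principal (sum_lattice t) (y * y^*)) (sum_lattice t).
  apply: principal_sub => _ [u [v [Ou Ov ->]]].
  exists (y * y^* * u), (y * y^* * v); split; last by ring.
    by apply: integersM.
  by apply: integersM.
have {}SN : has_index O (principal O (y * y^*)) (N * N).
  apply/(index_principal_transfer _ gO gS w0 SO _ subS OSk) => //.
  by apply: subO; apply: integers_quad_quart.
have suby : subset (principal O (y * y^*)) (principal O y).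
  by move=> z [u [Ou ->]]; exists (y^* * u); rewrite mulrA; split=> //; apply: (OM).
have [n [l [On nl eqN]]] := index_between gO (principal_addgrp y gO)
  (principal_addgrp _ gO) (subO _ Oy) suby SN.
have OnJ : has_index O (principal O y^*) n.
  have idx := @index_image _ _ Num.conj _ (fun x y => rmorphB _ x y) (fmorph_inj _) On.
  apply: has_index_ext idx => z; split.
  - by move=> [u [Ou ->]]; apply: quart_integers_conj.
  - by move=> Oz; exists z^*; rewrite conjCK; split=> //; apply: quart_integers_conj.
  - move=> [_ [[u [Ou ->]] ->]]; exists u^*.
    by rewrite rmorphM; split=> //; apply: quart_integers_conj.
  - move=> [u [Ou ->]]; exists (y * u^*); rewrite rmorphM /= conjCK.
    by split=> //; exists u^*; split=> //; apply: quart_integers_conj.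
have yn : has_index (principal O y) (principal O (y * y^*)) n.
  have idx := index_principal y0 OnJ; apply: has_index_ext idx => //.
  exact: principal_comp.
have ln : l = n by apply: index_unique (principal_addgrp _ gO) nl yn.
exists n => //; rewrite -NE; congr (_%:R).
by apply/eqP; rewrite -eqn_sqr -!mulnn eqN ln.
Qed.

End QuarticNorm.

(** * The reflex field *)

Section ReflexField.

Variables (K K0 : cset) (d a1 a2 p q : algC) (nu1 nu2 : {rmorphism algC -> algC}).
Hypotheses (sK : is_subfield K) (cm : cm_data K K0 d a1 a2 p q nu1 nu2).
Variables (Phi : seq (algC -> algC)) (t1 t2 : {rmorphism algC -> algC}).
Hypothesis td : type_data K d a1 a2 p q Phi t1 t2.

Let m := t1 a1 * t2 a1.
Let eta := t1 a1 + t2 a1.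

Lemma t2_d : t2 d = - t1 d.
Proof. by case: td => _ [[-> ->]|[-> ->]] _; rewrite ?opprK. Qed.

Lemma t1_d2 : t1 d ^+ 2 = d ^+ 2.
Proof. by case: td => _ [[-> _]|[-> _]] _; rewrite ?sqrrN. Qed.

Lemma b1_sqr : t1 a1 ^+ 2 = p + q * t1 d.
Proof. by case: td => _ _ []. Qed.

Lemma b2_sqr : t2 a1 ^+ 2 = p - q * t1 d.
Proof. by case: td => _ _ [_ -> _ _ _]; rewrite t2_d mulrN. Qed.

Lemma refl_m_pm : m = a1 * a2 \/ m = - (a1 * a2).
Proof. by case: td => _ _ []. Qed.

Lemma refl_m_sqr : m ^+ 2 = p ^+ 2 - q ^+ 2 * d ^+ 2.
Proof. by rewrite -(m_sqr cm); case: refl_m_pm => ->; rewrite ?sqrrN. Qed.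

Lemma refl_m_notin : m \notin Crat.
Proof. by case: refl_m_pm => ->; rewrite ?rpredN (cm_m cm). Qed.

Lemma refl_m2Q : m ^+ 2 \in Crat.
Proof.
rewrite refl_m_sqr; have [[Qp Qq] Qd] := ((cm_p cm, cm_q cm), cm_d2 cm).
by rmem.
Qed.

Lemma eta_sqr : eta ^+ 2 = 2 * p + 2 * m.
Proof.
have -> : eta ^+ 2 = t1 a1 ^+ 2 + t2 a1 ^+ 2 + 2 * m by rewrite /eta /m; ring.
by rewrite b1_sqr b2_sqr; ring.
Qed.

Lemma refl_mE : m = (eta ^+ 2 - 2 * p) / 2.
Proof. by rewrite eta_sqr; field. Qed.

Lemma eta_neq0 : eta != 0.
Proof.
apply: contraNneq refl_m_notin => e0; rewrite refl_mE e0.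
by have Qp := cm_p cm; rmem.
Qed.

Lemma eta_conj : eta^* = - eta.
Proof. by case: td => _ _ [_ _ J1 J2 _]; rewrite rmorphD /= J1 J2 opprD. Qed.

Lemma refl_m_conj : m^* = m.
Proof. by case: td => _ _ [_ _ J1 J2 _]; rewrite rmorphM /= J1 J2 mulrNN. Qed.

Lemma nu2_m : nu2 m = - m.
Proof. by case: refl_m_pm => ->; rewrite ?rmorphN (cm_nu2 cm). Qed.

Lemma quart_mul x y : quart m eta x -> quart m eta y -> quart m eta (x * y).
Proof.
move=> [a [b [c [e [[Qa Qb Qc Qe] ->]]]]] [a' [b' [c' [e' [[Qa' Qb' Qc' Qe'] ->]]]]].
have Qp := cm_p cm; have Qn := refl_m2Q.
pose n := m ^+ 2.
pose U := c * c' + e * e' * n; pose V := c * e' + e * c'.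
have [QU QV] : U \in Crat /\ V \in Crat by split; rewrite /U /V /n; rmem.
exists (a * a' + b * b' * n + 2 * p * U + 2 * V * n),
  (a * b' + b * a' + 2 * p * V + 2 * U),
  (a * c' + b * e' * n + c * a' + e * b' * n), (a * e' + b * c' + c * b' + e * a').
split; first by split; rewrite /n; rmem.
transitivity ((a + b * m) * (a' + b' * m) + (c + e * m) * (c' + e' * m) * eta ^+ 2 +
  ((a + b * m) * (c' + e' * m) + (c + e * m) * (a' + b' * m)) * eta); first by ring.
by rewrite eta_sqr /U /V /n; ring.
Qed.

Lemma quart_conj a b c e : a \in Crat -> b \in Crat -> c \in Crat -> e \in Crat ->
  (a + b * m + (c + e * m) * eta)^* = a + b * m - (c + e * m) * eta.
Proof.
exact: (quart_coord_conj refl_m_conj eta_conj).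
Qed.

Lemma quart_inv x : quart m eta x -> x != 0 -> quart m eta x^-1.
Proof.
move=> [a [b [c [e [[Qa Qb Qc Qe] xE]]]]] x0.
have Qp := cm_p cm; have Qn := refl_m2Q.
pose y := x^*; have yE : y = a + b * m - (c + e * m) * eta by rewrite /y xE quart_conj.
have y0 : y != 0 by rewrite fmorph_eq0.
pose n := m ^+ 2.
pose A := a ^+ 2 + b ^+ 2 * n - 2 * p * (c ^+ 2 + e ^+ 2 * n) - 4 * c * e * n.
pose B := 2 * a * b - 4 * p * c * e - 2 * (c ^+ 2 + e ^+ 2 * n).
have [QA QB] : A \in Crat /\ B \in Crat by split; rewrite /A /B /n; rmem.
have gE : x * y = A + B * m.
  transitivity ((a + b * m) ^+ 2 - (c + e * m) ^+ 2 * eta ^+ 2).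
    by rewrite yE xE; ring.
  by rewrite eta_sqr /A /B /n; ring.
have g0 : A + B * m != 0 by rewrite -gE mulf_neq0.
have g'0 : A + - B * m != 0.
  apply: contraNneq g0 => eq0.
  have QNB : - B \in Crat by rewrite rpredN.
  have [-> B0] := quad_inj refl_m_notin QA QNB eq0.
  by rewrite -[B]opprK B0 oppr0 mul0r addr0.
pose R := A ^+ 2 - B ^+ 2 * n.
have QR : R \in Crat by rewrite /R /n; rmem.
have RE : (A + B * m) * (A + - B * m) = R by rewrite /R /n; ring.
have R0 : R != 0 by rewrite -RE mulf_neq0.
have -> : x^-1 = y * (A / R + - B / R * m + (0 + 0 * m) * eta).
  apply: (mulfI x0); rewrite divff // mulrA gE.
  transitivity ((A + B * m) * (A + - B * m) / R); first by rewrite RE divff.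
  by field.
apply: quart_mul.
  exists a, b, (- c), (- e); split; last by rewrite yE; ring.
  by split; rmem.
exists (A / R), (- B / R), 0, 0; split=> //.
by split; rmem.
Qed.

Lemma quart_subfield : is_subfield (quart m eta).
Proof.
split; first by exists 0, 0, 0, 0; split; [split; rmem | ring].
split; first by exists 1, 0, 0, 0; split; [split; rmem | ring].
split.
  move=> _ _ [a [b [c [e [[Qa Qb Qc Qe] ->]]]]] [a' [b' [c' [e' [[Qa' Qb' Qc' Qe'] ->]]]]].
  by exists (a + a'), (b + b'), (c + c'), (e + e'); split; [split; rmem | ring].
split.
  move=> _ [a [b [c [e [[Qa Qb Qc Qe] ->]]]]].
  by exists (- a), (- b), (- c), (- e); split; [split; rmem | ring].
by split; [exact: quart_mul | exact: quart_inv].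
Qed.

Lemma type_normE x : K x -> type_norm Phi x = t1 x * t2 x.
Proof.
move=> Kx; case: td => -[f1 [f2 [-> f1E f2E]]] _ _.
by rewrite /type_norm !big_cons big_nil mulr1 f1E ?f2E.
Qed.

(** This is the one combination in a type norm that is not visibly in [quart m eta]. It is, because
    [t1 d] is [(t1 a1)^2 - (t2 a1)^2] over [2 q], and [(t1 a1 - t2 a1)^2 = eta^2 - 4 m]. *)
Lemma type_diff : t1 d * (t1 a1 - t2 a1) = eta * (p - m) / q.
Proof.
have q0 := cm_q0 cm.
have -> : t1 d = (t1 a1 ^+ 2 - t2 a1 ^+ 2) / (2 * q).
  by rewrite b1_sqr b2_sqr; field.
have -> : p - m = (eta ^+ 2 - 4 * m) / 2 by rewrite eta_sqr; field.
by rewrite /eta /m; field.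
Qed.

(** [m] is the type norm of [a1], and [eta] is the type norm of [1 + a1] minus [1 + m]; conversely
    every type norm expands in [m] and [eta]. *)
Lemma reflex_fieldE : seteq (reflex_field K Phi) (quart m eta).
Proof.
have Ka1 := K_a1 cm.
move=> z; split=> [zr|]; last first.
  move=> [a [b [c [e [[Qa Qb Qc Qe] ->]]]]] F sF NF.
  have Fm : F m by apply: NF; exists a1; rewrite type_normE.
  apply: quart_mem => //.
  have [_ [F1 [_ [FN _]]]] := sF.
  have -> : eta = (1 + t1 a1) * (1 + t2 a1) - 1 - m by rewrite /eta /m; ring.
  do 2![apply: subfieldB => //]; apply: NF; exists (1 + a1).
  have [_ [K1 [KD _]]] := sK.
  have K1a : K (1 + a1) by apply: (KD).
  by rewrite type_normE // !rmorphD !rmorph1.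
apply: zr; first exact: quart_subfield.
move=> _ [x [Kx ->]]; rewrite type_normE //.
have [a [b [c [e [[Qa Qb Qc Qe] ->]]]]] := (cm_K cm x).1 Kx.
have [[Qp Qq] Qd] := ((cm_p cm, cm_q cm), cm_d2 cm).
(* The coefficient of [eta * (p - m)] contributed by [type_diff]. *)
pose g := (a * e - b * c) / q.
exists (a ^+ 2 - b ^+ 2 * d ^+ 2), (c ^+ 2 - e ^+ 2 * d ^+ 2),
  (a * c - b * e * d ^+ 2 + g * p), (- g).
have Qg : g \in Crat by rewrite /g; rmem.
split; first by split; rmem.
have tE (t : {rmorphism algC -> algC}) :
    t (a + b * d + (c + e * d) * a1) = a + b * t d + (c + e * t d) * t a1.
  exact: (embedding_quart sK (aut_embedding K t) Qa Qb Qc Qe (K_d cm) Ka1).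
rewrite !tE t2_d -!t1_d2.
set D := t1 d.
transitivity (a ^+ 2 - b ^+ 2 * D ^+ 2 + (c ^+ 2 - e ^+ 2 * D ^+ 2) * m +
  (a * c - b * e * D ^+ 2) * eta + (a * e - b * c) * (D * (t1 a1 - t2 a1))).
  by rewrite /m /eta; ring.
have q0 := cm_q0 cm.
rewrite type_diff.
by rewrite /g; field.
Qed.

End ReflexField.

(** * The reflex type *)

Section ReflexType.

Variables (K K0 : cset) (d a1 a2 p q : algC) (nu1 nu2 : {rmorphism algC -> algC}).
Hypotheses (sK : is_subfield K) (cm : cm_data K K0 d a1 a2 p q nu1 nu2).
Variables (Phi : seq (algC -> algC)) (t1 t2 : {rmorphism algC -> algC}).
Hypothesis td : type_data K d a1 a2 p q Phi t1 t2.

Let m := t1 a1 * t2 a1.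
Let eta := t1 a1 + t2 a1.
Let Kr := reflex_field K Phi.
Let Kc := normal_closure K.

Lemma Kc_subfield : is_subfield Kc.
Proof. exact: gen_field_subfield. Qed.

Lemma Kc_K : subset K Kc.
Proof. by move=> x Kx F sF GF; apply: GF; exists id, x. Qed.

Lemma Kc_a1 : Kc a1.
Proof. exact: Kc_K (K_a1 cm). Qed.

Lemma Kc_a2 : Kc a2.
Proof.
move=> F sF GF; apply: GF; exists nu1, a1; rewrite (cm_nu1a cm).
by split; [exact: aut_embedding | split; [exact: K_a1 cm|]].
Qed.

(** [eta^2 = 2 p + 2 m] with [m] equal to [a1 a2] up to sign. [nu2] changes the sign of [a1 a2] and
    conjugation that of [eta], so both [a1 + a2] and [a1 - a2] are conjugate to [eta]. *)
Lemma sum_conjugate z : z = a1 + a2 \/ z = a1 - a2 ->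
  exists t : {rmorphism algC -> algC}, t z = eta.
Proof.
move=> zE; pose cn : {rmorphism algC -> algC} := Num.conj.
have [_ a1J a2J] := conj_cm cm.
suff [t tz] : exists t : {rmorphism algC -> algC}, t z ^+ 2 = eta ^+ 2.
  have [{}tz|{}tz] := sqr_eq_pm tz; first by exists t.
  exists (cn \o t)%FUN; change ((t z)^* = eta).
  by rewrite tz rmorphN /= (eta_conj td) opprK.
have Qp := cm_p cm.
have zsq : z ^+ 2 = 2 * p + 2 * (a1 * a2) \/ z ^+ 2 = 2 * p - 2 * (a1 * a2).
  have a12 : a1 ^+ 2 + a2 ^+ 2 = 2 * p by rewrite (cm_a1 cm) (cm_a2 cm); ring.
  by case: zE => ->; [left|right]; rewrite -a12; ring.
have nu2p : nu2 p = p by apply: aut_Crat.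
rewrite (eta_sqr td).
case: zsq => zsq; case: (refl_m_pm td) => ->.
- by exists idfun.
- exists nu2; rewrite -rmorphXn zsq rmorphD.
  rewrite (rmorphM nu2 2 p) (rmorphM nu2 2 (a1 * a2)) (cm_nu2 cm) nu2p rmorph_nat.
  by ring.
- exists nu2; rewrite -rmorphXn zsq rmorphB.
  rewrite (rmorphM nu2 2 p) (rmorphM nu2 2 (a1 * a2)) (cm_nu2 cm) nu2p rmorph_nat.
  by ring.
- by exists idfun; rewrite /= zsq; ring.
Qed.

(** The sum settles the signs: [z = - b] would give [w = b' + 2 b], and then [w^2 = b'^2] forces
    [4 b (b + b') = 0]. *)
Lemma summand_unique (b b' z w : algC) : z ^+ 2 = b ^+ 2 -> w ^+ 2 = b' ^+ 2 ->
  z + w = b + b' -> b != 0 -> b + b' != 0 -> z = b.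
Proof.
move=> zb wb zw b0 bb0; have [//|zE] := sqr_eq_pm zb.
have wE : w = b' + 2 * b.
  by rewrite -[w](addKr z) zw zE; ring.
move/eqP: wb; rewrite wE -subr_eq0.
have -> : (b' + 2 * b) ^+ 2 - b' ^+ 2 = 4 * b * (b + b') by ring.
by rewrite !mulf_eq0 pnatr_eq0 (negPf b0) (negPf bb0).
Qed.

(** Membership in the type is read off from the preimage of [eta]. The sign [e] handles [a1 + a2]
    and [a1 - a2] at once. *)
Lemma aut_in_type (t : {rmorphism algC -> algC}) e : e ^+ 2 = 1 -> t e = e ->
  t (a1 + e * a2) = eta -> agree K t t1 \/ agree K t t2.
Proof.
move=> e2 te tz; have et := aut_embedding K t.
have b0 (s : {rmorphism algC -> algC}) : s a1 != 0 by rewrite fmorph_eq0 (cm_a10 cm).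
have tA : t a1 ^+ 2 = p + q * t d.
  by rewrite -rmorphXn (cm_a1 cm) rmorphD rmorphM (aut_Crat t (cm_p cm)) (aut_Crat t (cm_q cm)).
have tB : (e * t a2) ^+ 2 = p - q * t d.
  rewrite exprMn e2 mul1r -rmorphXn (cm_a2 cm) rmorphB rmorphM.
  by rewrite (aut_Crat t (cm_p cm)) (aut_Crat t (cm_q cm)).
have tS : t a1 + e * t a2 = eta by rewrite -tz rmorphD rmorphM te.
have : t d ^+ 2 = t1 d ^+ 2.
  by rewrite (t1_d2 td) -rmorphXn /= aut_Crat ?(cm_d2 cm).
case/sqr_eq_pm => tdE; [left|right].
  apply: (embedding_agree sK cm) => //; first exact: aut_embedding.
  apply: (@summand_unique _ (t2 a1) _ (e * t a2)) => //; last exact: (eta_neq0 cm td).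
  - by rewrite tA tdE (b1_sqr td).
  - by rewrite tB tdE (b2_sqr td).
apply: (embedding_agree sK cm) => //; first exact: aut_embedding.
  by rewrite tdE (t2_d td).
apply: (@summand_unique _ (t1 a1) _ (e * t a2)) => //.
- by rewrite tA tdE (b2_sqr td) mulrN.
- by rewrite tB tdE (b1_sqr td) mulrN opprK.
- by rewrite tS addrC.
- by rewrite addrC; apply: (eta_neq0 cm td).
Qed.

(** Since [eta] generates the reflex field, the inverse of [psi] there is determined by the [z] with
    [psi z = eta]; the automorphism [rho] realises it. *)
Lemma reflex_type_agree (psi r : algC -> algC) (rho : {rmorphism algC -> algC}) z :
  is_embedding Kc psi -> (forall y, Kr y -> Kc (r y) /\ psi (r y) = y) ->
  Kc z -> psi z = eta -> rho eta = z ->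
  agree Kr r rho /\ forall y, Kr y -> Kc (rho y).
Proof.
move=> epsi rP Kz pz rz; have sKc := Kc_subfield; have Qp := cm_p cm.
have FQ := subfield_Crat sKc.
have [_ [_ [KD [_ [KM _]]]]] := sKc.
have [_ [pD pM]] := epsi; have pQ := embedding_Crat sKc epsi.
have Q2 : (2 : algC) \in Crat by rewrite rpred_nat.
have Q2p : 2 * p \in Crat by rmem.
have Q2V : 2^-1 \in Crat by rmem.
pose w := (z ^+ 2 - 2 * p) / 2.
have Kz2 : Kc (z ^+ 2) by rewrite expr2; apply: (KM).
have Kw' : Kc (z ^+ 2 - 2 * p) by apply: (subfieldB sKc) => //; apply: FQ.
have Kw : Kc w by apply: (KM) => //; apply: FQ.
have pw : psi w = m.
  rewrite /w (pM _ _ Kw' (FQ _ Q2V)) (embeddingB sKc epsi Kz2 (FQ _ Q2p)).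
  by rewrite (pQ _ Q2p) (pQ _ Q2V) expr2 pM // pz -expr2 /m (refl_mE td).
have rw : rho m = w.
  rewrite /m (refl_mE td) -/eta fmorph_div rmorphB rmorphXn rmorphM /= rz.
  by rewrite (aut_Crat rho Qp) rmorph_nat.
have main y : Kr y -> Kc (rho y) /\ psi (rho y) = y.
  move=> /(reflex_fieldE sK cm td) [a [b [c [e [[Qa Qb Qc Qe] ->]]]]].
  rewrite -/m -/eta; have er := aut_embedding Kc rho.
  have -> : rho (a + b * m + (c + e * m) * eta) = a + b * w + (c + e * w) * z.
    have er1 := aut_embedding (fun=> True) rho.
    rewrite -rw -rz; exact: (@embedding_quart (fun=> True) rho).
  split; first by apply: (quart_mem sKc).
  by rewrite (embedding_quart sKc epsi) // pw pz.
split=> [y Ky|y /main []//].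
have [[Kry pr] [Krho prho]] := (rP _ Ky, main _ Ky).
by apply: (embedding_inj sKc epsi) => //; rewrite pr prho.
Qed.

(* [Kr = Q(eta)], and the reflex type consists of the two embeddings
   [eta |-> a1 + a2] and [eta |-> a1 - a2]. *)
Definition reflex_data (Phir : seq (algC -> algC)) (rho1 rho2 : {rmorphism algC -> algC}) :=
  [/\ exists r1 r2, [/\ Phir = [:: r1; r2] \/ Phir = [:: r2; r1],
        agree Kr r1 rho1 & agree Kr r2 rho2],
     forall y, Kr y -> Kc (rho1 y) /\ Kc (rho2 y), rho1 eta = a1 + a2
   & rho2 eta = a1 - a2].

Lemma aut_inverse (t : {rmorphism algC -> algC}) x y : t x = y ->
  exists r : {rmorphism algC -> algC}, r y = x.
Proof. by move=> <-; exists (algC_invaut t); apply: (algC_autK t). Qed.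

Lemma reflex_type_data Phir : reflex_type K Phi Phir ->
  exists rho1 rho2, reflex_data Phir rho1 rho2.
Proof.
move=> [Rs [Sr Ru]]; have sKc := Kc_subfield; have Kca2 := Kc_a2; have Kca1 := Kc_a1.
have [_ [_ [KD [_ [KM _]]]]] := sKc.
have Kp : Kc (a1 + a2) by apply: (KD).
have Km : Kc (a1 - a2) by apply: (subfieldB sKc).
have [tp tpE] := sum_conjugate (or_introl erefl).
have [tm tmE] := sum_conjugate (or_intror erefl).
have [rho1 rho1E] := aut_inverse tpE; have [rho2 rho2E] := aut_inverse tmE.
case: (td) => -[f1 [f2 [PhiE f1E f2E]]] _ _.
have inS (t : {rmorphism algC -> algC}) : agree K t t1 \/ agree K t t2 ->
    is_embedding Kc t /\ exists j : 'I_(size Phi), agree K t (nth id Phi j).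
  move=> tt; split; first exact: aut_embedding.
  rewrite PhiE; case: tt => tE; [exists ord0 | exists (lift ord0 ord0)] => x Kx /=.
    by rewrite tE // f1E.
  by rewrite tE // f2E.
have [i1 i1P] : exists i : 'I_(size Phir), forall y, Kr y ->
    Kc (nth id Phir i y) /\ tp (nth id Phir i y) = y.
  by apply: Sr; apply/inS/(@aut_in_type _ 1); rewrite ?expr1n ?rmorph1 ?mul1r.
have [i2 i2P] : exists i : 'I_(size Phir), forall y, Kr y ->
    Kc (nth id Phir i y) /\ tm (nth id Phir i y) = y.
  by apply: Sr; apply/inS/(@aut_in_type _ (-1)); rewrite ?sqrrN ?expr1n ?rmorphN1 ?mulN1r.
have [ag1 K1] := reflex_type_agree (aut_embedding Kc tp) i1P Kp tpE rho1E.
have [ag2 K2] := reflex_type_agree (aut_embedding Kc tm) i2P Km tmE rho2E.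
have Kr_eta : Kr eta.
  by apply/(reflex_fieldE sK cm td); exists 0, 0, 1, 0; split; [split; rmem | rewrite /eta; ring].
have n12 : i1 <> i2.
  move=> e12; have := ag2 _ Kr_eta; rewrite -e12 ag1 // rho1E rho2E => /addrI /eqP.
  by rewrite -addr_eq0 -mulr2n mulrn_eq0 (negPf (cm_a20 cm)).
have iT k : k = i1 \/ k = i2.
  have [psi [[epsi [j psij]] rP]] := Rs k.
  have KcK := Kc_K.
  have [pD pM] : psi (a1 + a2) = psi a1 + psi a2 /\ psi (a1 - a2) = psi a1 - psi a2.
    by split; [case: epsi => _ [-> //] | rewrite (embeddingB sKc epsi)].
  (* [psi] sends [a1] to one of [t1 a1], [t2 a1], and [a2] to the other one up to sign. *)
  have psum : psi (a1 + a2) = eta \/ psi (a1 - a2) = eta.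
    have FQ := subfield_Crat sKc; have [Qp Qq] := (cm_p cm, cm_q cm).
    have [_ [_ psiM]] := epsi; have Kcd := KcK _ (K_d cm).
    have p2 : psi a2 ^+ 2 = p - q * psi d.
      rewrite expr2 -psiM // -expr2 (cm_a2 cm) (embeddingB sKc epsi).
      - rewrite (psiM _ _ (FQ _ Qq) Kcd).
        by rewrite (embedding_Crat sKc epsi Qp) (embedding_Crat sKc epsi Qq).
      - exact: FQ.
      - by apply: (KM) => //; apply: FQ.
    have ptj : (psi d = t1 d /\ psi a1 = t1 a1) \/ (psi d = - t1 d /\ psi a1 = t2 a1).
      have [Kd Ka1] := (K_d cm, K_a1 cm).
      rewrite PhiE in j psij; case: j psij => -[|[|//]] lt_j /= psij; [left|right].
        by rewrite !psij // !f1E.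
      by rewrite !psij // !f2E // (t2_d td).
    rewrite pD pM /eta; case: ptj => -[pd pa].
      have : psi a2 ^+ 2 = t2 a1 ^+ 2 by rewrite p2 pd (b2_sqr td).
      by case/sqr_eq_pm => ->; rewrite pa; [left|right; rewrite opprK].
    have : psi a2 ^+ 2 = t1 a1 ^+ 2 by rewrite p2 pd (b1_sqr td) mulrN opprK.
    by case/sqr_eq_pm => ->; rewrite pa; [left|right; rewrite opprK]; rewrite addrC.
  case: psum => psum; [left|right]; apply: Ru => y Ky.
    by have [-> // _] := reflex_type_agree epsi rP Kp psum rho1E; rewrite ag1.
  by have [-> // _] := reflex_type_agree epsi rP Km psum rho2E; rewrite ag2.
exists rho1, rho2; split=> // [|y Ky]; last by split; [apply: K1|apply: K2].
by exists (nth id Phir i1), (nth id Phir i2); split=> //; apply: seq_two_indices.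
Qed.

End ReflexType.

(** * Units of relative norm one *)

(** [U] and [V] stand for the trace and norm of [t = eps + eps^*]. The inequalities say that [2 - t]
    and [2 + t] have positive norm and nonnegative trace, and that [t] has positive discriminant.
    They leave nine values of [U]. *)
Lemma unit_trace_cases (U V : int) : 0 < 4 - 2 * U + V -> 0 < 4 + 2 * U + V ->
  0 <= 4 - U -> 0 <= 4 + U -> 0 < U ^+ 2 - 4 * V ->
  U = 0 \/ V = 0 \/ (U = 1 /\ V = -1) \/ (U = -1 /\ V = -1).
Proof.
rewrite expr2 => c1 c2 c3 c4 c5.
have Uc : U = -4 \/ U = -3 \/ U = -2 \/ U = -1 \/ U = 0 \/ U = 1 \/ U = 2 \/ U = 3 \/ U = 4.
  by lia.
by repeat (case: Uc => [Uc|Uc]); subst U; lia.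
Qed.

Section Units.

Variables (K K0 : cset) (d a1 a2 p q : algC) (nu1 nu2 : {rmorphism algC -> algC}).
Hypotheses (sK : is_subfield K) (cm : cm_data K K0 d a1 a2 p q nu1 nu2).

Lemma K_conj x : K x -> K x^*.
Proof.
move=> /(cm_K cm) [a [b [c [e [[Qa Qb Qc Qe] ->]]]]]; have [dJ a1J _] := conj_cm cm.
apply/(cm_K cm); rewrite !(rmorphD, rmorphM) /= dJ a1J !conj_Crat //.
by exists a, b, (- c), (- e); split; [split; rmem | ring].
Qed.

Lemma K_fixed x : K x -> x^* = x -> quad d x.
Proof.
move=> /(cm_K cm) [a [b [c [e [[Qa Qb Qc Qe] ->]]]]]; have [dJ a1J _] := conj_cm cm.
rewrite !(rmorphD, rmorphM) /= dJ a1J !conj_Crat // => fx; exists a, b; split=> //.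
have : 2 * ((c + e * d) * a1) = 0.
  transitivity ((a + b * d + (c + e * d) * a1) - (a + b * d + (c + e * d) * - a1)).
    by ring.
  by rewrite fx subrr.
by move/eqP; rewrite mulf_eq0 pnatr_eq0 /= => /eqP ->; rewrite addr0.
Qed.

Lemma quad_K : subset (quad d) K.
Proof.
move=> _ [a [b [Qa Qb ->]]]; apply/(cm_K cm).
by exists a, b, 0, 0; split; [split; rmem | ring].
Qed.

Lemma nu1_conj x : K x -> nu1 x^* = (nu1 x)^*.
Proof.
have [dJ a1J a2J] := conj_cm cm; pose cn : {rmorphism algC -> algC} := Num.conj.
apply: (embedding_agree sK cm (aut_embedding K (nu1 \o cn)%FUN)
  (aut_embedding K (cn \o nu1)%FUN)).
  by rewrite /= dJ (cm_nu1d cm) rmorphN /= dJ.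
by rewrite /= a1J rmorphN (cm_nu1a cm) a2J.
Qed.

Lemma real_decomposition x u : K x -> K u -> u != 0 -> u^* = - u ->
  exists X Y, [/\ quad d X, quad d Y & x = X + Y * u].
Proof.
move=> Kx Ku u0 uJ; have KxJ := K_conj Kx.
have [_ [_ [KD [_ [KM _]]]]] := sK; have KV := subfieldV sK.
have K2 : K 2^-1 by apply: (KV); apply: subfield_nat.
have J2 : (2^-1)^* = 2^-1 :> algC by rewrite conj_Crat //; rmem.
exists ((x + x^*) / 2), ((x - x^*) / 2 / u); split.
- apply: K_fixed; first by apply: (KM) => //; apply: (KD).
  by rewrite rmorphM rmorphD /= conjCK J2 addrC.
- apply: K_fixed.
    by apply: (KM); [apply: (KM) => //; apply: subfieldB | apply: (KV)].
  rewrite fmorph_div rmorphM rmorphB /= conjCK J2 uJ invrN.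
  by rewrite mulrN -mulNr -mulNr opprB.
- by field.
Qed.

Lemma biquadratic_of_imaginary u : K u -> u != 0 -> u^* = - u -> u ^+ 2 \in Crat ->
  biquadratic K.
Proof.
move=> Ku u0 uJ u2; exists u, d; split=> //; split; first exact: K_d cm.
split=> //; split; first exact: cm_d2 cm.
move=> x Kx; have [X [Y [[a [b [Qa Qb ->]]] [c [e [Qc Qe ->]]] ->]]] :=
  real_decomposition Kx Ku u0 uJ.
by exists a, c, b, e; split=> //; ring.
Qed.

(** Powers of [z] lie in [K]. Conversely [K = K0 + K0 u] with [u = z - z^*] imaginary, and [K0] is
    generated by [s = z + z^*]. *)
Lemma Qzeta5_of_root z : K z -> z ^+ 4 + z ^+ 3 + z ^+ 2 + z + 1 = 0 -> z * z^* = 1 ->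
  field_isomorphic K Qzeta5.
Proof.
move=> Kz z_root zJ.
have [_ [K1 [KD [KN [KM _]]]]] := sK; have FQ := subfield_Crat sK.
have z5 : z ^+ 5 = 1.
  apply/eqP; rewrite -subr_eq0; apply/eqP.
  transitivity ((z - 1) * (z ^+ 4 + z ^+ 3 + z ^+ 2 + z + 1)); first by ring.
  by rewrite z_root mulr0.
have prim : 5.-primitive_root z.
  have [k kprim kdvd] := @prim_order_exists _ 5 z isT z5.
  have /primeP [_ /(_ k kdvd)] : prime 5 by [].
  move=> /orP [/eqP k1|/eqP <- //].
  have z1 : z = 1 by have := prim_expr_order kprim; rewrite k1 expr1.
  move: z_root; rewrite z1 !expr1n => /eqP.
  have -> : 1 + 1 + 1 + 1 + 1 = 5 :> algC by ring.
  by rewrite pnatr_eq0.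
exists id; split; first by [].
split=> [x Kx|y [z' [prim' [a [b [c [e [[Qa Qb Qc Qe] ->]]]]]]]]; last first.
  have [k ->] := prim_rootP prim (prim_expr_order prim').
  have KX n : K (z ^+ n).
    by elim: n => [//|n IHn]; rewrite exprS; apply: (KM).
  eexists; split; last by [].
  have KT c' n : c' \in Crat -> K (c' * z ^+ n) by move=> ?; apply: (KM) => //; apply: FQ.
  rewrite -!exprM; apply: (KD); [apply: (KD); [apply: (KD)|]|]; try exact: KT.
  exact: FQ.
exists z; split=> //.
have z0 : z != 0.
  by apply/eqP => z0; move/eqP: zJ; rewrite z0 mul0r eq_sym oner_eq0.
have zJE : z^* = z ^+ 4.
  by apply: (mulfI z0); rewrite zJ -exprS z5.
have z4 : z ^+ 4 = - 1 - z - z ^+ 2 - z ^+ 3.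
  apply/eqP; rewrite -subr_eq0; apply/eqP; rewrite -[RHS]z_root; ring.
pose u := z - z^*; pose s := z + z^*.
have uE : u = 1 + 2 * z + z ^+ 2 + z ^+ 3 by rewrite /u zJE z4; ring.
have sE : s = - 1 - z ^+ 2 - z ^+ 3 by rewrite /s zJE z4; ring.
have suE : s * u = z ^+ 2 - z ^+ 3.
  transitivity (z ^+ 2 - z ^+ 5 * z ^+ 3); last by rewrite z5 mul1r.
  by rewrite /s /u zJE; ring.
have Ku : K u by apply: subfieldB => //; apply: K_conj.
have uJ : u^* = - u by rewrite rmorphB /= conjCK opprB.
have u0 : u != 0.
  have zz : z != z^*.
    apply/eqP => zz; have z2 : z ^+ 2 = 1 by rewrite expr2 {2}zz.
    have := prim_order_dvd prim 2.
    by rewrite z2 eqxx.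
  by rewrite subr_eq0.
have [X [Y [QX QY ->]]] := real_decomposition Kx Ku u0 uJ.
have [al [be [Qal Qbe sab]]] : quad d s.
  apply: K_fixed; first by apply: (KD) => //; apply: K_conj.
  by rewrite rmorphD /= conjCK addrC.
(* A rational [s] would be an integer with [s^2 + s = 1]. *)
have be0 : be != 0.
  apply/eqP => be0; have sQ : s \in Crat by rewrite sab be0 mul0r addr0.
  have sA : s \in Aint.
    by rewrite rpredD ?zJE ?rpredX // (Aint_prim_root prim).
  have /intrP [c cE] := Cint_rat_Aint sQ sA.
  have : s ^+ 2 + s - 1 = 0.
    transitivity (z ^+ 4 + z ^+ 3 + z ^+ 2 + z + 1); last by [].
    transitivity (z ^+ 2 + 2 * z ^+ 5 + z ^+ 5 * z ^+ 3 + z + z ^+ 4 - 1).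
      by rewrite /s zJE; ring.
    by rewrite z5; ring.
  rewrite cE -[1]/(1%:~R) -rmorphXn -rmorphD -rmorphB /= => /eqP.
  rewrite intr_eq0 expr2 => /eqP c_eq.
  have [c_small|[c_mid|c_big]] : c <= -2 \/ (c = -1 \/ c = 0) \/ 1 <= c by lia.
  - by nia.
  - by case: c_mid c_eq => ->.
  - by nia.
have quad_s v : quad d v -> exists a b, [/\ a \in Crat, b \in Crat & v = a + b * s].
  move=> [a [b [Qa Qb ->]]]; exists (a - b * al / be), (b / be).
  by split; [rmem|rmem|rewrite sab; field].
have [a [b [Qa Qb ->]]] := quad_s _ QX; have [c [e [Qc Qe ->]]] := quad_s _ QY.
(* Coordinates of [a + b s + c u + e s u] after writing [s], [u] and [s u] in powers of [z]. *)
exists (a - b + c), (2 * c), (- b + c + e), (- b + c - e); split.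
  by split; rmem.
transitivity (a + b * s + c * u + e * (s * u)); first by ring.
by rewrite suE uE sE; ring.
Qed.

Hypotheses (nbiq : ~ biquadratic K) (nz5 : ~ field_isomorphic K Qzeta5).

Lemma relative_norm1_bounds (z : algC) : z * z^* = 1 -> 0 <= 2 - (z + z^*) /\ 0 <= 2 + (z + z^*).
Proof.
move=> zJ; split.
  have -> : 2 - (z + z^*) = (1 - z) * (1 - z)^*.
    rewrite rmorphB rmorph1 /=.
    transitivity (1 + z * z^* - (z + z^*)); [by rewrite zJ; ring | ring].
  exact: mul_conjC_ge0.
have -> : 2 + (z + z^*) = (1 + z) * (1 + z)^*.
  rewrite rmorphD rmorph1 /=.
  transitivity (1 + z * z^* + (z + z^*)); [by rewrite zJ; ring | ring].
exact: mul_conjC_ge0.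
Qed.

(* Integrality and [|eps| = 1] at both places leave finitely many traces
   [t = eps + eps^*]; each of them other than [2] and [-2] puts a square root of a
   negative rational or a fifth root of unity into [K]. *)
Lemma unit_norm1 eps : K eps -> eps \in Aint -> eps * eps^* = 1 -> eps = 1 \/ eps = - 1.
Proof.
move=> Ke Ae eJ; have KeJ := K_conj Ke.
have [_ [K1 [KD [KN [KM _]]]]] := sK; have FQ := subfield_Crat sK.
pose t := eps + eps^*; pose u := eps - eps^*.
have Ku : K u by apply: subfieldB.
have uJ : u^* = - u by rewrite rmorphB /= conjCK opprB.
have u2 : u ^+ 2 = t ^+ 2 - 4.
  transitivity (t ^+ 2 - 4 * (eps * eps^*)); first by rewrite /u /t; ring.
  by rewrite eJ mulr1.
have tJ : t^* = t by rewrite rmorphD /= conjCK addrC.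
have AJ : eps^* \in Aint.
  by have := Aint_aut (Num.conj : {rmorphism algC -> algC}) eps; rewrite Ae.
have Kt : K t by apply: (KD).
have Ot : ring_of_integers (quad d) t by split; [apply: K_fixed | rewrite rpredD].
have e2 : t = 2 -> eps = 1.
  move=> t2; apply/eqP; rewrite -subr_eq0 -normr_eq0 -sqrf_eq0 normCK rmorphB rmorph1 /=.
  have -> : (eps - 1) * (eps^* - 1) = eps * eps^* + 1 - t by rewrite /t; ring.
  by rewrite eJ t2; apply/eqP; ring.
have eN2 : t = - 2 -> eps = - 1.
  move=> t2; apply/eqP; rewrite -addr_eq0 -normr_eq0 -sqrf_eq0 normCK rmorphD rmorph1 /=.
  have -> : (eps + 1) * (eps^* + 1) = eps * eps^* + 1 + t by rewrite /t; ring.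
  by rewrite eJ t2; apply/eqP; ring.
apply: contrapT => neps.
have t24 : t ^+ 2 != 4.
  apply/eqP => t24; apply: neps.
  have t22 : t ^+ 2 = 2 ^+ 2 by rewrite t24; ring.
  by have [t2|t2] := sqr_eq_pm t22; [left; apply: e2 | right; apply: eN2].
have u0 : u != 0.
  by apply: contraNneq t24 => u0; move: u2; rewrite u0 expr0n /= => /eqP;
    rewrite eq_sym subr_eq0.
have t2Q : t ^+ 2 \notin Crat.
  apply/negP => t2Q; have [t0|t0] := eqVneq t 0.
    apply: nbiq; apply: (biquadratic_of_imaginary Ku) => //.
    by rewrite u2; rmem.
  apply: nbiq; apply: (@biquadratic_of_imaginary (u * t)); first exact: KM.
  - by rewrite mulf_neq0.
  - by rewrite rmorphM /= uJ tJ mulNr.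
  - by rewrite exprMn u2; rmem.
have tQ : t \notin Crat by apply: contra t2Q => tQ; rmem.
pose t' := nu1 t.
have e'J : nu1 eps * (nu1 eps)^* = 1 by rewrite -nu1_conj // -rmorphM eJ rmorph1.
have t'E : t' = nu1 eps + (nu1 eps)^* by rewrite /t' rmorphD nu1_conj.
have [b1 b2] := relative_norm1_bounds eJ.
have [b1' b2'] := relative_norm1_bounds e'J.
rewrite -/t in b1 b2; rewrite -t'E in b1' b2'.
have /intrP [U UE] := quad_trace_int (cm_nu1d cm) Ot.
have /intrP [V VE] := quad_norm_int (cm_d2 cm) (cm_nu1d cm) Ot.
rewrite -/t' in UE VE.
have tn2 c : c \in Crat -> t != c /\ t' != c.
  move=> Qc; split; first by apply: contraNneq tQ => ->.
  by apply: contraNneq tQ => t'c; rewrite -(Crat_aut nu1) -/t' t'c.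
have tE2 : t ^+ 2 = U%:~R * t - V%:~R by rewrite -UE -VE; ring.
have Q2 : (2 : algC) \in Crat by rmem.
have QN2 : (- 2 : algC) \in Crat by rmem.
(* [2 - t] and [2 + t] are squared absolute values at both places, and nonzero because [t] is
   irrational. *)
have c1 : 0 < 4 - 2 * U + V.
  rewrite -(ltr0z algC); have -> : (4 - 2 * U + V)%:~R = (2 - t) * (2 - t') :> algC.
    by rewrite intrD intrB intrM -UE -VE; ring.
  by rewrite mulr_gt0 // lt_def ?b1 ?b1' subr_eq0 eq_sym andbT; case: (tn2 2 Q2).
have c2 : 0 < 4 + 2 * U + V.
  rewrite -(ltr0z algC); have -> : (4 + 2 * U + V)%:~R = (2 + t) * (2 + t') :> algC.
    by rewrite !intrD intrM -UE -VE; ring.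
  by rewrite mulr_gt0 // lt_def ?b2 ?b2' addrC addr_eq0 andbT; case: (tn2 (- 2) QN2).
have c3 : 0 <= 4 - U.
  rewrite -(ler0z algC); have -> : (4 - U)%:~R = (2 - t) + (2 - t') :> algC.
    by rewrite intrB -UE; ring.
  by rewrite addr_ge0.
have c4 : 0 <= 4 + U.
  rewrite -(ler0z algC); have -> : (4 + U)%:~R = (2 + t) + (2 + t') :> algC.
    by rewrite intrD -UE; ring.
  by rewrite addr_ge0.
have t'J : t'^* = t' by rewrite t'E rmorphD /= conjCK addrC.
have c5 : 0 < U ^+ 2 - 4 * V.
  rewrite -(ltr0z algC).
  have -> : (U ^+ 2 - 4 * V)%:~R = (t - t') * (t - t')^* :> algC.
    have -> : (t - t')^* = t - t' by rewrite rmorphB /= -/t tJ t'J.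
    by rewrite intrB rmorphXn intrM /= -UE -VE; ring.
  rewrite mul_conjC_gt0 subr_eq0; apply: contraNneq tQ => tt'.
  have -> : t = U%:~R / 2 by rewrite -UE -tt'; field.
  by rmem.
(* [U = 0] makes [t^2] rational and [V = 0] makes [t] rational. The other two cases read
   [t^2 - t - 1 = 0] and [t^2 + t - 1 = 0], making [- eps] or [eps] a primitive fifth root of
   unity. *)
have [U0|[V0|[UV|UV]]] : U = 0 \/ V = 0 \/ (U = 1 /\ V = -1) \/ (U = -1 /\ V = -1).
  exact: unit_trace_cases.
- by case/negP: t2Q; rewrite tE2 U0 mulr0z mul0r sub0r; rmem.
- have t0 : t != 0 by have [] := tn2 0 Crat0.
  case/negP: tQ; have -> : t = U%:~R.
    by apply: (mulIf t0); rewrite -expr2 tE2 V0 mulr0z subr0.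
  by rmem.
- apply: nz5; apply: (@Qzeta5_of_root (- eps)); first exact: KN.
    transitivity (eps ^+ 2 * (t ^+ 2 - t - 1)); last first.
      by rewrite tE2 UV.1 UV.2 mulr1z mulrNz; ring.
    transitivity (eps ^+ 4 - eps ^+ 3 + eps ^+ 2 * (2 * (eps * eps^*) - 1) -
      eps * (eps * eps^*) + (eps * eps^*) ^+ 2); last by rewrite /t; ring.
    by rewrite eJ; ring.
  by rewrite rmorphN mulrNN.
- apply: nz5; apply: (@Qzeta5_of_root eps) => //.
  transitivity (eps ^+ 2 * (t ^+ 2 + t - 1)); last first.
    by rewrite tE2 UV.1 UV.2 !mulrNz mulr1z; ring.
  transitivity (eps ^+ 4 + eps ^+ 3 + eps ^+ 2 * (2 * (eps * eps^*) - 1) +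
    eps * (eps * eps^*) + (eps * eps^*) ^+ 2); last by rewrite /t; ring.
  by rewrite eJ; ring.
Qed.

(** The relative norm is a rational unit and is positive, hence equal to 1. *)
Lemma unit_rational_norm eps : K eps -> eps \in Aint -> eps != 0 -> eps^-1 \in Aint ->
  eps * eps^* \in Crat -> eps = 1 \/ eps = - 1.
Proof.
move=> Ke Ae e0 AeV eQ; apply: unit_norm1 => //.
have AJ x : x \in Aint -> x^* \in Aint.
  by move=> Ax; have := Aint_aut (Num.conj : {rmorphism algC -> algC}) x; rewrite Ax.
have /intrP [c cE] : eps * eps^* \in Num.int.
  by apply: Cint_rat_Aint => //; apply: rpredM => //; apply: AJ.
have /intrP [c' c'E] : (eps * eps^*)^-1 \in Num.int.
  apply: Cint_rat_Aint; first by rewrite rpredV.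
  by rewrite invfM -fmorphV; apply: rpredM => //; apply: AJ.
have c0 : 0 < c by rewrite -(ltr0z algC) -cE mul_conjC_gt0.
have cc : c * c' = 1.
  apply/eqP; rewrite -(eqr_int algC) intrM -cE -c'E mulfV // mulf_neq0 //.
  by rewrite fmorph_eq0.
have c'0 : 0 < c' by rewrite -(pmulr_rgt0 _ c0) cc.
have c1 : c = 1 by clear -c0 c'0 cc; nia.
by rewrite cE c1.
Qed.

End Units.

(** * The kernel condition for principal ideals *)

Lemma seteq_refl A : seteq A A.
Proof. by []. Qed.

Definition subring (R : cset) :=
  [/\ addgrp R, R 1 & forall x y, R x -> R y -> R (x * y)].

Lemma integers_subring F : is_subfield F -> subring (ring_of_integers F).
Proof.
move=> sF; split; [exact: integers_addgrp | exact: integers1 |].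
by move=> x y; apply: integersM.
Qed.

Lemma ideal_mul_ext A A' B B' : seteq A A' -> seteq B B' ->
  seteq (ideal_mul A B) (ideal_mul A' B').
Proof.
move=> AA BB z; split=> -[s [sP ->]]; exists s; split=> // x /sP [];
  by move=> /AA ? /BB ?.
Qed.

Lemma principal1 R : seteq (principal R 1) R.
Proof. by move=> z; split=> [[u [Ru ->]]|Rz]; [rewrite mul1r|exists z; rewrite mul1r]. Qed.

Lemma mul_principal R R' x y : subring R' -> subset R R' -> R 1 ->
  seteq (ideal_mul (principal R x) (principal R' y)) (principal R' (x * y)).
Proof.
move=> [gR' R'1 R'M] RR R1 z; split=> [[s [sP ->]]|[u [Ru ->]]].
  rewrite big_seq; apply: addgrp_sum; first exact: principal_addgrp.
  move=> i /sP [[r [Rr ->]] [t [Rt ->]]]; exists (r * t); split; last by ring.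
  by apply: R'M => //; apply: RR.
exists [:: (x * 1, y * u)]; split; last by rewrite big_seq1 /=; ring.
by move=> i; rewrite inE => /eqP -> /=; split; [exists 1 | exists u].
Qed.

Lemma mul_principal_ring R R' x : subring R' -> subset R R' -> R 1 ->
  seteq (ideal_mul (principal R x) R') (principal R' x).
Proof.
move=> sR' RR R1; have R'E := seteq_sym (principal1 R').
apply: seteq_trans (ideal_mul_ext (seteq_refl _) R'E) _ => //.
by have := mul_principal x 1 sR' RR R1; rewrite mulr1.
Qed.

Lemma frac_ideal_principal R x (n : nat) : subring R -> x != 0 -> (0 < n)%N ->
  R (n%:R * x) -> frac_ideal R (principal R x).
Proof.
move=> [gR R1 RM] x0 n0 Rnx; have gx := principal_addgrp x gR.
split; first by case: gx.
split; first by move=> y z; apply: addgrpD.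
split.
  by move=> r _ Rr [u [Ru ->]]; exists (r * u); rewrite mulrCA; split=> //; apply: RM.
split; first by exists x; split=> //; exists 1; rewrite mulr1.
by exists n; split=> // _ [u [Ru ->]]; rewrite mulrA; apply: RM.
Qed.

Lemma integral_principal F y : is_subfield F -> ring_of_integers F y -> y != 0 ->
  integral_ideal (ring_of_integers F) (principal (ring_of_integers F) y).
Proof.
move=> sF Oy y0; split; last by apply: principal_sub => u; apply: integersM.
by apply: (@frac_ideal_principal _ _ 1) => //; rewrite ?mul1r //; apply: integers_subring.
Qed.

Lemma invertible_principal F y : is_subfield F -> ring_of_integers F y -> y != 0 ->
  invertible (ring_of_integers F) (principal (ring_of_integers F) y).
Proof.
move=> sF [Fy Ay] y0; have sO := integers_subring sF.
split; first by case: (@integral_principal F y).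
have [n n0 An] := Aint_inv_multiple Ay y0.
exists (principal (ring_of_integers F) y^-1); split.
  apply: (@frac_ideal_principal _ _ n) => //; first by rewrite invr_eq0.
  split=> //; have [_ [_ [_ [_ [FM _]]]]] := sF.
  by apply: FM; [apply: subfield_nat | apply: subfieldV].
have := @mul_principal _ (ring_of_integers F) y y^-1 sO (fun _ => id) (integers1 sF).
by rewrite mulfV // => yy; apply: seteq_trans yy (principal1 _).
Qed.

Lemma coprime_principal F (f : nat) y u v : is_subfield F ->
  ring_of_integers F y -> y != 0 -> ring_of_integers F u -> ring_of_integers F v ->
  y * u + f%:R * v = 1 ->
  coprime_to (ring_of_integers F) f (principal (ring_of_integers F) y).
Proof.
move=> sF Oy y0 Ou Ov yuv; have sO := integers_subring sF.
have [gO O1 OM] := sO.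
have [frac sub] := integral_principal sF Oy y0.
have OE := principal1 (ring_of_integers F).
have Ofrac : frac_ideal (ring_of_integers F) (ring_of_integers F).
  split; first by case: gO.
  split; first by move=> ? ?; apply: addgrpD.
  split=> //; split; first by exists 1; rewrite oner_neq0.
  by exists 1%N; split=> // z Oz; rewrite mul1r.
have OO : seteq (ideal_mul (ring_of_integers F) (ring_of_integers F)) (ring_of_integers F).
  apply: seteq_trans (ideal_mul_ext (seteq_sym OE) (seteq_refl _)) _ => //.
  by apply: seteq_trans (mul_principal_ring 1 sO (fun _ => id) O1) _.
split=> //; exists (principal (ring_of_integers F) y), (ring_of_integers F).
split=> //; split; first exact: invertible_principal.
split.
  move=> z Oz; exists (y * (u * z)), (v * z).
  split; first by exists (u * z); split=> //; apply: (OM).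
  split; first exact: OM.
  by transitivity ((y * u + f%:R * v) * z); [rewrite yuv mul1r | ring].
split; first by split.
split; first by split=> //; exists (ring_of_integers F).
split; last exact: mul_principal_ring.
by move=> z Oz; exists z, 0; split=> //; split; [case: gO | rewrite mulr0 addr0].
Qed.

(** * Reflex type norms of elements and of principal ideals *)

Section Kernel.

Variables (K K0 : cset) (d a1 a2 p q : algC) (nu1 nu2 : {rmorphism algC -> algC}).
Hypotheses (sK : is_subfield K) (cm : cm_data K K0 d a1 a2 p q nu1 nu2).
Variables (Phi : seq (algC -> algC)) (t1 t2 : {rmorphism algC -> algC}).
Hypothesis td : type_data K d a1 a2 p q Phi t1 t2.
Variables (Phir : seq (algC -> algC)) (rho1 rho2 : {rmorphism algC -> algC}).
Hypothesis rd : reflex_data K a1 a2 Phi t1 t2 Phir rho1 rho2.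

Let m := t1 a1 * t2 a1.
Let eta := t1 a1 + t2 a1.
Let Kr := reflex_field K Phi.
Let Kc := normal_closure K.
Let OK := ring_of_integers K.
Let OKr := ring_of_integers Kr.
Let OKc := ring_of_integers Kc.

Lemma Kr_subfield : is_subfield Kr.
Proof. exact: gen_field_subfield. Qed.

Lemma a_sqr_sum : a1 ^+ 2 + a2 ^+ 2 = 2 * p.
Proof. by rewrite (cm_a1 cm) (cm_a2 cm); ring. Qed.

Lemma rho1_m : rho1 m = a1 * a2.
Proof.
have [_ _ r1 _] := rd; rewrite /m (refl_mE td) -/eta.
rewrite fmorph_div rmorphB rmorphXn (rmorphM rho1 2 p) (aut_Crat rho1 (cm_p cm)).
by rewrite rmorph_nat r1 -a_sqr_sum; field.
Qed.

Lemma rho2_m : rho2 m = - (a1 * a2).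
Proof.
have [_ _ _ r2] := rd; rewrite /m (refl_mE td) -/eta.
rewrite fmorph_div rmorphB rmorphXn (rmorphM rho2 2 p) (aut_Crat rho2 (cm_p cm)).
by rewrite rmorph_nat r2 -a_sqr_sum; field.
Qed.

Lemma rho_quart (rho : {rmorphism algC -> algC}) a b c e :
  a \in Crat -> b \in Crat -> c \in Crat -> e \in Crat ->
  rho (a + b * m + (c + e * m) * eta) = a + b * rho m + (c + e * rho m) * rho eta.
Proof.
move=> Qa Qb Qc Qe; have sA : is_subfield (fun=> True) by [].
exact: (embedding_quart sA (aut_embedding _ rho)).
Qed.

(** [rho1] and [rho2] differ formally by the sign of [a2], so their symmetric functions lie in [K]
    because [a2^2] does. This remains valid when [a2] itself is in [K]. *)
Lemma rho_decomposition y : Kr y ->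
  exists U V, [/\ K U, K V, rho1 y = U + a2 * V & rho2 y = U - a2 * V].
Proof.
move=> /(reflex_fieldE sK cm td) [a [b [c [e [[Qa Qb Qc Qe] ->]]]]].
have [_ _ r1 r2] := rd.
have [_ [K1 [KD [_ [KM _]]]]] := sK; have FQ := subfield_Crat sK.
have Ka1 := K_a1 cm; have Kd := K_d cm.
have [[Qp Qq] Ka2] : (p \in Crat /\ q \in Crat) /\ K (a2 ^+ 2).
  split; first by split; [exact: cm_p cm | exact: cm_q cm].
  rewrite (cm_a2 cm); apply: subfieldB => //; first by apply: FQ; apply: cm_p cm.
  by apply: (KM) => //; apply: FQ; apply: cm_q cm.
have Ka12 : K (a1 ^+ 2) by rewrite expr2; apply: (KM).
exists (a + c * a1 + e * (a1 * a2 ^+ 2)), (b * a1 + c + e * a1 ^+ 2); split.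
- apply: (KD); first by apply: (KD); [apply: FQ | apply: (KM) => //; apply: FQ].
  by apply: (KM); [apply: FQ | apply: (KM)].
- apply: (KD); first by apply: (KD); [apply: (KM) => //; apply: FQ | apply: FQ].
  by apply: (KM) => //; apply: FQ.
- by rewrite rho_quart // rho1_m r1; ring.
- by rewrite rho_quart // rho2_m r2; ring.
Qed.

Lemma rho_norm_K y : Kr y -> K (rho1 y * rho2 y).
Proof.
move=> /rho_decomposition [U [V [KU KV -> ->]]].
have [_ [_ [KD [_ [KM _]]]]] := sK.
have -> : (U + a2 * V) * (U - a2 * V) = U * U - a2 ^+ 2 * (V * V) by ring.
have Ka2 : K (a2 ^+ 2).
  rewrite (cm_a2 cm); apply: subfieldB => //.
    by apply: subfield_Crat sK (cm_p cm).
  by apply: (KM); [apply: subfield_Crat sK (cm_q cm) | apply: K_d cm].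
by apply: subfieldB => //; [apply: (KM) | apply: (KM) => //; apply: (KM)].
Qed.

Lemma rho_trace_K y : Kr y -> K (rho1 y + rho2 y).
Proof.
move=> /rho_decomposition [U [V [KU KV -> ->]]].
have [_ [_ [KD _]]] := sK.
have -> : U + a2 * V + (U - a2 * V) = U + U by ring.
exact: KD.
Qed.

Lemma rho_conj y : Kr y -> rho1 y^* = (rho1 y)^* /\ rho2 y^* = (rho2 y)^*.
Proof.
move=> /(reflex_fieldE sK cm td) [a [b [c [e [[Qa Qb Qc Qe] ->]]]]].
rewrite (quart_conj td) //; have [_ _ r1 r2] := rd; have [_ a1J a2J] := conj_cm cm.
have -> : a + b * (t1 a1 * t2 a1) - (c + e * (t1 a1 * t2 a1)) * (t1 a1 + t2 a1) =
  a + b * m + (- c + - e * m) * eta by rewrite /m /eta; ring.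
have QNc : - c \in Crat by rmem.
have QNe : - e \in Crat by rmem.
split.
  rewrite rho_quart // rho_quart // rho1_m r1.
  by rewrite !(rmorphD, rmorphM) /= a1J a2J !conj_Crat //; ring.
rewrite rho_quart // rho_quart // rho2_m r2.
by rewrite !(rmorphD, rmorphM, rmorphB, rmorphN) /= a1J a2J !conj_Crat //; ring.
Qed.

Lemma rho_norm_quad w : quad m w -> rho1 w * rho2 w = w * nu2 w.
Proof.
move=> [a [b [Qa Qb ->]]].
have E (r : {rmorphism algC -> algC}) : r (a + b * m) = a + b * r m.
  by rewrite rmorphD (rmorphM r b m) (aut_Crat r Qa) (aut_Crat r Qb).
rewrite !E rho1_m rho2_m (nu2_m cm td) -/m.
transitivity (a ^+ 2 - b ^+ 2 * (a1 * a2) ^+ 2); first by ring.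
transitivity (a ^+ 2 - b ^+ 2 * m ^+ 2); last by ring.
by rewrite /m; case: (refl_m_pm td) => ->; rewrite ?sqrrN.
Qed.

Lemma quart_eq_Kr : seteq (ring_of_integers (quart m eta)) OKr.
Proof. by move=> z; split=> -[/(reflex_fieldE sK cm td)]. Qed.

(** Both [rho1] and [rho2] commute with conjugation, so the product of the four conjugates of [y] is
    the squared absolute value of its type norm. *)
Lemma reflex_norm_index y : OKr y -> y != 0 -> exists2 n : nat,
  n%:R = (rho1 y * rho2 y) * (rho1 y * rho2 y)^* & has_index OKr (principal OKr y) n.
Proof.
move=> Oy y0; have [Kry Ay] := Oy.
have e2 : quad m (eta ^+ 2).
  rewrite (eta_sqr td); exists (2 * p), 2.
  by have Qp := cm_p cm; split; [rmem|rmem|].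
have sL := quart_subfield cm td.
have [[m2 mQ] [mJ eJ]] := ((refl_m2Q cm td, refl_m_notin cm td), (refl_m_conj td, eta_conj td)).
have Oy' : ring_of_integers (quart m eta) y by apply/quart_eq_Kr.
have [n nE idx] := quart_norm_index m2 mQ (nu2_m cm td) mJ eJ (eta_neq0 cm td) e2 sL Oy' y0.
exists n.
  have [Qw _] := quart_norm_quad mJ eJ sL Oy'.
  have [r1J r2J] := rho_conj Kry.
  rewrite nE -rho_norm_quad // !rmorphM r1J r2J /=.
  have -> : rho1 y * (rho1 y)^* * (rho2 y * (rho2 y)^*) =
    rho1 y * rho2 y * (rho1 y * rho2 y)^* by rewrite rmorphM /=; ring.
  by rewrite ger0_norm ?mul_conjC_ge0 // rmorphM.
apply: has_index_ext idx; first exact: quart_eq_Kr.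
by move=> z; split=> -[u [/quart_eq_Kr Ou ->]]; exists u.
Qed.

Lemma rho_integers y : OKr y -> OKc (rho1 y) /\ OKc (rho2 y).
Proof.
move=> [Kry Ay]; have [_ rK _ _] := rd; have [K1 K2] := rK _ Kry.
by split; split=> //; rewrite Aint_aut.
Qed.

Lemma rho_norm_integers y : OKr y -> OK (rho1 y * rho2 y).
Proof.
move=> Oy; split; first by apply: rho_norm_K; case: Oy.
by have [[_ A1] [_ A2]] := rho_integers Oy; rmem.
Qed.

Lemma image_principal r (rho : {rmorphism algC -> algC}) y :
  agree Kr r rho -> (forall z, OKr z -> OKc (rho z)) -> OKr y ->
  seteq (ideal_mul (image r (principal OKr y)) OKc) (principal OKc (rho y)).
Proof.
move=> ag rO Oy; have [gO O1 OM] := integers_subring (gen_field_subfield _ : is_subfield Kc).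
have sKr := Kr_subfield.
have rE z : OKr z -> r (y * z) = rho y * rho z.
  by move=> Oz; rewrite ag ?rmorphM //; case: (integersM sKr Oy Oz).
move=> z; split=> [[s [sP ->]]|[u [Ou ->]]].
  rewrite big_seq; apply: addgrp_sum; first exact: principal_addgrp.
  move=> i /sP [[_ [[v [Ov ->]] ->]] Oi]; rewrite rE //.
  by exists (rho v * i.2); split; [apply: (OM) => //; apply: rO | rewrite mulrA].
have Or1 : OKr 1 by apply: integers1.
exists [:: (r (y * 1), u)]; split; last by rewrite big_seq1 /= rE // rmorph1 mulr1.
move=> i; rewrite inE => /eqP -> /=; split=> //.
by exists (y * 1); split=> //; exists 1.
Qed.

Lemma type_norm_principal y : OKr y ->
  seteq (ideal_prod OKc [seq ideal_mul (image r (principal OKr y)) OKc | r <- Phir])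
    (principal OKc (rho1 y * rho2 y)).
Proof.
move=> Oy; have [[r1 [r2 [PE ag1 ag2]]] _ _ _] := rd.
have sO := integers_subring (gen_field_subfield _ : is_subfield Kc); have [_ O1 _] := sO.
have E1 := image_principal ag1 (fun z Oz => (rho_integers Oz).1) Oy.
have E2 := image_principal ag2 (fun z Oz => (rho_integers Oz).2) Oy.
have go A B u v : seteq A (principal OKc u) -> seteq B (principal OKc v) ->
    seteq (ideal_mul A (ideal_mul B OKc)) (principal OKc (u * v)).
  move=> Au Bv; have BvO := seteq_trans (ideal_mul_ext Bv (seteq_refl _))
    (mul_principal_ring v sO (fun _ => id) O1).
  exact: seteq_trans (ideal_mul_ext Au BvO) (mul_principal u v sO (fun _ => id) O1).
by case: PE => -> /=; [|rewrite mulrC]; apply: go.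
Qed.

Section Principal.

Variables (f : nat) (y u v : algC).
Hypotheses (Oy : OKr y) (Ou : OKr u) (Ov : OKr v) (y0 : y != 0).
Hypothesis yuv : y * u + f%:R * v = 1.

Let x := rho1 y * rho2 y.

(** The product of the two relations obtained by applying [rho1] and [rho2]. The cofactor of [f] is
    symmetric in the two, so it lies in [K]. *)
Lemma norm_coprime : x * (rho1 u * rho2 u) +
  f%:R * ((rho1 v + rho2 v) - f%:R * (rho1 v * rho2 v)) = 1.
Proof.
have E (r : {rmorphism algC -> algC}) : r y * r u = 1 - f%:R * r v.
  by rewrite -rmorphM -[y * u](addrK (f%:R * v)) yuv rmorphB rmorph1 rmorphM rmorph_nat.
transitivity ((rho1 y * rho1 u) * (rho2 y * rho2 u) +
  f%:R * ((rho1 v + rho2 v) - f%:R * (rho1 v * rho2 v))); first by rewrite /x; ring.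
by rewrite !E; ring.
Qed.

(** The pair attached to the ideal of [y] is generated by the type norm [x] itself, which is the
    witness. *)
Lemma principal_in_kernel : S_kernel K Phi Phir OK f (principal OKr y).
Proof.
have sKr := Kr_subfield; have sO := integers_subring sK; have [gO O1 OM] := sO.
have sOc := integers_subring (gen_field_subfield _ : is_subfield Kc).
have Ox : OK x := rho_norm_integers Oy.
have x0 : x != 0 by rewrite mulf_neq0 // fmorph_eq0.
have OOc : subset OK OKc by move=> z [Kz Az]; split=> //; apply: Kc_K.
have cop : coprime_to OK f (principal OK x).
  apply: (coprime_principal sK Ox x0 (rho_norm_integers Ou) _ norm_coprime).
  apply: gO.2; last by apply: (OM); [apply: integers_nat | apply: rho_norm_integers].
  split; first by apply: rho_trace_K; case: Ov.
  by have [[_ A1] [_ A2]] := rho_integers Ov; rmem.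
split; first exact: coprime_principal sKr Oy y0 Ou Ov yuv.
exists (principal OK x), (principal OK x), x.
split; first by case: (integral_principal sK Ox x0).
split.
  apply: seteq_trans (mul_principal_ring x sOc OOc O1) _.
  exact/seteq_sym/type_norm_principal.
split; first exact: invertible_principal.
split=> //; split; first exact: mul_principal_ring.
split; first by case: Ox.
split=> //; split=> //; split=> //.
have [n nE idx] := reflex_norm_index Oy y0.
have [gOr Or1 OrM] := integers_subring sKr.
have [fr sub] := integral_principal sKr Oy y0.
exists (principal OKr y), OKr, n, 1%N; split=> //; split.
  split=> //; split; first by case: gOr.
  split; first by move=> ? ?; apply: addgrpD.
  split=> //; split; first by exists 1; rewrite oner_neq0.
  by exists 1%N; split=> // z Oz; rewrite mul1r.
split; first by apply: mul_principal_ring => //; apply: integers_subring.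
split=> //; split; first exact: index_self.
by rewrite divr1 nE.
Qed.

Hypotheses (nbiq : ~ biquadratic K) (nz5 : ~ field_isomorphic K Qzeta5).
Variable O' : cset.
Hypotheses (oO' : is_order K O') (idx : has_index OK O' f).
Hypothesis kernel : forall a, S_kernel K Phi Phir OK f a -> S_kernel K Phi Phir O' f a.

Lemma order_addgrp : addgrp O'.
Proof.
have [_ [O1 [OB _]]] := oO'; split=> //.
by have := OB _ _ O1 O1; rewrite subrr.
Qed.

Lemma index_in_order z : OK z -> O' (f%:R * z).
Proof.
apply: (index_kills _ order_addgrp idx); exact: integers_addgrp.
Qed.

(** The kernel for [O'] yields a generator [x'] of the ideal of [x], only with a rational relative
    norm and coprime to [f] in [O']. The unit theorem gives [x' = x] or [x' = - x], and coprimality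
    puts [x'] in [O']. *)
Lemma type_norm_in_order : O' x.
Proof.
have sKc := gen_field_subfield _ : is_subfield Kc.
have [_ [c [b [x' [_ [cE [_ [_ [bc [Kx' [x'0 [cop [bx nx']]]]]]]]]]]]] :=
  kernel principal_in_kernel.
have sO := integers_subring sK; have [gO O1 OM] := sO.
have sOc := integers_subring sKc; have [gOc Oc1 OcM] := sOc.
have [O'O [O'1 [_ [O'M _]]]] := oO'; have gO' := order_addgrp.
have Ox : OK x := rho_norm_integers Oy.
have x0 : x != 0 by rewrite mulf_neq0 // fmorph_eq0.
have OOc : subset OK OKc by move=> z [Kz Az]; split=> //; apply: Kc_K.
(* The ideals are compared over the normal closure, where the ideal type norm is defined. *)
have xx : seteq (principal OKc x') (principal OKc x).
  apply: seteq_trans _ (seteq_trans cE (type_norm_principal Oy)).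
  apply: seteq_sym; apply: seteq_trans (ideal_mul_ext (seteq_sym bc) (seteq_refl _)) _ => //.
  apply: seteq_trans (mul_principal_ring x' sOc OOc O1); apply: ideal_mul_ext => //.
  apply: seteq_trans (ideal_mul_ext bx (seteq_refl _)) _ => //.
  exact: mul_principal_ring.
have [e [[_ Ae] x'E]] : principal OKc x x' by apply/xx; exists 1; rewrite mulr1.
have [e' [[_ Ae'] xE]] : principal OKc x' x by apply/xx; exists 1; rewrite mulr1.
have eE : e = x' / x by rewrite x'E mulrC mulKf.
have e'E : e' = e^-1 by apply: (mulfI x'0); rewrite -xE eE invf_div mulrCA mulfV ?mulr1.
have e0 : e != 0 by rewrite eE mulf_neq0 // invr_eq0.
have Ke : K e.
  have [_ [_ [_ [_ [KM _]]]]] := sK; rewrite eE; apply: (KM) => //.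
  by apply: subfieldV => //; case: Ox.
have eps : e = 1 \/ e = -1.
  apply: (unit_rational_norm sK cm nbiq nz5) => //; first by rewrite -e'E.
  have [n nE _] := reflex_norm_index Oy y0.
  have [_ [_ [nb [nc [_ [_ [_ [_ [_ nE']]]]]]]]] := nx'.
  (* Both terms are rational: [x' x'^*] is a quotient of indices and [x x^*] is the natural number
     [n]. *)
  have -> : e * e^* = (x' * x'^*) / (x * x^*).
    rewrite eE fmorph_div /=; field.
    by rewrite fmorph_eq0 x0.
  by rewrite nE' -/x -nE; rmem.
have Ox' : OK x' by rewrite x'E; split; [rewrite -x'E|have [_ Ax] := Ox; rmem].
(* [x' C = B] with [B] inside [O'], and [1 = u1 + f v1] with [u1] in [C]. Thus [x' u1] lies in [B],
   and [f x'] lies in [O'] because [f] annihilates the quotient of the maximal order by [O']. *)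
have O'x' : O' x'.
  have [_ [B [C [[_ BO] [_ [_ [_ [_ [Ccop BE]]]]]]]]] := cop.
  have [u1 [v1 [Cu1 [O'v1 uv1]]]] := Ccop _ O'1.
  have -> : x' = x' * u1 + f%:R * x' * v1.
    by transitivity (x' * (u1 + f%:R * v1)); [rewrite -uv1 mulr1 | ring].
  apply: addgrpD => //; last by apply: (O'M) => //; apply: index_in_order.
  apply/BO/BE; exists [:: (x', u1)]; rewrite big_seq1; split=> // i.
  rewrite inE => /eqP -> /=; split=> //.
  by exists 1; rewrite mulr1.
move: O'x'; rewrite x'E; case: eps => ->; rewrite ?mulr1 ?mulrN1 //.
by move/(addgrpN gO'); rewrite opprK.
Qed.

End Principal.

End Kernel.

(** * Reflex traces in the order *)

(** The integers carrying [z] into [G] form an ideal. It contains [f], so it contains the gcd of [f]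
    with each admissible [k]; taking [k] for the least prime factor of [f] makes that gcd smaller
    than [f]. *)
Lemma local_multiples (G : cset) z f : addgrp G -> (0 < f)%N -> G (f%:R * z) ->
  (forall l, prime l -> (l %| f)%N -> exists2 k : nat, ~~ (l %| k)%N & G (k%:R * z)) ->
  G z.
Proof.
move=> gG; have [n] := ubnP f; elim: n f => // n IHn f lt_fn f0 Gf loc.
have [f1|f_gt1] := leqP f 1.
  by have f_eq1 : f = 1%N by [lia]; rewrite f_eq1 mul1r in Gf.
have lp : prime (pdiv f) by apply: pdiv_prime.
have [k lk Gk] := loc _ lp (pdiv_dvd f).
have [a _ /dvdnP [b eqb]] := Bezoutl k f0.
have Gg : G ((gcdn f k)%:R * z).
  have -> : (gcdn f k)%:R * z = b%:R * (f%:R * z) - a%:R * (k%:R * z).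
    rewrite !mulrA -!natrM -eqb natrD natrM; ring.
  by apply: gG.2; apply: addgrpMn.
have g0 : (0 < gcdn f k)%N by rewrite gcdn_gt0 f0.
have lt_gf : (gcdn f k < f)%N.
  rewrite ltn_neqAle dvdn_leq ?dvdn_gcdl // andbT.
  apply: contra lk => /eqP gf; apply: dvdn_trans (pdiv_dvd f) _.
  by rewrite -[X in (X %| _)%N]gf dvdn_gcdr.
apply: (IHn (gcdn f k)) => //; first by apply: leq_trans lt_gf _; rewrite -ltnS.
by move=> l pl lg; apply: loc => //; apply: dvdn_trans lg (dvdn_gcdl _ _).
Qed.

Lemma coprimez_of_primes (f : nat) (T : int) : (0 < f)%N ->
  (forall r, prime r -> (r %| f)%N -> ~~ (r %| T)%Z) -> coprimez f T.
Proof.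
move=> f0 loc; rewrite /coprimez /gcdz /= -[_ == _]/(gcdn f `|T| == 1%N).
have g0 : (0 < gcdn f `|T|)%N by rewrite gcdn_gt0 f0.
apply: contraT => g1; have g_gt1 : (1 < gcdn f `|T|)%N by rewrite ltn_neqAle eq_sym g1.
have pr := pdiv_prime g_gt1; have dv := pdiv_dvd (gcdn f `|T|).
case/negP: (loc _ pr (dvdn_trans dv (dvdn_gcdl _ _))).
by rewrite dvdzE /= (dvdn_trans dv (dvdn_gcdr _ _)).
Qed.

(** Chinese remaindering for [l] and the prime-to-[l] part of [f]. Replacing [e] by [e k] preserves
    [e] modulo [l] and makes it vanish at the other primes of [f], where the local norm becomes
    1. *)
Lemma local_idempotent (l f : nat) : prime l -> (0 < f)%N -> exists k : nat,
  k = 1 %[mod l] /\ forall r, prime r -> (r %| f)%N -> r != l -> (r %| k)%N.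
Proof.
move=> pl f0; have co : coprime l (f`_l^').
  by rewrite prime_coprime // -p'natE // part_pnat.
exists (chinese l f`_l^' 1 0); split; first exact: chinese_modl.
move=> r pr rf nrl; apply: (@dvdn_trans f`_l^'); last first.
  by have := chinese_modr co 1 0; rewrite mod0n => /eqP.
move: rf; rewrite -{1}(partnC l f0) Euclid_dvdM // => /orP [rl|//].
have := pnat_dvd rl (part_pnat l f).
by rewrite pnatE // inE /= => /eqP rl'; rewrite rl' eqxx in nrl.
Qed.

(* The norm of [1 - e ^ 2 g] from a quadratic field to [Q], for [g] of trace [A] and
   norm [B]. *)
Definition local_norm (A B e : int) : int := 1 - e ^+ 2 * A + e ^+ 4 * B.

Lemma local_norm_coprime (l f k : nat) (A B e : int) : prime l -> (0 < f)%N ->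
  k = 1 %[mod l] -> (forall r, prime r -> (r %| f)%N -> r != l -> (r %| k)%N) ->
  ~~ (l %| local_norm A B e)%Z -> coprimez f (local_norm A B (e * k)).
Proof.
move=> pl f0 k1 kr le; apply: coprimez_of_primes => // r pr rf.
have [->|nrl] := eqVneq r l.
  apply: contra le => ld; rewrite /local_norm.
  have lk : (l %| (k : int) - 1)%Z.
    by rewrite -eqz_mod_dvd -[1]/(Posz 1) !modz_nat k1.
  have -> : 1 - e ^+ 2 * A + e ^+ 4 * B = local_norm A B (e * k) +
    (k%:Z - 1) * (e ^+ 2 * A * (k%:Z + 1) - e ^+ 4 * B * (k%:Z + 1) * (k%:Z ^+ 2 + 1)).
    by rewrite /local_norm; ring.
  by rewrite rpredD // dvdz_mulr.
have rk : (r %| (k : int))%Z by rewrite dvdzE /= kr.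
apply/negP => rd; have : (r %| 1)%Z.
  have -> : 1 = local_norm A B (e * k) + k%:Z * (e ^+ 2 * k%:Z * A - e ^+ 4 * k%:Z ^+ 3 * B) :> int.
    by rewrite /local_norm; ring.
  by rewrite rpredD // dvdz_mulr.
by rewrite dvdzE /= dvdn1; case: r pr {rf nrl rk rd} => [|[|]].
Qed.

Section Trace.

Variables (K K0 : cset) (d a1 a2 p q : algC) (nu1 nu2 : {rmorphism algC -> algC}).
Hypotheses (sK : is_subfield K) (cm : cm_data K K0 d a1 a2 p q nu1 nu2).
Variables (Phi : seq (algC -> algC)) (t1 t2 : {rmorphism algC -> algC}).
Hypothesis td : type_data K d a1 a2 p q Phi t1 t2.
Variables (Phir : seq (algC -> algC)) (rho1 rho2 : {rmorphism algC -> algC}).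
Hypothesis rd : reflex_data K a1 a2 Phi t1 t2 Phir rho1 rho2.
Hypotheses (nbiq : ~ biquadratic K) (nz5 : ~ field_isomorphic K Qzeta5).
Variables (O' : cset) (f : nat).
Hypotheses (oO' : is_order K O') (idx : has_index (ring_of_integers K) O' f).
Hypothesis kernel : forall a, S_kernel K Phi Phir (ring_of_integers K) f a ->
  S_kernel K Phi Phir O' f a.

Let m := t1 a1 * t2 a1.
Let eta := t1 a1 + t2 a1.
Let Kr := reflex_field K Phi.
Let OK := ring_of_integers K.
Let OKr := ring_of_integers Kr.
Let gO' : addgrp O' := order_addgrp oO'.
Let sKr : is_subfield Kr := gen_field_subfield _.
Let tr y := rho1 y + rho2 y.

Lemma norm_in_order y u v : OKr y -> OKr u -> OKr v -> y * u + f%:R * v = 1 ->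
  O' (rho1 y * rho2 y).
Proof.
move=> Oy Ou Ov yuv; have [y0|y0] := eqVneq y 0.
  by rewrite y0 !rmorph0 mul0r; case: gO'.
exact: (type_norm_in_order sK cm td rd Oy Ou Ov y0 yuv nbiq nz5 oO' idx kernel).
Qed.

Lemma imaginary_square y : OKr y -> y^* = - y ->
  ring_of_integers (quad m) (y ^+ 2).
Proof.
move=> Oy yJ; have [Ky2 Ay2] : OKr (y ^+ 2) by rewrite expr2; apply: integersM.
split=> //; apply: (quart_fixed (refl_m_conj td) (eta_conj td)).
  by apply/(reflex_fieldE sK cm td).
by rewrite rmorphXn /= yJ sqrrN.
Qed.

Lemma quad_OKr z : ring_of_integers (quad m) z -> OKr z.
Proof. by move=> [Qz Az]; split=> //; apply/(reflex_fieldE sK cm td)/quad_quart. Qed.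

(* N(1 + e y) - N(1 - e y) = 2 e Tr(y) for the reflex type norm N and trace Tr. *)
Lemma trace_in_order y (A B e : int) : OKr y -> y^* = - y ->
  y ^+ 2 + nu2 (y ^+ 2) = A%:~R -> y ^+ 2 * nu2 (y ^+ 2) = B%:~R ->
  coprimez f (local_norm A B e) -> O' ((2 * e)%:~R * tr y).
Proof.
move=> Oy yJ yA yB /coprimezP [[U V] /= UV].
have Og := imaginary_square Oy yJ.
have Og' := quad_OKr (quad_integers_aut (nu2_m cm td) Og).
have [gOr Or1 OrM] := integers_subring sKr.
have Oi k := @integers_int Kr k sKr.
set g' := nu2 (y ^+ 2) in yA yB Og'.
have TE : (1 - e%:~R ^+ 2 * y ^+ 2) * (1 - e%:~R ^+ 2 * g') = (local_norm A B e)%:~R.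
  transitivity (1 - e%:~R ^+ 2 * (y ^+ 2 + g') + e%:~R ^+ 4 * (y ^+ 2 * g')); first by ring.
  by rewrite yA yB /local_norm; ring.
have one (s : int) : s ^+ 2 = 1 ->
    O' (rho1 (1 + (s * e)%:~R * y) * rho2 (1 + (s * e)%:~R * y)).
  move=> s2; have s2C : s%:~R ^+ 2 = 1 :> algC by rewrite -rmorphXn s2.
  have Oz (r : int) : OKr (1 + r%:~R * y) by apply: addgrpD => //; apply: (OrM).
  (* The cofactor [1 - s e y] turns [1 + s e y] into [1 - e^2 y^2], the factor with [g'] turns that
     into the rational local norm, and [U], [V] are the Bezout coefficients with [f]. *)
  apply: (@norm_in_order _ ((1 + (- (s * e))%:~R * y) *
    (1 - e%:~R * (e%:~R * g')) * V%:~R) U%:~R (Oz _) _ (Oi U)).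
    apply: (OrM); last exact: Oi.
    apply: (OrM); first exact: Oz.
    by apply: gOr.2 => //; apply: (OrM); [apply: Oi | apply: (OrM) => //; apply: Oi].
  transitivity ((1 - s%:~R ^+ 2 * (e%:~R ^+ 2 * y ^+ 2)) * (1 - e%:~R ^+ 2 * g') * V%:~R +
    f%:R * U%:~R); first by rewrite mulrNz !intrM; ring.
  have := congr1 (fun z : int => z%:~R : algC) UV.
  rewrite /= intrD (intrM _ U) (intrM _ V) => UVC.
  by rewrite s2C mul1r TE -[RHS]UVC [f%:R]pmulrn; ring.
have := gO'.2 _ _ (one 1 erefl) (one (-1) erefl); congr O'.
by rewrite /tr; ring.
Qed.

Lemma f_gt0 : (0 < f)%N.
Proof. by apply: index_gt0 idx _; case: (integers_addgrp sK). Qed.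

Lemma square_data y : OKr y -> y^* = - y -> exists A B : int,
  y ^+ 2 + nu2 (y ^+ 2) = A%:~R /\ y ^+ 2 * nu2 (y ^+ 2) = B%:~R.
Proof.
move=> Oy yJ; have Og := imaginary_square Oy yJ.
have /intrP [A AE] := quad_trace_int (nu2_m cm td) Og.
have /intrP [B BE] := quad_norm_int (refl_m2Q cm td) (nu2_m cm td) Og.
by exists A, B.
Qed.

(** Here [1 - e^2 A + e^4 B] is [1 - e^4] modulo 5, which vanishes for every [e] prime to 5. For
    [y + y^3] and [2 (y - y^3)] the local norms at [e = 1] are instead [-3] and [17] modulo 5, and
    in twice the first element plus the second the cubes cancel, leaving [4 y]. *)
Lemma local_trace5 y (A B : int) k : OKr y -> y^* = - y ->
  y ^+ 2 + nu2 (y ^+ 2) = A%:~R -> y ^+ 2 * nu2 (y ^+ 2) = B%:~R ->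
  k = 1 %[mod 5] -> (forall r, prime r -> (r %| f)%N -> r != 5 -> (r %| k)%N) ->
  (5 %| A)%Z -> (5 %| B + 1)%Z -> O' (8 * k%:R * tr y).
Proof.
move=> Oy yJ yA yB k1 kr A5 B5.
have [gOr Or1 OrM] := integers_subring sKr.
set g := y ^+ 2 in yA yB; set g' := nu2 g in yA yB.
have Oy3 : OKr (y ^+ 3) by rewrite exprS expr2; apply: (OrM) => //; apply: (OrM).
have Oy1 : OKr (y + y ^+ 3) by apply: addgrpD.
have Oy2 : OKr (2 * (y - y ^+ 3)).
  by apply: (OrM); [apply: integers_nat | apply: gOr.2].
have J1 : (y + y ^+ 3)^* = - (y + y ^+ 3) by rewrite rmorphD rmorphXn /= yJ; ring.
have J2 : (2 * (y - y ^+ 3))^* = - (2 * (y - y ^+ 3)).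
  by rewrite rmorphM rmorphB rmorphXn rmorph_nat /= yJ; ring.
have S1 : (y + y ^+ 3) ^+ 2 = g * (1 + g) ^+ 2 by rewrite /g; ring.
have S2 : (2 * (y - y ^+ 3)) ^+ 2 = 4 * g * (1 - g) ^+ 2 by rewrite /g; ring.
have N1 : nu2 (g * (1 + g) ^+ 2) = g' * (1 + g') ^+ 2.
  by rewrite /g'; ring.
have N2 : nu2 (4 * g * (1 - g) ^+ 2) = 4 * g' * (1 - g') ^+ 2.
  by rewrite /g'; ring.
have f0 := f_gt0.
have cop A' B' : ~~ (5 %| local_norm A' B' 1)%Z -> coprimez f (local_norm A' B' k).
  by move=> nd; have := @local_norm_coprime 5 f k A' B' 1 isT f0 k1 kr nd; rewrite mul1r.
have dvd5 (c X Y : int) : ~~ (5 %| c)%Z -> ~~ (5 %| c + A * X + (B + 1) * Y)%Z.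
  by apply: contra; rewrite !rpredDr // dvdz_mulr.
have T1 : O' ((2 * k%:Z)%:~R * tr (y + y ^+ 3)).
  apply: (@trace_in_order _ (A + 2 * (A ^+ 2 - 2 * B) + (A ^+ 3 - 3 * A * B))
    (B * (1 + A + B) ^+ 2)) => //.
  - rewrite S1 N1; transitivity ((g + g') +
      2 * ((g + g') ^+ 2 - 2 * (g * g')) + ((g + g') ^+ 3 - 3 * (g + g') * (g * g'))); first by ring.
    by rewrite yA yB; ring.
  - rewrite S1 N1; transitivity ((g * g') * (1 + (g + g') + (g * g')) ^+ 2); first by ring.
    by rewrite yA yB; ring.
  apply: cop; have := @dvd5 (-3) (-1 - 2 * A - A ^+ 2 + 3 * B + B * (A + 2 + 2 * B))
    (4 + B + B ^+ 2) isT; apply: contra.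
  by congr (_ %| _)%Z; rewrite /local_norm; ring.
have T2 : O' ((2 * k%:Z)%:~R * tr (2 * (y - y ^+ 3))).
  apply: (@trace_in_order _ (4 * (A - 2 * (A ^+ 2 - 2 * B) + (A ^+ 3 - 3 * A * B)))
    (16 * B * (1 - A + B) ^+ 2)) => //.
  - rewrite S2 N2; transitivity (4 * ((g + g') -
      2 * ((g + g') ^+ 2 - 2 * (g * g')) + ((g + g') ^+ 3 - 3 * (g + g') * (g * g')))); first by ring.
    by rewrite yA yB; ring.
  - rewrite S2 N2; transitivity (16 * (g * g') * (1 - (g + g') + (g * g')) ^+ 2); first by ring.
    by rewrite yA yB; ring.
  apply: cop; have := @dvd5 17 (-4 + 8 * A - 4 * A ^+ 2 + 12 * B + 16 * B * (A - 2 - 2 * B))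
    (-16 + 16 * B + 16 * B ^+ 2) isT; apply: contra.
  by congr (_ %| _)%Z; rewrite /local_norm; ring.
have := addgrpD gO' (addgrpMn 2 gO' T1) T2; congr O'.
by rewrite /tr; ring.
Qed.

(* The value at 0 of the quadratic [1 - s A + s ^ 2 B] is interpolated from its values
   at s = 1, 4, 9: ten times it is 15 T(1) - 6 T(4) + T(9). *)
Lemma local_trace y l : OKr y -> y^* = - y -> prime l -> (l %| f)%N ->
  exists2 k : nat, ~~ (l %| k)%N & O' (k%:R * (12 * tr y)).
Proof.
move=> Oy yJ pl lf; have f0 := f_gt0.
have [A [B [yA yB]]] := square_data Oy yJ.
have [k [k1 kr]] := local_idempotent pl f0.
have lk : ~~ (l %| k)%N.
  by rewrite /dvdn k1 modn_small ?prime_gt1.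
have step (e : int) : ~~ (l %| local_norm A B e)%Z -> O' ((2 * (e * k))%:~R * tr y).
  move=> le; apply: (trace_in_order Oy yJ yA yB).
  exact: local_norm_coprime pl f0 k1 kr le.
have close (e c : int) : c * (2 * e) = 12 -> ~~ (l %| local_norm A B e)%Z ->
    exists2 k : nat, ~~ (l %| k)%N & O' (k%:R * (12 * tr y)).
  move=> c12 /step Oe; exists k => //; have := addgrpMz c gO' Oe; congr O'.
  transitivity ((c * (2 * e))%:~R * k%:R * tr y); first by rewrite !intrM -pmulrn; ring.
  by rewrite c12; ring.
(* At 2 and 3 the choice [e = l] makes the local norm 1 modulo [l]; the factor [l] lost in [2 e] is
   absorbed by 12. *)
have [l2|l_neq2] := eqVneq l 2%N.
  apply: (close 2 3) => //; rewrite l2 dvdzE /local_norm.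
  have -> : 1 - 2 ^+ 2 * A + 2 ^+ 4 * B = 1 + 2 * (- 2 * A + 8 * B) :> int by ring.
  by rewrite -dvdzE rpredDr // dvdz_mulr.
have [l3|l_neq3] := eqVneq l 3%N.
  apply: (close 3 2) => //; rewrite l3 /local_norm.
  have -> : 1 - 3 ^+ 2 * A + 3 ^+ 4 * B = 1 + 3 * (- 3 * A + 27 * B) :> int by ring.
  by rewrite rpredDr // dvdz_mulr.
have [n1|/negPn n1] := boolP (~~ (l %| local_norm A B 1)%Z); first exact: (close 1 6).
have [n2|/negPn n2] := boolP (~~ (l %| local_norm A B 2)%Z); first exact: (close 2 3).
have [n3|/negPn n3] := boolP (~~ (l %| local_norm A B 3)%Z); first exact: (close 3 2).
have l5 : l = 5%N.
  have : (l %| 10)%Z.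
    have -> : 10 = 15 * local_norm A B 1 - 6 * local_norm A B 2 + local_norm A B 3 :> int.
      by rewrite /local_norm; ring.
    by apply: rpredD => //; apply: rpredB; apply: dvdz_mull.
  rewrite dvdzE /= -[10%N]/(2 * 5)%N Euclid_dvdM // !dvdn_prime2 //.
  by rewrite (negPf l_neq2) => /eqP.
subst l; have A5 : (5 %| A)%Z.
  have : (5 %| 12 * A)%Z.
    have -> : 12 * A = local_norm A B 2 - 16 * local_norm A B 1 + 5 * 3 :> int.
      by rewrite /local_norm; ring.
    by apply: rpredD; [apply: rpredB => //; apply: dvdz_mull | apply: dvdz_mulr].
  by rewrite Gauss_dvdzr.
have B5 : (5 %| B + 1)%Z.
  have -> : B + 1 = local_norm A B 1 + A by rewrite /local_norm; ring.
  by rewrite rpredD.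
exists (2 * k)%N; first by rewrite Euclid_dvdM // negb_or lk.
have := addgrpMn 3 gO' (local_trace5 Oy yJ yA yB k1 kr A5 B5); congr O'.
by rewrite natrM; ring.
Qed.

Lemma imaginary_trace_in_order y : OKr y -> y^* = - y -> O' (12 * tr y).
Proof.
move=> Oy yJ; apply: (local_multiples gO' f_gt0); last by move=> l; apply: local_trace.
apply: (index_in_order sK oO' idx); split.
  have [_ [_ [_ [_ [KM _]]]]] := sK; apply: (KM); first exact: subfield_nat.
  by apply: (rho_trace_K sK cm td rd); case: Oy.
by have [[_ A1] [_ A2]] := rho_integers rd Oy; rmem.
Qed.

(* For an imaginary element, taking the trace to the reflex field and back is doubling. *)
Lemma imaginary_in_order x : OK x -> O' (24%:R * (x - x^*)).
Proof.
move=> Ox; have [Kx Ax] := Ox; pose w := x - x^*.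
have [a [b [c [e [[Qa Qb Qc Qe] xE]]]]] := (cm_K cm x).1 Kx.
have [dJ a1J a2J] := conj_cm cm; have [q0 [Qp Qq]] := (cm_q0 cm, (cm_p cm, cm_q cm)).
have wE : w = (2 * c + 2 * e * d) * a1.
  by rewrite /w xE !(rmorphD, rmorphM) /= dJ a1J !conj_Crat //; ring.
(* [y] is the trace of [w] under [Phi]; [C] and [E] are its coordinates on [eta] and [m eta],
   obtained from [type_diff]. *)
pose y := t1 w + t2 w; pose C := 2 * c + 2 * e * p / q; pose E := - (2 * e / q).
have tE (t : {rmorphism algC -> algC}) : t w = (2 * c + 2 * e * t d) * t a1.
  by rewrite wE rmorphM rmorphD !rmorphM rmorph_nat (aut_Crat t Qc) (aut_Crat t Qe).
have yE : y = 0 + 0 * m + (C + E * m) * eta.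
  rewrite /y !tE (t2_d td).
  transitivity (2 * c * eta + 2 * e * (t1 d * (t1 a1 - t2 a1))); first by rewrite /eta; ring.
  by rewrite (type_diff cm td) -/eta -/m /C /E; field.
have [QC QE] : C \in Crat /\ E \in Crat by split; rewrite /C /E; rmem.
have Q0 := Crat0.
have AJ : x^* \in Aint.
  by have := Aint_aut (Num.conj : {rmorphism algC -> algC}) x; rewrite Ax.
have Oy : OKr y.
  split; first by apply/(reflex_fieldE sK cm td); exists 0, 0, C, E.
  by rewrite /y rpredD // Aint_aut rpredB.
have yJ : y^* = - y by rewrite yE (quart_conj td) // -/m -/eta; ring.
have [_ _ r1 r2] := rd.
have trE : tr y = 2 * w.
  rewrite /tr yE (@rho_quart a1 t1 t2 rho1) // (@rho_quart a1 t1 t2 rho2) //.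
  rewrite (rho1_m cm td rd) (rho2_m cm td rd) r1 r2.
  transitivity (2 * a1 * (C + E * a2 ^+ 2)); first by ring.
  by rewrite (cm_a2 cm) wE /C /E; field.
have := imaginary_trace_in_order Oy yJ; rewrite trE mulrA; congr (O' (_ * _)).
by ring.
Qed.

End Trace.

(** * Counting the index *)

Section Counting.

Variables (K K0 : cset) (d a1 a2 p q : algC) (nu1 nu2 : {rmorphism algC -> algC}).
Hypotheses (sK : is_subfield K) (cm : cm_data K K0 d a1 a2 p q nu1 nu2).
Variables (O' : cset) (f c : nat).
Hypotheses (oO' : is_order K O') (idx : has_index (ring_of_integers K) O' f).
Hypotheses (c0 : (0 < c)%N)
  (cO' : forall x, ring_of_integers K x -> O' (c%:R * (x - x^*))).

Let OK := ring_of_integers K.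
Let O0 := ring_of_integers (quad d).
Let tau (x : algC) := x - x^*.
Let M := image tau OK.

Let tauB x y : tau (x - y) = tau x - tau y.
Proof. by rewrite /tau rmorphB /=; ring. Qed.

Let sF : is_subfield (quad d) := quad_subfield (cm_d2 cm) (cm_d cm).
Let gO : addgrp OK := integers_addgrp sK.
Let gO0 : addgrp O0 := integers_addgrp sF.
Let gO' : addgrp O' := order_addgrp oO'.
Let gM : addgrp M := image_addgrp tauB gO.

Lemma O0_sub : subset O0 OK.
Proof. by move=> x [Qx Ax]; split=> //; apply: (quad_K cm). Qed.

Lemma O0_conj x : O0 x -> x^* = x.
Proof.
move=> [[a [b [Qa Qb ->]]] _]; rewrite rmorphD rmorphM /= (cm_dJ cm).
by rewrite !conj_Crat.
Qed.

Lemma OK_conj x : OK x -> OK x^*.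
Proof.
move=> [Kx Ax]; split; first exact: (K_conj cm).
by have := Aint_aut (Num.conj : {rmorphism algC -> algC}) x; rewrite Ax.
Qed.

Lemma kernel_tau : seteq (fun x => OK x /\ tau x = 0) O0.
Proof.
move=> x; split=> [[[Kx Ax] /eqP]|Ox].
  by rewrite subr_eq0 eq_sym => /eqP fx; split=> //; apply: (K_fixed cm).
by split; [apply: O0_sub | rewrite /tau O0_conj // subrr].
Qed.

Lemma M_conj z : M z -> OK z /\ z^* = - z.
Proof.
move=> [x [Ox ->]]; split; first by apply: gO.2 => //; apply: OK_conj.
by rewrite rmorphB /= conjCK opprB.
Qed.

Lemma imaginary_product z w : M z -> M w -> O0 (z * w).
Proof.
move=> /M_conj [Oz zJ] /M_conj [Ow wJ]; apply/kernel_tau.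
split; first exact: integersM.
by rewrite /tau rmorphM /= zJ wJ mulrNN subrr.
Qed.

Lemma M_scale r z : O0 r -> M z -> M (r * z).
Proof.
move=> Or [x [Ox ->]]; exists (r * x).
split; first by apply: integersM => //; apply: O0_sub.
by rewrite /tau rmorphM /= (O0_conj Or); ring.
Qed.

Lemma imaginary_exists : exists t, [/\ OK t, t != 0 & t^* = - t].
Proof.
have KE : K = quart d a1 by apply/funext => x; apply/propext; apply: (cm_K cm).
have [t [Ot t0 tJ _]] : exists t, [/\ ring_of_integers (quart d a1) t, t != 0, t^* = - t &
    ring_of_integers (quad d) (t ^+ 2)].
  apply: eta_multiple; [exact: cm_d2 cm|exact: cm_d cm|exact: cm_a1J cm|exact: cm_a10 cm| |].
    by exists p, q; split; [exact: cm_p cm|exact: cm_q cm|exact: cm_a1 cm].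
  by rewrite -KE.
by exists t; rewrite /OK KE.
Qed.

(** Multiplication by a nonzero [mu] in [M] carries [M] onto a finite-index subgroup of [O0], where
    the index of multiplication by [n] is known and can be transferred. *)
Lemma imaginary_index n : (0 < n)%N -> has_index M (principal M n%:R) (n * n).
Proof.
move=> n0; have [t [Ot t0 tJ]] := imaginary_exists.
pose mu := 2 * t.
have mu0 : mu != 0 by rewrite mulf_neq0 // pnatr_eq0.
have Mmu : M mu by exists t; split=> //; rewrite /tau tJ /mu; ring.
pose B := principal M mu; have gB : addgrp B := principal_addgrp mu gM.
have BO : subset B O0 by move=> _ [z [Mz ->]]; apply: imaginary_product.
have Omm : O0 (mu * mu) by apply: imaginary_product.
have mm0 : mu * mu != 0 by rewrite mulf_neq0.
have [N [_ _ idxN]] := quad_norm_index (cm_d2 cm) (cm_d cm) (cm_nu1d cm) Omm mm0.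
have mmB : subset (principal O0 (mu * mu)) B.
  move=> _ [r [Or ->]]; exists (r * mu); split; first exact: M_scale.
  by ring.
have [k [_ [idxB _ _]]] := index_between gO0 gB (principal_addgrp _ gO0) BO mmB idxN.
have nC0 : n%:R != 0 :> algC by rewrite pnatr_eq0 -lt0n.
have nO : subset (principal O0 n%:R) O0.
  by apply: principal_sub => u; apply: addgrpMn.
have nB : subset (principal B n%:R) B.
  by apply: principal_sub => u; apply: addgrpMn.
have idxn := quad_index_nat (cm_d2 cm) (cm_d cm) n0.
have {}idxn := (index_principal_transfer _ gO0 gB nC0 BO nO nB idxB).1 idxn.
have muV : mu^-1 != 0 by rewrite invr_eq0.
apply: has_index_ext (index_principal muV idxn) => z; split.
- by move=> [_ [[u [Mu ->]] ->]]; rewrite mulKf.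
- by move=> Mz; exists (mu * z); rewrite mulKf //; split=> //; exists z.
- by move=> [_ [[_ [[u [Mu ->]] ->]] ->]]; exists u; rewrite mulrCA mulKf.
- move=> [u [Mu ->]]; exists (n%:R * (mu * u)).
  split; last by rewrite mulrCA mulKf.
  by exists (mu * u); split=> //; exists u.
Qed.

Variables (nD : nat).
Hypothesis idxD : has_index (ring_of_integers K0) (rel_disc K K0) nD.

Lemma index_square_dvd : (f ^ 2 %| ((2 * c) ^ 2) ^ 2 * ((c ^ 2) ^ 2 * nD))%N.
Proof.
have [O'O [O'1 [_ [O'M _]]]] := oO'.
have K0E : K0 = quad d by apply/funext => x; apply/propext; apply: (cm_K0 cm).
have [h [g [idxh idxg ->]]] := index_exact gO gO' O'O tauB idx.
have dvd_h : (h %| (2 * c) ^ 2)%N.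
  have c2 : (0 < 2 * c)%N by rewrite muln_gt0.
  have gtO' : addgrp (image tau O') := image_addgrp tauB gO'.
  have sub1 : subset (image tau O') M by move=> _ [x [/O'O Ox ->]]; exists x.
  (* [tau] doubles imaginary elements, so applying it to [c * tau x], which lies in [O'], gives
     [2 c * tau x]. *)
  have sub2 : subset (principal M (2 * c)%:R) (image tau O').
    move=> _ [_ [[x [Ox ->]] ->]]; exists (c%:R * tau x); split; first exact: cO'.
    by rewrite /tau rmorphM rmorphB rmorph_nat /= conjCK natrM; ring.
  have [h' [k [idxh' _ eqh]]] := index_between gM gtO' (principal_addgrp _ gM) sub1 sub2
    (imaginary_index c2).
  by rewrite -mulnn eqh (index_unique gtO' idxh' idxh) dvdn_mulr.
have dvd_g : (g ^ 2 %| (c ^ 2) ^ 2 * nD)%N.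
  pose B x := O' x /\ tau x = 0; pose D := rel_disc K K0.
  have gB : addgrp B.
    split; first by split; [case: gO' | rewrite /tau rmorph0 subrr].
    move=> x y [Ox tx] [Oy ty]; split; first exact: gO'.2.
    by rewrite tauB tx ty subrr.
  have BO : subset B O0 by move=> x [/O'O Ox tx]; apply/kernel_tau.
  have idxB : has_index O0 B g by apply: has_index_ext idxg; [exact: kernel_tau|].
  (* The discriminant generators are squares of values [tau (x1 * x2^* )]. *)
  have discE x1 x2 : OK x1 -> OK x2 -> M (x1 * x2^* - x1^* * x2).
    move=> Ox1 Ox2; exists (x1 * x2^*); split; first by apply: integersM => //; apply: OK_conj.
    by rewrite /tau rmorphM /= conjCK.
  have gD : addgrp D.
    split; first by exists [::]; rewrite big_nil.
    move=> _ _ [s [sP ->]] [s' [s'P ->]].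
    exists (s ++ [seq (- i.1, i.2) | i <- s']); split.
      move=> i; rewrite mem_cat => /orP [/sP //|/mapP [j /s'P [Oj Gj] ->]].
      by split=> //=; apply: addgrpN => //; apply: integers_addgrp; rewrite K0E.
    rewrite big_cat big_map /= -sumrN; congr (_ + _).
    by apply: eq_bigr => i _; rewrite mulNr.
  have DO : subset D O0.
    move=> _ [s [sP ->]]; rewrite big_seq; apply: addgrp_sum => // i /sP [Oi].
    move=> [x1 [x2 [Ox1 [Ox2 ->]]]]; rewrite K0E in Oi.
    by apply: integersM => //; rewrite expr2; apply: imaginary_product; apply: discE.
  pose I := principal D (c ^ 2)%:R.
  have IB : subset I B.
    move=> _ [_ [[s [sP ->]] ->]]; rewrite big_distrr /= big_seq.
    apply: addgrp_sum => // i /sP [Oi [x1 [x2 [Ox1 [Ox2 ->]]]]].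
    rewrite K0E in Oi; set mu := _ - _.
    have Mmu : M mu by apply: discE.
    have MO z : M z -> O' (c%:R * z) by move=> [x [Ox ->]]; apply: cO'.
    (* One factor [c] for each [mu]: both [i.1 * mu] and [mu] are in [M], so their [c]-multiples lie
       in [O'], and the product of two imaginary numbers is real. *)
    have -> : (c ^ 2)%:R * (i.1 * mu ^+ 2) = (c%:R * (i.1 * mu)) * (c%:R * mu).
      by rewrite natrX; ring.
    split; first by apply: O'M; apply: MO => //; apply: M_scale.
    have [_ muJ] := M_conj Mmu.
    by rewrite /tau !rmorphM !rmorph_nat /= muJ (O0_conj Oi); ring.
  have [w Ow [wQ span]] := quad_integer_basis (cm_d2 cm) (cm_d cm).
  have Iw x : I x -> I (w * x).
    move=> [_ [[s [sP ->]] ->]].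
    exists (\sum_(i <- [seq (w * i.1, i.2) | i <- s]) i.1 * i.2); split.
      exists [seq (w * i.1, i.2) | i <- s]; split=> // _ /mapP [j /sP [Oj Gj] ->].
      by split=> //=; rewrite K0E in Oj *; apply: integersM.
    rewrite big_map mulrCA; congr (_ * _); rewrite big_distrr.
    by apply: eq_bigr => i _ /=; rewrite mulrA.
  have B1 : B 1 by split=> //; rewrite /tau rmorph1 subrr.
  have Ig := ideal_in_suborder gO0 (integers1 sF) Ow span gB B1 BO idxB IB Iw
    (integersM sF Ow Ow).
  have g0 : (0 < g)%N by apply: index_gt0 idxB _; case: gO0.
  have cc0 : (0 < c ^ 2)%N by rewrite expn_gt0 c0.
  have ccC : (c ^ 2)%:R != 0 :> algC by rewrite pnatr_eq0 -lt0n.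
  have idxD' : has_index O0 D nD by rewrite /O0 -K0E.
  have nO n : subset (principal O0 n%:R) O0.
    by apply: principal_sub => u; apply: addgrpMn.
  have subI : subset I (principal O0 (c ^ 2)%:R) by move=> _ [x [/DO Ox ->]]; exists x.
  have idxI := index_tower gO0 (principal_addgrp _ gO0) (nO _) subI
    (quad_index_nat (cm_d2 cm) (cm_d cm) cc0) (index_principal ccC idxD').
  have gI : addgrp I := principal_addgrp _ gD.
  (* [I] has index [c^4 nD] in [O0] and lies in [g O0], which has index [g^2]. *)
  have [gg [k [idxgg _ eqk]]] := index_between gO0 (principal_addgrp _ gO0) gI (nO g) Ig idxI.
  have idxg2 := quad_index_nat (cm_d2 cm) (cm_d cm) g0.
  have eqgg := index_unique (principal_addgrp _ gO0) idxgg idxg2.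
  by rewrite -[((c ^ 2) ^ 2)%N]mulnn eqk eqgg mulnn dvdn_mulr.
by rewrite expnMn dvdn_mul // dvdn_exp2r.
Qed.

End Counting.

(* Stated for variables so that the large powers are never evaluated. *)
Lemma constant_dvd a b n :
  (((a * (a ^ 3 * b)) ^ 2) ^ 2 * (((a ^ 3 * b) ^ 2) ^ 2 * n) %| a ^ 40 * b ^ 16 * n)%N.
Proof.
rewrite [(a * (a ^ 3 * b))%N]mulnA -expnS mulnA; apply: dvdn_mul; last exact: dvdnn.
rewrite -!(expnM _ 2) (expnMn (a ^ 4)) (expnMn (a ^ 3)) -(expnM a 4) -(expnM a 3).
rewrite mulnACA -!expnD.
by apply: dvdn_mul; apply: dvdn_exp2l.
Qed.

Theorem theorem2p1 (K K0 : algC -> Prop) (Phi Phir : seq (algC -> algC))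
    (O' : algC -> Prop) (f nD : nat) :
  quartic_CM K K0 ->
  ~ biquadratic K ->
  ~ field_isomorphic K Qzeta5 ->
  CM_type K Phi ->
  reflex_type K Phi Phir ->
  is_order K O' -> conj_stable O' ->
  has_index (ring_of_integers K) O' f ->
  (forall a, S_kernel K Phi Phir (ring_of_integers K) f a ->
             S_kernel K Phi Phir O' f a) ->
  has_index (ring_of_integers K0) (rel_disc K K0) nD ->
  (f ^ 2 %| 2 ^ 40 * 3 ^ 16 * nD)%N.
Proof.
move=> CM nbiq nz5 CMPhi RPhi oO' _ idx kernel idxD.
have sK : is_subfield K by case: CM.
have [d [a1 [a2 [p [q [nu1 [nu2 cm]]]]]]] := CM_structure CM nbiq.
have [t1 [t2 td]] := CM_type_data sK cm CMPhi.
have [rho1 [rho2 rd]] := reflex_type_data sK cm td RPhi.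
(* 24 is spelled [2 ^ 3 * 3] to match [constant_dvd] at [a = 2], [b = 3]. *)
have O'24 x : ring_of_integers K x -> O' ((2 ^ 3 * 3)%N%:R * (x - x^*)).
  exact: (imaginary_in_order sK cm td rd nbiq nz5 oO' idx kernel).
apply: dvdn_trans (index_square_dvd sK cm oO' idx _ O'24 idxD) _; first by [].
exact: constant_dvd.
Qed.
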